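(* Suppose that $\mathsf H:\mathcal H\to\mathbb R$ is locally Lipschitz (i.e. Lipschitz on every ball of finite radius) and $\mathcal C^*$-increasing, and that $\psi:\mathcal C\to\mathbb R$ is $\mathcal C^*$-increasing and satisfies, for some $C>0$ and $p\in[1,2)$, $$|\psi(\mu)-\psi(\nu)|\le C|\mu-\nu|_{L^p},\qquad\forall\mu,\nu\in\mathcal C.$$ Let $\mathfrak J_{\mathrm{good}}$ be a good collection of partitions. For every $j\in\mathfrak J_{\mathrm{good}}$, let $f_j$ be the unique viscosity solution of $\mathrm{HJ}(\mathcal H^j,\mathcal C^j,\mathsf H^j;\psi^j)$ in the class $\mathcal S_j$. Then $(f_j^\uparrow)_{j\in\mathfrak J_{\mathrm{good}}}$ converges in the local uniform topology to a Lipschitz function $f:\mathbb R_+\times\mathcal C\to\mathbb R$ satisfying $f(0,\cdot)=\psi$, $$\sup_{t\in\mathbb R_+}\|f(t,\cdot)\|_{\mathrm{Lip}}\le\|\psi\|_{\mathrm{Lip}},\qquad \sup_{\mu\in\mathcal C}\|f(\cdot,\mu)\|_{\mathrm{Lip}}\le\sup_{\iota\in\mathcal H,\ |\iota|_{\mathcal H}\le\|\psi\|_{\mathrm{Lip}}}|\mathsf H(\iota)|.$$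
   Context: $\mathbb R_+=[0,\infty)$. Fix an integer $D\ge1$. $\mathbb S^D$ is the space of real symmetric $D\times D$ matrices with inner product $a\cdot b=\mathrm{tr}(ab)$ and norm $|a|=\sqrt{a\cdot a}$; $\mathbb S^D_+$ is the cone of positive semidefinite matrices; $a\ge b$ means $a-b\in\mathbb S^D_+$. $\mathcal H=L^2([0,1);\mathbb S^D)$ (Lebesgue measure) with $\langle\iota,\kappa\rangle_{\mathcal H}=\int_0^1\iota(s)\cdot\kappa(s)\,ds$ and norm $|\cdot|_{\mathcal H}$; $|\kappa|_{L^p}=(\int_0^1|\kappa(s)|^pds)^{1/p}$. $\mathcal C\subset\mathcal H$ is the closed convex cone of (classes of) functions $\mu:[0,1)\to\mathbb S^D_+$ that are square-integrable, right-continuous with left limits, and increasing, i.e. $\mu(t)-\mu(s)\in\mathbb S^D_+$ for $t\ge s$. For a closed convex cone $K$ in a Hilbert space $\mathcal X$, $K^*=\{x\in\mathcal X:\langle x,y\rangle\ge0\ \forall y\in K\}$. A function $g$ on a subset $\mathcal D$ of a Hilbert space is $K$-increasing if $g(x)\ge g(x')$ whenever $x,x'\in\mathcal D$, $x-x'\in K$. Lipschitz norms of functions on subsets of a Hilbert space are with respect to the Hilbert norm. Partitions. A partition is a tuple $j=(t_1,\dots,t_n)$ with $0<t_1<\dots<t_n=1$; $|j|=n$, $t_0=0$. Partitions are ordered by inclusion of the underlying sets. A collection of partitions is directed if any two members are both included in a third member; generating if it is directed and the sigma-algebras generated by the intervals $[t_{k-1},t_k)$, $1\le k\le|j|$, over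 all its members $j$, together generate the Borel sigma-algebra of $[0,1)$; good if it is generating and consists only of uniform partitions ($t_k=k/n$). For nets indexed by a directed collection, convergence $x_j\to x$ means: for each neighborhood $\mathcal N$ of $x$ there is a member $j_{\mathcal N}$ with $x_j\in\mathcal N$ for all members $j\supset j_{\mathcal N}$. Local uniform topology: uniform convergence on every closed metric ball of finite radius. For a partition $j$: $\mathcal H^j=(\mathbb S^D)^{|j|}$ with $\langle x,y\rangle_{\mathcal H^j}=\sum_k(t_k-t_{k-1})x_k\cdot y_k$; $\mathcal C^j=\{x\in\mathcal H^j:0\le x_1\le\dots\le x_{|j|}\}$, with dual cone $(\mathcal C^j)^*\subset\mathcal H^j$; $\mathrm p_j:\mathcal H\to\mathcal H^j$, $(\mathrm p_j\iota)_k=\frac1{t_k-t_{k-1}}\int_{t_{k-1}}^{t_k}\iota(s)ds$; $\mathrm l_j:\mathcal H^j\to\mathcal H$, $\mathrm l_jx=\sum_kx_k\mathbf 1_{[t_{k-1},t_k)}$; $\mathsf H^j=\mathsf H\circ\mathrm l_j$ on $\mathcal H^j$; $\psi^j=\psi\circ\mathrm l_j$ on $\mathcal C^j$; for $g:\mathbb R_+\times\mathcal C^j\to\mathbb R$, $g^\uparrow(t,\mu)=g(t,\mathrm p_j\mu)$ on $\mathbb R_+\times\mathcal C$. The class $\mathcal S_j$ is the set of $g:\mathbb R_+\times\mathcal C^j\to\mathbb R$ with $\sup_t\|g(t,\cdot)\|_{\mathrm{Lip}}<\infty$, $\sup_{t>0,x\in\mathcal C^j}|g(t,x)-g(0,x)|/t<\infty$,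 and $g(t,\cdot)$ $(\mathcal C^j)^*$-increasing for every $t\ge0$. (Under the stated hypotheses it is known that exactly one viscosity solution of $\mathrm{HJ}(\mathcal H^j,\mathcal C^j,\mathsf H^j;\psi^j)$ exists in $\mathcal S_j$.) Viscosity solutions. Let $\mathcal X$ be a separable Hilbert space, $\mathcal D\subset\mathcal X$, $\mathsf G:\mathcal X\to\mathbb R$ continuous. A function $\phi:(0,\infty)\times\mathcal D\to\mathbb R$ is smooth if at every $(t,x)$ there is a unique $(\partial_t\phi(t,x),\nabla\phi(t,x))\in\mathbb R\times\mathcal X$ with $\phi(s,y)-\phi(t,x)=\partial_t\phi(t,x)(s-t)+\langle\nabla\phi(t,x),y-x\rangle+o(|s-t|+|y-x|)$ as $(s,y)\to(t,x)$ in $(0,\infty)\times\mathcal D$, the error is in fact $O(|s-t|^2+|y-x|^2)$ at every point, and $(t,x)\mapsto(\partial_t\phi,\nabla\phi)$ is continuous. A continuous $f:\mathbb R_+\times\mathcal D\to\mathbb R$ is a viscosity subsolution (resp. supersolution) of $\mathrm{HJ}(\mathcal X,\mathcal D,\mathsf G)$ if for every $(t,x)\in(0,\infty)\times\mathcal D$ and smooth $\phi$ such that $f-\phi$ has a local maximum (resp. minimum) at $(t,x)$ relative to $(0,\infty)\times\mathcal D$, $(\partial_t\phi-\mathsf G(\nabla\phi))(t,x)\le0$ (resp. $\ge0$); a viscosity solution is both, and it solves $\mathrm{HJ}(\mathcal X,\mathcal D,\mathsf G;\psi)$ if also $f(0,\cdot)=\psi$. *)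

(* Defs.v *)
From HB Require Import structures.
From mathcomp Require Import all_boot all_order all_algebra.
From mathcomp Require Import all_classical all_reals all_analysis.
Import Order.TTheory GRing.Theory Num.Theory.
Import numFieldTopology.Exports numFieldNormedType.Exports.

Set Implicit Arguments.
Unset Strict Implicit.
Unset Printing Implicit Defensive.

Local Open Scope classical_set_scope.
Local Open Scope ring_scope.

(* A (pre-)Hilbert space is given by an ambient module V, the set X of its
   vectors and the inner product ip (only meaningful on X).  For L^2 the vectors
   are representatives of classes, so ip is only positive semidefinite there:
   functions on L^2 are functions of representatives, and those which are
   Lipschitz for the induced seminorm descend to classes. *)

Section lipschitz.
Context {R : realType} {V : zmodType}.

(* Least Lipschitz constant of g on A for the (semi)norm N, +oo if there is
   none.  Unlike the supremum of difference quotients with the convention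
   x / 0 = 0, it is +oo if g separates points at distance 0. *)
Definition lipnorm (A : set V) (N : V -> R) (g : V -> R) : \bar R :=
  ereal_inf [set L%:E | L in [set L : R | 0 <= L /\
    forall x y, A x -> A y -> `|g x - g y| <= L * N (x - y)]].

Definition cone_increasing (A K : set V) (g : V -> R) : Prop :=
  forall x x', A x -> A x' -> K (x - x') -> g x' <= g x.

End lipschitz.

Section inner_product.
Context {R : realType} {V : lmodType R}.
Variables (X : set V) (ip : V -> V -> R).

Definition ipnorm (x : V) : R := Num.sqrt (ip x x).

Definition dual_cone (K : set V) : set V :=
  [set x | X x /\ forall y, K y -> 0 <= ip x y].

Definition locally_lipschitz (g : V -> R) : Prop :=
  forall (c : V) (r : R), X c ->
    (lipnorm [set x | X x /\ (ipnorm (x - c) <= r)%R] ipnorm g < +oo)%E.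

Definition tnorm (z : R * V) : R := `|z.1| + ipnorm z.2.

Definition cylinder (D : set V) : set (R * V) :=
  [set z | 0 <= z.1 /\ D z.2].

Definition open_cylinder (D : set V) : set (R * V) :=
  [set z | 0 < z.1 /\ D z.2].

Definition closed_balls (A : set (R * V)) : set (set (R * V)) :=
  [set B | exists c r, A c /\ B = [set z | A z /\ tnorm (z - c) <= r]].

End inner_product.

Section viscosity.
Context {R : realType} {V : lmodType R}.
Variables (X : set V) (ip : V -> V -> R) (D : set V).
Let N := tnorm ip.
Let Q := open_cylinder D.

Definition remainder (phi : R * V -> R) (z d w : R * V) : R :=
  phi w - phi z - (d.1 * (w.1 - z.1) + ip d.2 (w.2 - z.2)).

(* d = (time derivative, gradient) of phi at z, relative to (0,oo) x D. *)
Definition is_differential (phi : R * V -> R) (z d : R * V) : Prop :=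
  X d.2 /\
  forall e : R, 0 < e -> exists2 del : R, 0 < del &
    forall w, Q w -> N (w - z) < del ->
      `|remainder phi z d w| <= e * N (w - z).

Definition smooth (phi : R * V -> R) (dphi : R * V -> R * V) : Prop :=
  forall z, Q z ->
  [/\ is_differential phi z (dphi z),
      forall d, is_differential phi z d -> d = dphi z,
      exists C del : R, 0 < del /\
        forall w, Q w -> N (w - z) < del ->
          `|remainder phi z (dphi z) w| <=
            C * (`|w.1 - z.1| ^+ 2 + ipnorm ip (w.2 - z.2) ^+ 2)
    & forall e : R, 0 < e -> exists2 del : R, 0 < del &
        forall w, Q w -> N (w - z) < del -> N (dphi w - dphi z) < e].

Definition local_max (g : R * V -> R) (z : R * V) : Prop :=
  exists2 del : R, 0 < del &
    forall w, Q w -> N (w - z) < del -> g w <= g z.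

Definition local_min (g : R * V -> R) (z : R * V) : Prop :=
  exists2 del : R, 0 < del &
    forall w, Q w -> N (w - z) < del -> g z <= g w.

Definition continuous_on_cylinder (f : R * V -> R) : Prop :=
  forall z, cylinder D z -> forall e : R, 0 < e -> exists2 del : R, 0 < del &
    forall w, cylinder D w -> N (w - z) < del -> `|f w - f z| < e.

Definition viscosity_subsolution (G : V -> R) (f : R * V -> R) : Prop :=
  continuous_on_cylinder f /\
  forall z phi dphi, Q z -> smooth phi dphi ->
    local_max (fun w => f w - phi w) z -> (dphi z).1 - G (dphi z).2 <= 0.

Definition viscosity_supersolution (G : V -> R) (f : R * V -> R) : Prop :=
  continuous_on_cylinder f /\
  forall z phi dphi, Q z -> smooth phi dphi ->
    local_min (fun w => f w - phi w) z -> 0 <= (dphi z).1 - G (dphi z).2.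

Definition viscosity_solution (G : V -> R) (f : R * V -> R) : Prop :=
  viscosity_subsolution G f /\ viscosity_supersolution G f.

Definition solves_HJ (G psi : V -> R) (f : R * V -> R) : Prop :=
  viscosity_solution G f /\ forall x, D x -> f (0, x) = psi x.

End viscosity.

Section symmetric_matrices.
Context {R : realType} {D : nat}.

Definition symm (a : 'M[R]_D) : Prop := a^T = a.

Definition mxip (a b : 'M[R]_D) : R := \tr (a *m b).

Definition mxnorm2 (a : 'M[R]_D) : R := ipnorm mxip a.

Definition psd (a : 'M[R]_D) : Prop :=
  symm a /\ forall v : 'cV[R]_D, 0 <= (v^T *m a *m v) 0 0.

End symmetric_matrices.

Section L2.
Context {R : realType} {D : nat}.
Let lambda := @lebesgue_measure R.
Let I01 : set R := `[0, 1[.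

Definition L2 : set (R -> 'M[R]_D) :=
  [set iota | [/\ forall s, I01 s -> symm (iota s),
    forall a b, measurable_fun I01 (fun s => iota s a b)
    & (\int[lambda]_(s in I01) (mxnorm2 (iota s) ^+ 2)%:E < +oo)%E]].

Definition L2ip (iota kappa : R -> 'M[R]_D) : R :=
  \int[lambda]_(s in I01) mxip (iota s) (kappa s).

Definition L2norm : (R -> 'M[R]_D) -> R := ipnorm L2ip.

Definition Lpnorm (p : R) (kappa : R -> 'M[R]_D) : R :=
  (\int[lambda]_(s in I01) (mxnorm2 (kappa s) `^ p)) `^ p^-1.

Definition cadlag (mu : R -> 'M[R]_D) : Prop :=
  (forall t, 0 <= t < 1 -> mu s @[s --> t^'+] --> mu t) /\
  (forall t, 0 < t < 1 -> exists l : 'M[R]_D, mu s @[s --> t^'-] --> l).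

(* The cone C, through the cadlag representatives of its elements. *)
Definition mono_paths : set (R -> 'M[R]_D) :=
  [set mu | [/\ L2 mu, forall s, I01 s -> psd (mu s), cadlag mu
    & forall s t, I01 s -> I01 t -> s <= t -> psd (mu t - mu s)]].

Definition L2dual : set (R -> 'M[R]_D) := dual_cone L2 L2ip mono_paths.

End L2.

Section subdivisions.
Context {R : realType}.

(* [:: t_1; ...; t_n] with 0 < t_1 < ... < t_n = 1; in particular n >= 1. *)
Record subdivision := Subdivision {
  points :> seq R ;
  points_sorted : path <%R 0 points ;
  points_last : last 0 points = 1 }.

(* The k-th interval (counted from 0) is [lpt j k, rpt j k[. *)
Definition lpt (j : subdivision) (k : nat) : R := nth 0 (0 :: points j) k.
Definition rpt (j : subdivision) (k : nat) : R := nth 0 (points j) k.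
Definition cell (j : subdivision) (k : nat) : set R := `[lpt j k, rpt j k[.
Definition width (j : subdivision) (k : nat) : R := rpt j k - lpt j k.

Definition refined_by (j j' : subdivision) : Prop := {subset points j <= points j'}.

Definition directed (J : set subdivision) : Prop :=
  forall j1 j2, J j1 -> J j2 -> exists2 j3, J j3 & refined_by j1 j3 /\ refined_by j2 j3.

Definition generating (J : set subdivision) : Prop :=
  directed J /\
  <<s `[0, 1[, \bigcup_(j in J)
      <<s `[0, 1[, [set cell j k | k in [set k | (k < size j)%N]] >> >> =
  [set A : set R | measurable A /\ A `<=` `[0, 1[].

Definition uniform_subdivision (j : subdivision) : Prop :=
  forall k, (k < size j)%N -> rpt j k = k.+1%:R / (size j)%:R.

Definition good (J : set subdivision) : Prop :=
  generating J /\ forall j, J j -> uniform_subdivision j.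

Definition tails (J : set subdivision) : set_system subdivision :=
  [set P | exists2 j0, J j0 & forall j, J j -> refined_by j0 j -> P j].

End subdivisions.
Arguments subdivision R : clear implicits.

Section discretisation.
Context {R : realType} {D : nat}.
Implicit Type j : subdivision R.

Definition Hvec j : lmodType R := {ffun 'I_(size j) -> 'M[R]_D}.

Definition Hj j : set (Hvec j) := [set x | forall k, symm (x k)].

Definition Hjip j (x y : Hvec j) : R :=
  \sum_(k < size j) width j k * mxip (x k) (y k).

Definition Cj j : set (Hvec j) :=
  [set x | (forall k, psd (x k)) /\
           forall k l : 'I_(size j), (k <= l)%N -> psd (x l - x k)].

Definition Cjdual j : set (Hvec j) := dual_cone (@Hj j) (@Hjip j) (@Cj j).

Definition pj j (iota : R -> 'M[R]_D) : Hvec j :=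
  [ffun k : 'I_(size j) => \matrix_(a, b)
    ((width j k)^-1 * \int[lebesgue_measure]_(s in cell j k) iota s a b)].

Definition lj j (x : Hvec j) : R -> 'M[R]_D :=
  fun s => \sum_(k < size j) \1_(cell j k) s *: x k.

Definition lift_up j (g : R * Hvec j -> R) : R * (R -> 'M[R]_D) -> R :=
  fun z => g (z.1, pj j z.2).

Definition class_S j (g : R * Hvec j -> R) : Prop :=
  [/\ (ereal_sup [set lipnorm (@Cj j) (ipnorm (@Hjip j)) (fun x => g (t, x))
        | t in [set t | (0 <= t)%R]] < +oo)%E,
      (ereal_sup [set (`|g (t, x) - g (0%R, x)| / t)%:E
        | t in [set t : R | (0 < t)%R] & x in @Cj j] < +oo)%E
    & forall t, 0 <= t ->
        cone_increasing (@Cj j) (@Cjdual j) (fun x => g (t, x))].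

End discretisation.
Arguments Hvec {R} D j.

(* Main.v *)
Require Import Defs.
From HB Require Import structures.
From mathcomp Require Import all_boot all_order all_algebra.
From mathcomp Require Import all_classical all_reals all_analysis.
From mathcomp Require Import measurable_realfun ring lra.
Import Order.TTheory GRing.Theory Num.Theory.
Import numFieldTopology.Exports numFieldNormedType.Exports.

Set Implicit Arguments.
Unset Strict Implicit.
Unset Printing Implicit Defensive.

Local Open Scope classical_set_scope.
Local Open Scope ring_scope.

(* On the cone C^j a sub- or supersolution satisfies its inequality also at
   boundary points, so that doubling the variables compares solutions without
   boundary conditions.  If the partition i is coarser than j, the kernel
   |x - p_i l_j y| has gradients with the same lift to L^2 in both variables, so
   f_i and f_j are compared through the distance of their initial data,
   psi(l_i p_i l_j y) versus psi(l_j y).  For a monotone path mu the L^p norm of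
   mu - l_i p_i mu is o(1) |mu|_{L^2} as |i| grows since p < 2, which makes the
   net Cauchy on balls.  The same doubling, with the kernels L |x - y| and
   M |t - s| (L the Lipschitz constant of psi, M the supremum of |H| on the ball
   of radius L), gives the two Lipschitz bounds.  All kernels have bounded
   gradients, and a penalty with finite speed of propagation localises, so that
   a locally Lipschitz H is enough. *)

(** * Smoothed norms and Euclidean cones *)

(** The obstacle is that one speed and one penalty must serve all partitions, over an unbounded time
    interval, although [H] is only locally Lipschitz. The penalty is a function of sqrt(1 + |x|^2) +
    vel t. Its time derivative strictly exceeds vel times the norm of its space gradient, because
    |x| < sqrt(1 + |x|^2), so an interior maximum is contradictory without any further term in time.

    The time constant supplied by [class_S] may depend on the partition. A first comparison, with
    psi + M t and psi - M t, replaces it by [M]. These two functions are barriers for the constant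
    Hamiltonians M and -M, which bound [H] wherever the kernel gradients lie.

    Initial data have to be compared on the whole unbounded cone, not on a ball. The projection
    error is therefore kept proportional to the norm, and the slope [delta] of the penalty absorbs
    it. On a fixed ball what remains is [delta] times a bounded weight. *)

Section smoothed_norm.
Context {R : realType}.
Implicit Types e p q r : R.

(** Smooth substitute for |q|: within [e] of it, of slope less than 1, and of curvature at most
    1/e. *)
Definition snorm e q : R := Num.sqrt (e ^+ 2 + q ^+ 2).

Lemma snormN e q : snorm e (- q) = snorm e q.
Proof. by rewrite /snorm sqrrN. Qed.

Lemma snorm_gt0 e q : 0 < e -> 0 < snorm e q.
Proof. by move=> e0; rewrite sqrtr_gt0 ltr_wpDr ?sqr_ge0 ?exprn_gt0. Qed.

Lemma sqr_snorm e q : snorm e q ^+ 2 = e ^+ 2 + q ^+ 2.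
Proof. by rewrite sqr_sqrtr // addr_ge0 ?sqr_ge0. Qed.

Lemma le_sqr_abs p q : 0 <= q -> p ^+ 2 <= q ^+ 2 -> `|p| <= q.
Proof. by move=> q0 pq; rewrite -(ger0_norm q0) -ler_sqr ?nnegrE // !real_normK ?num_real. Qed.

Lemma snorm_ge e q : `|q| <= snorm e q.
Proof. by apply: le_sqr_abs; rewrite ?sqrtr_ge0 // sqr_snorm lerDr sqr_ge0. Qed.

Lemma snorm_gee e q : 0 <= e -> e <= snorm e q.
Proof.
move=> e0; apply: le_trans (ler_norm _) _.
by apply: le_sqr_abs; rewrite ?sqrtr_ge0 // sqr_snorm lerDl sqr_ge0.
Qed.

Lemma snorm_gt e q : 0 < e -> `|q| < snorm e q.
Proof.
move=> e0; rewrite -ltr_sqr ?nnegrE ?sqrtr_ge0 // sqr_snorm real_normK ?num_real //.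
by rewrite ltrDr exprn_gt0.
Qed.

Lemma snorm_le e q : 0 <= e -> snorm e q <= e + `|q|.
Proof.
move=> e0; rewrite -ler_sqr ?nnegrE ?sqrtr_ge0 ?addr_ge0 // sqr_snorm.
have := normr_ge0 q; rewrite -(real_normK (num_real q)); nra.
Qed.

Lemma snorm_le_quad e q : 0 < e -> snorm e q <= e + q ^+ 2 / (2 * e).
Proof.
move=> e0; have h : 0 <= q ^+ 2 / (2 * e) by rewrite divr_ge0 ?sqr_ge0 //; lra.
have e0' := ltW e0.
rewrite -ler_sqr ?nnegrE ?sqrtr_ge0 ?addr_ge0 // sqr_snorm.
have -> : q ^+ 2 = 2 * e * (q ^+ 2 / (2 * e)) by field; lra.
by set x := _ / _ in h *; have -> : 2 * e * x / (2 * e) = x by [field; lra|]; nra.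
Qed.

Lemma snorm_lip e p q : snorm e p <= snorm e q + `|p - q|.
Proof.
rewrite -ler_sqr ?nnegrE ?addr_ge0 ?sqrtr_ge0 // sqrrD !sqr_snorm.
rewrite real_normK ?num_real //.
have := ler_pM (normr_ge0 _) (normr_ge0 (p - q)) (snorm_ge e q) (lexx `|p - q|).
have := ler_norm (q * (p - q)); rewrite normrM; nra.
Qed.

(* One-sided second-order expansion: [q + 2 c + d] stands for the square
   of a displaced vector. *)
Lemma snorm_expansion e p q c d : 0 < e -> 0 <= d ->
  p ^+ 2 = q ^+ 2 + 2 * c + d ->
  snorm e p <= snorm e q + c / snorm e q + d / (2 * e).
Proof.
move=> e0 d0 pE; have S0 := snorm_gt0 q e0; have eS := snorm_gee q (ltW e0).
have SE := sqr_snorm e q; have TE := sqr_snorm e p.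
have T0 := snorm_gt0 p e0; move: (snorm e p) (snorm e q) T0 S0 eS SE TE.
move=> T S T0 S0 eS SE TE.
(* Concavity of the square root: [T] lies below the tangent at [S ^+ 2]. *)
have h : T <= S + (2 * c + d) / (2 * S).
  have -> : 2 * c + d = T ^+ 2 - S ^+ 2 by rewrite TE SE pE; ring.
  have -> : S + (T ^+ 2 - S ^+ 2) / (2 * S) = (T ^+ 2 + S ^+ 2) / (2 * S).
    by field; lra.
  by rewrite ler_pdivlMr; [have := sqr_ge0 (T - S); nra|lra].
apply: le_trans h _; rewrite mulrDl addrA lerD //.
  by rewrite lerD2l invfM mulrACA divff ?mul1r // ; lra.
by rewrite ler_wpM2l // lef_pV2 ?posrE; lra.
Qed.

End smoothed_norm.

(** Positivity is asked on [X] only: tr(ab) is definite on symmetric matrices but not on all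
    matrices. Definiteness fails for representatives in L^2, so this structure is used for matrices
    and for the spaces H^j. *)
Record euclid {R : realType} {V : lmodType R} (X : set V) (ip : V -> V -> R)
    : Prop := Euclid {
  euclid0 : X 0;
  euclidD : forall x y, X x -> X y -> X (x + y);
  euclidZ : forall a x, X x -> X (a *: x);
  ipC : forall x y, ip x y = ip y x;
  ipDl : forall x y z, ip (x + y) z = ip x z + ip y z;
  ipZl : forall a x y, ip (a *: x) y = a * ip x y;
  ip_ge0 : forall x, X x -> 0 <= ip x x;
  ip_eq0 : forall x, X x -> ip x x = 0 -> x = 0 }.

Section euclid_theory.
Context {R : realType} {V : lmodType R} (X : set V) (ip : V -> V -> R).
Hypothesis E : euclid X ip.
Local Notation "|: x :|" := (ipnorm ip x) (format "|: x :|").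

Lemma euclidN x : X x -> X (- x).
Proof. by move=> /(euclidZ E (-1)); rewrite scaleN1r. Qed.

Lemma euclidB x y : X x -> X y -> X (x - y).
Proof. by move=> hx hy; apply: (euclidD E) => //; exact: euclidN. Qed.

Lemma ipDr x y z : ip x (y + z) = ip x y + ip x z.
Proof. by rewrite !(ipC E x) (ipDl E). Qed.

Lemma ipZr a x y : ip x (a *: y) = a * ip x y.
Proof. by rewrite !(ipC E x) (ipZl E). Qed.

Lemma ipNl x y : ip (- x) y = - ip x y.
Proof. by rewrite -scaleN1r (ipZl E) mulN1r. Qed.

Lemma ipNr x y : ip x (- y) = - ip x y.
Proof. by rewrite -scaleN1r ipZr mulN1r. Qed.

Lemma ip0l x : ip 0 x = 0.
Proof. by rewrite -(scale0r 0) (ipZl E) mul0r. Qed.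

Lemma sqr_ipnorm x : X x -> |: x :| ^+ 2 = ip x x.
Proof. by move=> hx; rewrite sqr_sqrtr // (ip_ge0 E). Qed.

Lemma ipnorm_ge0 x : 0 <= |: x :|. Proof. exact: sqrtr_ge0. Qed.

Lemma ipnorm0 : |: 0 :| = 0.
Proof. by rewrite /ipnorm ip0l sqrtr0. Qed.

Lemma ipnormN x : |: - x :| = |: x :|.
Proof. by rewrite /ipnorm ipNl ipNr opprK. Qed.

Lemma ipnormZ a x : |: a *: x :| = `|a| * |: x :|.
Proof. by rewrite /ipnorm (ipZl E) ipZr mulrA -expr2 sqrtrM ?sqr_ge0 // sqrtr_sqr. Qed.

Lemma sqr_ipnormD x y : X x -> X y ->
  |: x + y :| ^+ 2 = |: x :| ^+ 2 + 2 * ip x y + |: y :| ^+ 2.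
Proof.
move=> hx hy; rewrite !sqr_ipnorm //; last exact: (euclidD E).
by rewrite (ipDl E) !ipDr (ipC E y x); ring.
Qed.

Lemma cauchy_schwarz x y : X x -> X y -> ip x y <= |: x :| * |: y :|.
Proof.
move=> hx hy; have [x0 y0] := (ipnorm_ge0 x, ipnorm_ge0 y).
have [/eqP y00|yn0] := boolP (|: y :| == 0).
  have /(ip_eq0 E hy) -> : ip y y = 0 by rewrite -sqr_ipnorm // y00 expr0n.
  by rewrite (ipC E) ip0l ipnorm0 mulr0.
have [/eqP x00|xn0] := boolP (|: x :| == 0).
  have /(ip_eq0 E hx) -> : ip x x = 0 by rewrite -sqr_ipnorm // x00 expr0n.
  by rewrite ip0l ipnorm0 mul0r.
have {}y0 : 0 < |: y :| by rewrite lt_def yn0.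
have {}x0 : 0 < |: x :| by rewrite lt_def xn0.
have := sqr_ge0 (|: |: y :| *: x + (- |: x :|) *: y :|).
rewrite sqr_ipnormD; try exact: (euclidZ E).
rewrite !ipnormZ ipZr (ipZl E) normrN !gtr0_norm // => h.
have xy : 0 < |: x :| * |: y :| by rewrite mulr_gt0.
by rewrite -(ler_pM2l xy); nra.
Qed.

Lemma cauchy_schwarz_abs x y : X x -> X y -> `|ip x y| <= |: x :| * |: y :|.
Proof.
move=> hx hy; rewrite ler_norml lerNl -ipNl -[|: x :|]ipnormN.
rewrite !cauchy_schwarz //; last exact: euclidN.
by rewrite ipnormN cauchy_schwarz.
Qed.

Lemma ler_ipnormD x y : X x -> X y -> |: x + y :| <= |: x :| + |: y :|.
Proof.
move=> hx hy; rewrite -ler_sqr ?nnegrE ?addr_ge0 ?ipnorm_ge0 //.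
by rewrite sqr_ipnormD // sqrrD; have := cauchy_schwarz hx hy; nra.
Qed.

Lemma ipnorm_distC x y : |: x - y :| = |: y - x :|.
Proof. by rewrite -ipnormN opprB. Qed.

Lemma ler_ipnorm_dist x y : X x -> X y -> `||: x :| - |: y :|| <= |: x - y :|.
Proof.
move=> hx hy; rewrite ler_norml lerBlDr; apply/andP; split; last first.
  by rewrite -{1}(subrK y x) ler_ipnormD //; exact: euclidB.
rewrite lerNl opprB lerBlDr ipnorm_distC -{1}(subrK x y) ler_ipnormD //.
exact: euclidB.
Qed.

Lemma snorm_ipnorm_expansion e x y : 0 < e -> X x -> X y ->
  snorm e |: x + y :| <=
    snorm e |: x :| + ip x y / snorm e |: x :| + |: y :| ^+ 2 / (2 * e).
Proof.
by move=> e0 hx hy; apply: snorm_expansion; rewrite ?sqr_ge0 ?sqr_ipnormD.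
Qed.

Lemma snorm_ipnorm_lip e x y : X x -> X y ->
  `|snorm e |: x :| - snorm e |: y :|| <= |: x - y :|.
Proof.
move=> hx hy; apply: le_trans (ler_ipnorm_dist hx hy).
rewrite ler_norml lerBlDr [_ + snorm _ _]addrC snorm_lip andbT.
by rewrite lerNl opprB lerBlDr addrC distrC snorm_lip.
Qed.

Lemma tnorm_ge0 z : 0 <= tnorm ip z.
Proof. by rewrite addr_ge0 ?ipnorm_ge0. Qed.

End euclid_theory.

(** * Viscosity solutions and second-order jets *)

Section jets.
Context {R : realType} {V : lmodType R} (X : set V) (ip : V -> V -> R) (D : set V).
Hypothesis E : euclid X ip.
Hypothesis DX : D `<=` X.
Hypothesis D_cone : forall x y s, D x -> D y -> 0 <= s -> D (x + s *: y).
Hypothesis D_span : forall q, X q -> (forall v, D v -> ip q v = 0) -> q = 0.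
Local Notation "|: x :|" := (ipnorm ip x) (format "|: x :|").
Local Notation N := (tnorm ip).
Implicit Types (u : R * V -> R) (z d w : R * V).

Definition quad (z w : R * V) : R := (w.1 - z.1) ^+ 2 + |: w.2 - z.2 :| ^+ 2.

(** The error may be any multiple of [quad]. A kernel then needs only a one-sided quadratic bound,
    and quadratics are the only functions whose [smooth]ness has to be checked. *)
Definition superjet u z d : Prop :=
  [/\ open_cylinder D z, X d.2 & exists C del, 0 < del /\
    forall w, open_cylinder D w -> N (w - z) < del ->
      u w <= u z + (d.1 * (w.1 - z.1) + ip d.2 (w.2 - z.2)) + C * quad z w].

Definition jet_sub (G : V -> R) u := forall z d, superjet u z d -> d.1 <= G d.2.

(** Subjets of [u] are opposites of superjets of [- u], so a single expansion of the kernel serves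
    both sides. *)
Definition jet_super (G : V -> R) u :=
  forall z d, superjet (fun w => - u w) z (- d) -> G d.2 <= d.1.

(** Uniqueness holds even on the boundary of the cone: from any point one may move forward in time
    and along every [v] in [D], and by [D_span] these directions determine the gradient. *)
Lemma is_differential_unique phi z d d' : open_cylinder D z ->
  is_differential X ip D phi z d -> is_differential X ip D phi z d' -> d = d'.
Proof.
move=> [z0 Dz] [Xd hd] [Xd' hd'].
have small (e : R) : 0 < e -> exists2 del : R, 0 < del &
    forall w, open_cylinder D w -> N (w - z) < del ->
    `|(d.1 - d'.1) * (w.1 - z.1) + ip (d.2 - d'.2) (w.2 - z.2)| <= e * N (w - z).
  move=> e0; have e20 : 0 < e / 2 by lra.
  have [del1 d10 h1] := hd _ e20; have [del2 d20 h2] := hd' _ e20.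
  exists (Num.min del1 del2); first by rewrite lt_min d10 d20.
  move=> w Qw; rewrite lt_min => /andP[w1 w2].
  have := h1 w Qw w1; have := h2 w Qw w2; rewrite /remainder.
  rewrite (ipDl E) (ipNl E) !ler_norml.
  by set n := N _; move=> /andP[? ?] /andP[? ?]; apply/andP; split; lra.
have dd1 : d.1 - d'.1 = 0.
  apply/eqP; rewrite -normr_le0; apply/ler_addgt0Pr => e e0; rewrite add0r.
  have [del del0 h] := small _ e0.
  have := h (z.1 + del / 2, z.2); rewrite /tnorm /= subrr (ipC E) (ip0l E).
  rewrite (ipnorm0 E) !addr0 (addrC z.1) addrK.
  have hd2 : 0 < del / 2 by lra.
  rewrite (gtr0_norm hd2) normrM (gtr0_norm hd2).
  rewrite ler_pM2r; last lra.
  by apply; [split => /=; [lra|]|lra].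
have dd2 : d.2 - d'.2 = 0.
  apply: D_span => [|v Dv]; first exact: (euclidB E).
  have Xv := DX Dv; have nv := ipnorm_ge0 ip v.
  apply/eqP; rewrite -normr_le0; apply/ler_addgt0Pr => e e0; rewrite add0r.
  have e'0 : 0 < e / (|: v :| + 1) by rewrite divr_gt0 //; lra.
  have [del del0 h] := small _ e'0.
  pose s := del / (2 * (|: v :| + 1)).
  have s0 : 0 < s by rewrite divr_gt0 //; lra.
  have sv : s * |: v :| < del.
    rewrite /s mulrAC ltr_pdivrMr; last lra.
    by rewrite ltr_pM2l //; lra.
  have := h (z.1, z.2 + s *: v); rewrite /tnorm /= subrr normr0 add0r mulr0 add0r.
  rewrite (addrC z.2) addrK (ipZr E) (ipnormZ E) (gtr0_norm s0) normrM (gtr0_norm s0).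
  rewrite mulrCA ler_pM2l // => /(_ _ sv) h'.
  apply: le_trans (h' _) _; first by split => //=; rewrite addrC; apply: D_cone => //; exact: ltW.
  by rewrite mulrAC ler_pdivrMr ?ler_pM2l //; lra.
case: d d' dd1 dd2 {Xd Xd' hd hd' small} => [d1 d2] [d1' d2'] /= /subr0_eq -> /subr0_eq ->.
by [].
Qed.

Definition quad_test z d (C : R) w :=
  d.1 * (w.1 - z.1) + ip d.2 (w.2 - z.2) + C * quad z w.

Definition quad_diff z d (C : R) w : R * V :=
  (d.1 + 2 * C * (w.1 - z.1), d.2 + (2 * C) *: (w.2 - z.2)).

Lemma remainder_quad z d C w w' : D z.2 -> X d.2 -> D w.2 -> D w'.2 ->
  remainder ip (quad_test z d C) w (quad_diff z d C w) w' = C * quad w w'.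
Proof.
move=> Dz Xd Dw Dw'; rewrite /remainder /quad_test /quad_diff /quad /=.
have -> : w'.2 - z.2 = (w'.2 - w.2) + (w.2 - z.2) by rewrite addrA subrK.
have [X1 X2] : X (w'.2 - w.2) /\ X (w.2 - z.2).
  by split; apply: (euclidB E); exact: DX.
move: (w'.2 - w.2) (w.2 - z.2) X1 X2 => x y Xx Xy.
by rewrite (sqr_ipnormD E) // (ipDl E) (ipZl E) (ipDr E) (ipC E y x); ring.
Qed.

Lemma quad_ge0 z w : 0 <= quad z w.
Proof. by rewrite addr_ge0 ?sqr_ge0. Qed.

Lemma quad_le z w : quad z w <= N (w - z) ^+ 2.
Proof.
have := ipnorm_ge0 ip (w.2 - z.2); have := normr_ge0 (w.1 - z.1).
by rewrite /quad /tnorm -(real_normK (num_real (w.1 - z.1))) /=; nra.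
Qed.

Lemma smooth_quad z d C : D z.2 -> X d.2 ->
  smooth X ip D (quad_test z d C) (quad_diff z d C).
Proof.
move=> Dz Xd w Qw; have [w0 Dw] := Qw.
have Xw : X (quad_diff z d C w).2.
  by apply: (euclidD E) => //; apply: (euclidZ E); apply: (euclidB E); exact: DX.
have diffw : is_differential X ip D (quad_test z d C) w (quad_diff z d C w).
  split=> // e e0; have C0 : 0 < `|C| + 1 by have := normr_ge0 C; lra.
  exists (e / (`|C| + 1)); first by rewrite divr_gt0.
  move=> w' [_ Dw']; rewrite ltr_pdivlMr // => wN.
  rewrite remainder_quad // normrM (ger0_norm (quad_ge0 _ _)).
  have := quad_le w w'; have := quad_ge0 w w'; have := normr_ge0 C.
  have := tnorm_ge0 ip (w' - w).
  move: (N _) wN => n wN n0 cc q0 qn.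
  by apply: le_trans (ler_wpM2l cc qn) _; nra.
split=> //.
- by move=> d' hd'; apply: is_differential_unique hd' diffw.
- exists `|C|, 1; split=> // w' [_ Dw'] _; rewrite remainder_quad //.
  by rewrite normrM (ger0_norm (quad_ge0 _ _)) /quad real_normK ?num_real.
- move=> e e0; have C0 : 0 < `|2 * C| + 1 by have := normr_ge0 (2 * C); lra.
  exists (e / (`|2 * C| + 1)); first by rewrite divr_gt0.
  move=> w' [_ Dw']; rewrite ltr_pdivlMr // => wN.
  suff -> : N (quad_diff z d C w' - quad_diff z d C w) = `|2 * C| * N (w' - w).
    by have := tnorm_ge0 ip (w' - w); move: (N _) wN => n; nra.
  rewrite /tnorm /=.
  have -> : d.1 + 2 * C * (w'.1 - z.1) - (d.1 + 2 * C * (w.1 - z.1)) =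
    2 * C * (w'.1 - w.1) by ring.
  have -> : d.2 + (2 * C) *: (w'.2 - z.2) - (d.2 + (2 * C) *: (w.2 - z.2)) =
    (2 * C) *: (w'.2 - w.2).
    by rewrite opprD addrACA subrr add0r -scalerBr opprB addrA subrK.
  by rewrite normrM (ipnormZ E) mulrDr.
Qed.

Lemma viscosity_jet_sub G u : viscosity_subsolution X ip D G u -> jet_sub G u.
Proof.
move=> [_ hu] z d [Qz Xd [C [del [del0 hw]]]].
have [_ Dz] := Qz.
have := hu z _ _ Qz (smooth_quad C Dz Xd).
rewrite /quad_diff /= !subrr mulr0 scaler0 !addr0 subr_le0; apply.
exists del => // w Qw wN; have := hw w Qw wN.
rewrite /quad_test /quad !subrr (ipnorm0 E) (ipC E _ 0) (ip0l E) expr0n /=.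
rewrite !mulr0; lra.
Qed.

Lemma viscosity_jet_super G u :
  viscosity_supersolution X ip D G u -> jet_super G u.
Proof.
move=> [_ hu] z d [Qz XNd [C [del [del0 hw]]]].
have [_ Dz] := Qz.
have Xd : X d.2 by rewrite -[d.2]opprK; exact: (euclidN E).
have := hu z _ _ Qz (smooth_quad (- C) Dz Xd).
rewrite /quad_diff /= !subrr mulr0 scaler0 !addr0 subr_ge0; apply.
exists del => // w Qw wN; have := hw w Qw wN.
rewrite /quad_test /quad !subrr (ipnorm0 E) (ipC E _ 0) (ip0l E) expr0n /=.
rewrite !mulr0 (ipNl E); lra.
Qed.

End jets.

(** * Doubling of variables *)

Section penalty.
Context {R : realType}.
Variables (delta A rho : R).
Hypotheses (delta0 : 0 <= delta) (A0 : 0 < A) (rho0 : 0 < rho).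

Implicit Types p q r h : R.

(** For nonnegative [r] the slope lies between [delta] and [delta + A]. Its growth at infinity beats
    any linear growth of rate below [A], which gives maxima; as [rho] tends to infinity it decreases
    to [delta * r], which is all that survives in the conclusion. *)
Definition pen r : R := delta * r + A * (snorm rho r - rho).
Definition dpen r : R := delta + A * (r / snorm rho r).

Lemma pen_expansion r h : pen (r + h) <= pen r + dpen r * h + A / (2 * rho) * h ^+ 2.
Proof.
have := @snorm_expansion R rho (r + h) r (r * h) (h ^+ 2) rho0 (sqr_ge0 _).
rewrite sqrrD -mulr_natl mulrA => /(_ erefl) H; rewrite /pen /dpen.
rewrite [r * h / _]mulrAC [h ^+ 2 / _]mulrC in H.
have {H} := ler_wpM2l (ltW A0) H.
by move: (2 * rho)^-1 (snorm _ (r + h)) (snorm _ r) (snorm _ r)^-1 => k T S q; lra.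
Qed.

Lemma pen_lip p q : `|pen p - pen q| <= (delta + A) * `|p - q|.
Proof.
have h1 := snorm_lip rho p q; have h2 := snorm_lip rho q p.
rewrite distrC in h2; have h3 := ler_norm (p - q).
have h4 := ler_norm (q - p); rewrite distrC in h4.
have := ler_wpM2l (ltW A0) h1; have := ler_wpM2l (ltW A0) h2.
have := ler_wpM2l delta0 h3; have := ler_wpM2l delta0 h4.
by move=> *; rewrite ler_norml /pen; apply/andP; split; lra.
Qed.

Lemma dpen_gt0 r : 0 < r -> 0 < dpen r.
Proof. by move=> r0; rewrite ltr_wpDl // mulr_gt0 // divr_gt0 // snorm_gt0. Qed.

Lemma dpen_le r : dpen r <= delta + A.
Proof.
rewrite lerD2l -[leRHS]mulr1 ler_pM2l // ler_pdivrMr ?snorm_gt0 // mul1r.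
exact: le_trans (ler_norm _) (snorm_ge _ _).
Qed.

Lemma pen_ge r : delta * r <= pen r.
Proof. by rewrite lerDl mulr_ge0 ?(ltW A0) // subr_ge0 snorm_gee // ltW. Qed.

Lemma pen_coercive r : 0 <= r -> A * (r - rho) <= pen r.
Proof.
move=> r0; rewrite /pen; apply: ler_wpDl; first exact: mulr_ge0.
by rewrite ler_pM2l // lerB // (le_trans (ler_norm _)) // snorm_ge.
Qed.

Lemma pen_le r : pen r <= delta * r + A * (r ^+ 2 / (2 * rho)).
Proof. by rewrite lerD2l ler_pM2l // lerBlDl snorm_le_quad. Qed.

End penalty.

(** A linear map with adjoint [a']. Points of two grids are compared after mapping both to a common
    coarser one, and [a'] pulls the gradient of the distance back. *)
Record contraction {R : realType} {V W : lmodType R} (X : set V) (ip : V -> V -> R)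
    (Y : set W) (ipw : W -> W -> R) (a : V -> W) (a' : W -> V) : Prop := Contraction {
  contr_in : forall x, X x -> Y (a x);
  contr_adj_in : forall w, Y w -> X (a' w);
  contrB : forall x y, a (x - y) = a x - a y;
  contr_adjZ : forall k w, a' (k *: w) = k *: a' w;
  contr_adj : forall x w, X x -> Y w -> ipw w (a x) = ip (a' w) x;
  contr_le : forall x, X x -> ipnorm ipw (a x) <= ipnorm ip x }.

Section kernel_jet.
Context {R : realType} {V W : lmodType R} (X : set V) (ip : V -> V -> R)
  (D : set V) (Y : set W) (ipw : W -> W -> R) (a : V -> W) (a' : W -> V).
Hypotheses (E : euclid X ip) (Ew : euclid Y ipw) (DX : D `<=` X).
Hypothesis ac : contraction X ip Y ipw a a'.
Variables (L M delta A rho e v : R).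
Hypotheses (L0 : 0 <= L) (M0 : 0 <= M) (delta0 : 0 <= delta) (A0 : 0 < A)
  (rho0 : 0 < rho) (e0 : 0 < e) (v0 : 0 < v).

(** Its level sets shrink at speed [v] as time grows. For an increasing function of it, the time
    derivative is [v] times a number strictly larger than the norm of the space gradient. *)
Definition weight (z : R * V) : R := snorm 1 (ipnorm ip z.2) + v * z.1.

Definition kernel s c (z : R * V) : R :=
  L * snorm e (ipnorm ipw (a z.2 - c)) + M * snorm e (z.1 - s)
  + pen delta A rho (weight z).

Lemma weight_gt0 (z : R * V) : 0 <= z.1 -> 0 < weight z.
Proof. by move=> z0; rewrite ltr_pwDl ?snorm_gt0 // mulr_ge0 // ltW. Qed.

Lemma weight_lip (z w : R * V) : X z.2 -> X w.2 ->
  `|weight z - weight w| <= (1 + v) * tnorm ip (z - w).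
Proof.
move=> Xz Xw; have := snorm_ipnorm_lip E 1 Xz Xw; rewrite /weight /tnorm /=.
have := ipnorm_ge0 ip (z.2 - w.2); have := normr_ge0 (z.1 - w.1).
rewrite !ler_norml; have := ler_norm (z.1 - w.1).
have := ler_norm (w.1 - z.1); rewrite distrC.
move: (ipnorm ip (z.2 - w.2)) `|_| => n m hm1 hm2 m0 n0 /andP[h1 h2].
have := ler_wpM2l (ltW v0) hm1; have := ler_wpM2l (ltW v0) hm2.
by have := mulr_ge0 (ltW v0) n0; move=> *; apply/andP; split; lra.
Qed.

Lemma kernel_lip s c z w : Y c -> X z.2 -> X w.2 ->
  `|kernel s c z - kernel s c w| <=
    (L + M + (delta + A) * (1 + v)) * tnorm ip (z - w).
Proof.
move=> Yc Xz Xw.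
have h1 := snorm_ipnorm_lip Ew e (euclidB Ew (contr_in ac Xz) Yc)
   (euclidB Ew (contr_in ac Xw) Yc).
have h2 : `|snorm e (z.1 - s) - snorm e (w.1 - s)| <= `|z.1 - w.1|.
  have := snorm_lip e (z.1 - s) (w.1 - s); have := snorm_lip e (w.1 - s) (z.1 - s).
  rewrite [X in `|X|](_ : _ = w.1 - z.1); last by ring.
  rewrite [X in _ -> _ <= _ + `|X| -> _](_ : _ = z.1 - w.1); last by ring.
  rewrite (distrC w.1) => ? ?; rewrite ler_norml; apply/andP; split; lra.
have h3 := pen_lip rho delta0 A0 (weight z) (weight w).
have h4 := weight_lip Xz Xw.
have {}h3 := le_trans h3 (ler_wpM2l (addr_ge0 delta0 (ltW A0)) h4).
have aE : a z.2 - c - (a w.2 - c) = a (z.2 - w.2).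
  by rewrite (contrB ac) opprB addrA subrK.
rewrite aE in h1.
have := le_trans h1 (contr_le ac (euclidB E Xz Xw)) => {}h1.
have n1 : ipnorm ip (z.2 - w.2) <= tnorm ip (z - w) by rewrite lerDr.
have n2 : `|z.1 - w.1| <= tnorm ip (z - w) by rewrite lerDl ipnorm_ge0.
have {}h1 := ler_wpM2l L0 (le_trans h1 n1).
have {}h2 := ler_wpM2l M0 (le_trans h2 n2).
rewrite /kernel; set g := (X in `|X|); have -> : g =
  L * (snorm e (ipnorm ipw (a z.2 - c)) - snorm e (ipnorm ipw (a w.2 - c))) +
  M * (snorm e (z.1 - s) - snorm e (w.1 - s)) +
  (pen delta A rho (weight z) - pen delta A rho (weight w)) by rewrite /g; ring.
apply: le_trans (ler_normD _ _) _; rewrite [leRHS]mulrDl; apply: lerD; last first.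
  by rewrite -mulrA.
apply: le_trans (ler_normD _ _) _; rewrite [leRHS]mulrDl !normrM.
by rewrite (ger0_norm L0) (ger0_norm M0) lerD.
Qed.

Definition kernel_diff s c (z : R * V) : R * V :=
  let S := snorm e (ipnorm ipw (a z.2 - c)) in
  let d := dpen delta A rho (weight z) in
  (M * ((z.1 - s) / snorm e (z.1 - s)) + d * v,
   a' ((L / S) *: (a z.2 - c)) + (d / snorm 1 (ipnorm ip z.2)) *: z.2).

(** The constant adds up half-curvatures: 1/(2e) for each smoothed distance, the slope bound
    [delta + A] times 1/2 for the smoothed norm inside [weight], and A/(2 rho) times the squared
    increment of [weight], itself at most 2(1 + v^2) [quad]. *)
Lemma kernel_expansion s c z w : 0 <= z.1 -> Y c -> X z.2 -> X w.2 ->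
  kernel s c w <= kernel s c z + ((kernel_diff s c z).1 * (w.1 - z.1)
     + ip (kernel_diff s c z).2 (w.2 - z.2))
  + ((L + M) / (2 * e) + (delta + A) / 2 + A / rho * (1 + v ^+ 2))
     * quad ip z w.
Proof.
move=> z0 Yc Xz Xw; rewrite /kernel /kernel_diff /quad /=.
set t := w.1 - z.1; set x := w.2 - z.2.
have Xx : X x by exact: (euclidB E).
have -> : a w.2 - c = (a z.2 - c) + a x by rewrite (contrB ac) [RHS]addrC addrA subrK.
have -> : w.1 - s = (z.1 - s) + t by rewrite /t; ring.
have YU : Y (a z.2 - c) by apply: (euclidB Ew) => //; exact: (contr_in ac).
set U := a z.2 - c in YU *.
have h1 := snorm_ipnorm_expansion Ew e0 YU (contr_in ac Xx).
have := @snorm_expansion R e (z.1 - s + t) (z.1 - s) ((z.1 - s) * t) (t ^+ 2) e0 (sqr_ge0 _).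
rewrite sqrrD -mulr_natl mulrA => /(_ erefl) h2.
have wE : weight w = weight z + (weight w - weight z) by ring.
set h := weight w - weight z in wE.
have h3 := pen_expansion delta A0 rho0 (weight z) h.
rewrite -wE in h3.
have := snorm_ipnorm_expansion E ltr01 Xz Xx.
have -> : z.2 + x = w.2 by rewrite addrC subrK.
set nu := snorm 1 (ipnorm ip z.2) => h4.
have hh : h <= ip z.2 x / nu + v * t + ipnorm ip x ^+ 2 / 2.
  by rewrite /h /weight /t -/nu; lra.
have nx0 := ipnorm_ge0 ip x.
have hh2 : h ^+ 2 <= 2 * (1 + v ^+ 2) * (t ^+ 2 + ipnorm ip x ^+ 2).
  have := snorm_ipnorm_lip E 1 Xw Xz; rewrite -/nu -/x.
  set k := _ - nu => hk; have -> : h = k + v * t by rewrite /h /k /weight -/nu /t; ring.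
  have {}hk : k ^+ 2 <= ipnorm ip x ^+ 2.
    by rewrite -(real_normK (num_real k)) ler_sqr ?nnegrE.
  have := sqr_ge0 (k - v * t); have := sqr_ge0 (v * ipnorm ip x).
  have := sqr_ge0 t.
  by rewrite !exprMn; nra.
(* [hh] bounds the increment [h] from above only; it can be multiplied by the slope because the
   slope is positive. *)
have d0 : 0 < dpen delta A rho (weight z).
  by apply: dpen_gt0 => //; exact: weight_gt0.
have dA := dpen_le delta A0 rho0 (weight z).
set d := dpen delta A rho (weight z) in h3 d0 dA *.
rewrite (contr_adjZ ac) (ipDl E) !(ipZl E) -(contr_adj ac) //.
set S := snorm e (ipnorm ipw U) in h1 *; set T := snorm e (z.1 - s) in h2 *.
set q := ipw U (a x) in h1 *.
have {}h1 := ler_wpM2l L0 h1; have {}h2 := ler_wpM2l M0 h2.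
have ax : ipnorm ipw (a x) ^+ 2 <= ipnorm ip x ^+ 2.
  by rewrite ler_sqr ?nnegrE ?ipnorm_ge0 // (contr_le ac).
have t20 := sqr_ge0 t.
have e20 : 0 <= 2 * e by rewrite mulr_ge0 // ltW.
have Aq : A / (2 * rho) * h ^+ 2 <= A / rho * (1 + v ^+ 2) * (t ^+ 2 + ipnorm ip x ^+ 2).
  have -> : A / rho * (1 + v ^+ 2) * (t ^+ 2 + ipnorm ip x ^+ 2) =
    A / (2 * rho) * (2 * (1 + v ^+ 2) * (t ^+ 2 + ipnorm ip x ^+ 2)) by field; rewrite gt_eqF.
  have r20 : 0 <= 2 * rho by rewrite mulr_ge0 // ltW.
  apply: ler_wpM2l => //; apply: divr_ge0 => //; exact: ltW.
have dh := ler_wpM2l (ltW d0) hh.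
have dx : d * (ipnorm ip x ^+ 2 / 2) <=
    (delta + A) / 2 * (t ^+ 2 + ipnorm ip x ^+ 2).
  have := ler_wpM2r (sqr_ge0 (ipnorm ip x)) dA.
  by have := mulr_ge0 (addr_ge0 delta0 (ltW A0)) t20; lra.
have Lx : L * (ipnorm ipw (a x) ^+ 2 / (2 * e)) <=
    L / (2 * e) * (t ^+ 2 + ipnorm ip x ^+ 2).
  rewrite mulrA mulrAC ler_wpM2l ?divr_ge0 // (le_trans ax) //.
  by rewrite lerDr.
have Mt : M * (t ^+ 2 / (2 * e)) <= M / (2 * e) * (t ^+ 2 + ipnorm ip x ^+ 2).
  by rewrite mulrA mulrAC ler_wpM2l ?divr_ge0 // lerDl sqr_ge0.
move: (t ^+ 2 + ipnorm ip x ^+ 2) (A / rho * (1 + v ^+ 2)) h1 h2 Aq dh dx Lx Mt => Q B.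
have -> : L / S * q = L * (q / S) by rewrite mulrAC mulrA.
have -> : d / nu * ip z.2 x = d * (ip z.2 x / nu) by rewrite mulrAC mulrA.
have -> : (z.1 - s) * t / T = (z.1 - s) / T * t by rewrite mulrAC.
rewrite [(L + M) / _]mulrDl; lra.
Qed.

Lemma superjet_kernel (g : R * V -> R) s c z : open_cylinder D z -> Y c ->
  (forall w, open_cylinder D w -> g w - kernel s c w <= g z - kernel s c z) ->
  superjet X ip D g z (kernel_diff s c z).
Proof.
move=> Qz Yc hg; have [z0 Dz] := Qz; have Xz := DX Dz.
split=> //.
  apply: (euclidD E); last exact: (euclidZ E).
  apply: (contr_adj_in ac); apply: (euclidZ Ew); apply: (euclidB Ew) => //.
  exact: (contr_in ac).
exists ((L + M) / (2 * e) + (delta + A) / 2 + A / rho * (1 + v ^+ 2)), 1.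
split=> // w Qw _; have := hg w Qw; have [_ Dw] := Qw.
by have := kernel_expansion s (ltW z0) Yc Xz (DX Dw); lra.
Qed.

End kernel_jet.

(** Compactness isolated as a property: some point dominates both balls of radius [r], without
    having to lie in them. *)
Definition attains_max {R : realType} {V1 V2 : lmodType R}
    (ip1 : V1 -> V1 -> R) (D1 : set V1) (ip2 : V2 -> V2 -> R) (D2 : set V2) :=
  forall (g : R * V1 -> R * V2 -> R) (r : R),
  (forall z1 z2, cylinder D1 z1 -> cylinder D2 z2 -> forall e : R, 0 < e ->
     exists2 del : R, 0 < del & forall w1 w2, cylinder D1 w1 -> cylinder D2 w2 ->
       tnorm ip1 (w1 - z1) < del -> tnorm ip2 (w2 - z2) < del ->
       `|g w1 w2 - g z1 z2| < e) ->
  exists z1 z2, [/\ cylinder D1 z1, cylinder D2 z2 & forall w1 w2,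
    cylinder D1 w1 -> cylinder D2 w2 -> tnorm ip1 w1 <= r -> tnorm ip2 w2 <= r ->
    g w1 w2 <= g z1 z2].

Section doubling.
Context {R : realType} {V1 V2 W : lmodType R}
  (X1 : set V1) (ip1 : V1 -> V1 -> R) (D1 : set V1)
  (X2 : set V2) (ip2 : V2 -> V2 -> R) (D2 : set V2)
  (Y : set W) (ipw : W -> W -> R)
  (a1 : V1 -> W) (a1' : W -> V1) (a2 : V2 -> W) (a2' : W -> V2).
Hypotheses (E1 : euclid X1 ip1) (E2 : euclid X2 ip2) (Ew : euclid Y ipw).
Hypotheses (DX1 : D1 `<=` X1) (DX2 : D2 `<=` X2) (D10 : D1 0) (D20 : D2 0).
Hypotheses (ac1 : contraction X1 ip1 Y ipw a1 a1')
  (ac2 : contraction X2 ip2 Y ipw a2 a2').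
Hypothesis maxD : attains_max ip1 D1 ip2 D2.
Variables (G1 : V1 -> R) (G2 : V2 -> R) (u : R * V1 -> R) (v : R * V2 -> R).
Hypotheses (cu : continuous_on_cylinder ip1 D1 u)
  (cv : continuous_on_cylinder ip2 D2 v).
Hypotheses (su : jet_sub X1 ip1 D1 G1 u) (sv : jet_super X2 ip2 D2 G2 v).
Variables (L M delta A K C0 vel : R).
Hypotheses (L0 : 0 <= L) (M0 : 0 <= M) (delta0 : 0 <= delta) (K0 : 0 <= K)
  (KA : K < A) (vel1 : 1 <= vel).
Hypothesis growth : forall z1 z2, cylinder D1 z1 -> cylinder D2 z2 ->
  u z1 - v z2 <= C0 + K * (tnorm ip1 z1 + tnorm ip2 z2).
(** At a maximum, [w] is the gradient of the distance on the common grid and [q1], [q2] are the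
    penalty gradients; [q2] has a minus sign because [v] is touched from below. *)
Hypothesis speed : forall w q1 q2, Y w -> X1 q1 -> X2 q2 ->
  ipnorm ipw w <= L -> ipnorm ip1 q1 <= delta + A -> ipnorm ip2 q2 <= delta + A ->
  G1 (a1' w + q1) - G2 (a2' w - q2) <= vel * (ipnorm ip1 q1 + ipnorm ip2 q2).

Let bound z1 z2 := L * ipnorm ipw (a1 z1.2 - a2 z2.2) + M * `|z1.1 - z2.1|
  + delta * (weight ip1 vel z1 + weight ip2 vel z2).

Hypothesis boundary : forall z1 z2, cylinder D1 z1 -> cylinder D2 z2 ->
  z1.1 = 0 \/ z2.1 = 0 -> u z1 - v z2 <= bound z1 z2.

Section fixed_parameters.
Variables (e rho : R).
Hypotheses (e0 : 0 < e) (rho0 : 0 < rho).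

Let A0 : 0 < A. Proof. exact: le_lt_trans KA. Qed.
Let vel0 : 0 < vel. Proof. exact: lt_le_trans vel1. Qed.

Let Psi z1 z2 := u z1 - v z2
  - (kernel ip1 ipw a1 L M delta A rho e vel z2.1 (a2 z2.2) z1
     + pen delta A rho (weight ip2 vel z2)).

(** The distance part is symmetric, so [Psi] also has the form of a kernel in its second variable,
    and the same expansion applies there. *)
Let PsiE z1 z2 : Psi z1 z2 = u z1 - v z2
  - (kernel ip2 ipw a2 L M delta A rho e vel z1.1 (a1 z1.2) z2
     + pen delta A rho (weight ip1 vel z1)).
Proof.
rewrite /Psi /kernel (ipnorm_distC Ew (a2 z2.2)).
rewrite -(snormN e (z2.1 - _)) opprB.
by ring.
Qed.

Lemma tnorm_le_weight {V : lmodType R} (ip : V -> V -> R) (z : R * V) : 0 <= z.1 ->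
  tnorm ip z <= weight ip vel z.
Proof.
move=> z0; rewrite /tnorm /weight addrC lerD //.
  exact: le_trans (ler_norm _) (snorm_ge _ _).
by rewrite ger0_norm // ler_peMl.
Qed.

Lemma doubling_continuous z1 z2 : cylinder D1 z1 -> cylinder D2 z2 ->
  forall r : R, 0 < r -> exists2 del : R, 0 < del &
    forall w1 w2, cylinder D1 w1 -> cylinder D2 w2 ->
      tnorm ip1 (w1 - z1) < del -> tnorm ip2 (w2 - z2) < del ->
      `|Psi w1 w2 - Psi z1 z2| < r.
Proof.
move=> Cz1 Cz2 r r0; have r40 : 0 < r / 4 by lra.
have [d1 d10 h1] := cu Cz1 r40; have [d2 d20 h2] := cv Cz2 r40.
pose k := L + M + (delta + A) * (1 + vel).
have k0 : 0 < k.
  have [? ? ? ?] := And4 L0 M0 delta0 A0; have ? := vel0.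
  have ? : 0 < (delta + A) * (1 + vel) by apply: mulr_gt0; lra.
  by rewrite /k; lra.
have d30 : 0 < r / (4 * k) by rewrite divr_gt0 // mulr_gt0.
exists (Num.min (r / (4 * k)) (Num.min d1 d2)); first by rewrite !lt_min d30 d10.
move=> w1 w2 Cw1 Cw2; rewrite !lt_min => /and3P[n1 n1' _] /and3P[n2 _ n2'].
have g1 := h1 _ Cw1 n1'; have g2 := h2 _ Cw2 n2'.
have [[t1 D1z] [t2 D2z]] := (Cz1, Cz2); have [[t3 D1w] [t4 D2w]] := (Cw1, Cw2).
have Yz1 : Y (a1 z1.2) by apply: (contr_in ac1); exact: DX1.
have Yw2 : Y (a2 w2.2) by apply: (contr_in ac2); exact: DX2.
have g3 := kernel_lip E1 Ew ac1 rho e L0 M0 delta0 A0 vel0 w2.1 Yw2 (DX1 D1w) (DX1 D1z).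
have g4 := kernel_lip E2 Ew ac2 rho e L0 M0 delta0 A0 vel0 z1.1 Yz1 (DX2 D2w) (DX2 D2z).
rewrite -/k in g3 g4.
have kr (x : R) : x < r / (4 * k) -> k * x < r / 4.
  by rewrite ltr_pdivlMr ?mulr_gt0 // => ?; lra.
have {}g3 := le_lt_trans g3 (kr _ n1); have {}g4 := le_lt_trans g4 (kr _ n2).
have P1 : Psi w1 w2 - Psi z1 w2 = (u w1 - u z1)
  - (kernel ip1 ipw a1 L M delta A rho e vel w2.1 (a2 w2.2) w1
     - kernel ip1 ipw a1 L M delta A rho e vel w2.1 (a2 w2.2) z1).
  by rewrite /Psi; ring.
have P2 : Psi z1 w2 - Psi z1 z2 = - (v w2 - v z2)
  - (kernel ip2 ipw a2 L M delta A rho e vel z1.1 (a1 z1.2) w2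
     - kernel ip2 ipw a2 L M delta A rho e vel z1.1 (a1 z1.2) z2).
  by rewrite !PsiE; ring.
rewrite -(subrKA (Psi z1 w2)) P1 P2.
move: g1 g2 g3 g4; rewrite !ltr_norml.
by move=> /andP[? ?] /andP[? ?] /andP[? ?] /andP[? ?]; apply/andP; split; lra.
Qed.

Lemma doubling_max : exists z1 z2, [/\ cylinder D1 z1, cylinder D2 z2 &
  forall w1 w2, cylinder D1 w1 -> cylinder D2 w2 -> Psi w1 w2 <= Psi z1 z2].
Proof.
have [? ? ? ?] := And4 L0 M0 delta0 A0; have [? ?] := (vel0, KA).
(* Beyond total radius [r] the growth bound minus the coercive penalty is below [Psi 0 0]. The
   absolute value ensures that the origin lies in the balls. *)
pose r := `|(C0 + 2 * A * rho - Psi 0 0) / (A - K)|.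
have [z1 [z2 [Cz1 Cz2 hmax]]] := maxD r doubling_continuous.
exists z1, z2; split=> // w1 w2 Cw1 Cw2.
have [[t1 D1w] [t2 D2w]] := (Cw1, Cw2).
have C10 : cylinder D1 (0 : R * V1) by split.
have C20 : cylinder D2 (0 : R * V2) by split.
have N10 : tnorm ip1 (0 : R * V1) = 0 by rewrite /tnorm normr0 (ipnorm0 E1) addr0.
have N20 : tnorm ip2 (0 : R * V2) = 0 by rewrite /tnorm normr0 (ipnorm0 E2) addr0.
have [n1 n2] := (tnorm_ge0 ip1 w1, tnorm_ge0 ip2 w2).
have [nr|nr] := leP (tnorm ip1 w1 + tnorm ip2 w2) r.
  by apply: hmax => //; lra.
apply: (@le_trans _ _ (Psi 0 0)); last first.
  by apply: hmax; rewrite ?N10 ?N20 // normr_ge0.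
have g1 := growth Cw1 Cw2.
have p1 := pen_coercive rho delta0 A0 (ltW (weight_gt0 ip1 vel0 t1)).
have p2 := pen_coercive rho delta0 A0 (ltW (weight_gt0 ip2 vel0 t2)).
have q1 := ler_wpM2l (ltW A0) (tnorm_le_weight ip1 t1).
have q2 := ler_wpM2l (ltW A0) (tnorm_le_weight ip2 t2).
have s1 : 0 <= L * snorm e (ipnorm ipw (a1 w1.2 - a2 w2.2)).
  by rewrite mulr_ge0 // sqrtr_ge0.
have s2 : 0 <= M * snorm e (w1.1 - w2.1) by rewrite mulr_ge0 // sqrtr_ge0.
have {nr} := le_lt_trans (ler_norm _) nr.
rewrite ltr_pdivrMr ?subr_gt0 //.
by rewrite {2}/Psi /kernel; lra.
Qed.

(** If both times are positive at the maximum, the time derivatives coming from the [M] term cancel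
    in the difference of the two inequalities. What is left says that [vel] times the sum of the
    penalty slopes is at most [vel] times the sum of the norms of the penalty gradients, against the
    strict inequality [qlt]. So one time is 0 and [boundary] applies. *)
Lemma doubling_le0 z1 z2 : cylinder D1 z1 -> cylinder D2 z2 -> Psi z1 z2 <= 0.
Proof.
have [? ? ? ?] := And4 L0 M0 delta0 A0; have ? := vel0.
move=> Cz1 Cz2; have [y1 [y2 [Cy1 Cy2 hmax]]] := doubling_max.
apply: le_trans (hmax _ _ Cz1 Cz2) _.
have [[t1 D1y] [t2 D2y]] := (Cy1, Cy2).
have [by0|ny0] := pselect (y1.1 = 0 \/ y2.1 = 0).
  have := boundary Cy1 Cy2 by0.
  have := pen_ge delta A0 rho0 (weight ip1 vel y1).
  have := pen_ge delta A0 rho0 (weight ip2 vel y2).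
  have := ler_wpM2l L0 (le_trans (ler_norm _) (snorm_ge e (ipnorm ipw (a1 y1.2 - a2 y2.2)))).
  have := ler_wpM2l M0 (snorm_ge e (y1.1 - y2.1)).
  by rewrite /Psi /kernel /bound; lra.
have {}t1 : 0 < y1.1 by rewrite lt_def t1 andbT; apply/eqP => ?; apply: ny0; left.
have {}t2 : 0 < y2.1 by rewrite lt_def t2 andbT; apply/eqP => ?; apply: ny0; right.
have [Xy1 Xy2] := (DX1 D1y, DX2 D2y).
have [Y1 Y2] := (contr_in ac1 Xy1, contr_in ac2 Xy2).
have ju : superjet X1 ip1 D1 u y1
    (kernel_diff ip1 ipw a1 a1' L M delta A rho e vel y2.1 (a2 y2.2) y1).
  apply: (superjet_kernel E1 Ew) => // w [w0 Dw].
  have := hmax w y2 (conj (ltW w0) Dw) Cy2; rewrite /Psi; lra.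
have jv : superjet X2 ip2 D2 (fun w => - v w) y2
    (kernel_diff ip2 ipw a2 a2' L M delta A rho e vel y1.1 (a1 y1.2) y2).
  apply: (superjet_kernel E2 Ew) => // w [w0 Dw].
  have := hmax y1 w Cy1 (conj (ltW w0) Dw); rewrite !PsiE; lra.
have {ju} := su ju; rewrite -[kernel_diff _ _ a2 _ _ _ _ _ _ _ _ _ _ _]opprK in jv.
have {jv} := sv jv; rewrite /kernel_diff /=.
rewrite (ipnorm_distC Ew (a2 y2.2)).
rewrite -(snormN e (y2.1 - _)) opprB.
set S := snorm e (ipnorm _ _); set T := snorm e _.
set m1 := weight ip1 vel y1; set m2 := weight ip2 vel y2.
set w := (L / S) *: (a1 y1.2 - a2 y2.2).
rewrite opprD -[a2 y2.2 - a1 y1.2]opprB scalerN -/w.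
have -> : a2' (- w) = - a2' w by rewrite -[- w]scaleN1r (contr_adjZ ac2) scaleN1r.
rewrite opprK.
set q1 := _ *: y1.2; set q2 := _ *: y2.2 => hv hu.
have Yw : Y w by apply: (euclidZ Ew); exact: (euclidB Ew).
have [Xq1 Xq2] : X1 q1 /\ X2 q2 by split; [apply: (euclidZ E1)|apply: (euclidZ E2)].
have wL : ipnorm ipw w <= L.
  have S0 : 0 < S by exact: snorm_gt0.
  rewrite /w (ipnormZ Ew) ger0_norm; last by rewrite divr_ge0 // ltW.
  rewrite mulrAC ler_pdivrMr // ler_wpM2l //.
  exact: le_trans (ler_norm _) (snorm_ge _ _).
(* The strictness comes from |x| < sqrt(1 + |x|^2) and replaces the usual term that blows up at a
   final time. *)
have qlt (V : lmodType R) (X : set V) ip (E : euclid X ip) (y : R * V) : 0 < y.1 ->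
    ipnorm ip ((dpen delta A rho (weight ip vel y) / snorm 1 (ipnorm ip y.2)) *: y.2)
      < dpen delta A rho (weight ip vel y).
  move=> y0; have dp0 := dpen_gt0 delta0 A0 rho0 (weight_gt0 ip vel0 (ltW y0)).
  have n0 : 0 < snorm 1 (ipnorm ip y.2) by exact: snorm_gt0.
  rewrite (ipnormZ E) ger0_norm; last by rewrite divr_ge0 ?ltW.
  rewrite mulrAC ltr_pdivrMr // ltr_pM2l //.
  exact: le_lt_trans (ler_norm _) (snorm_gt _ _).
have q1d := qlt _ _ _ E1 _ t1; have q2d := qlt _ _ _ E2 _ t2.
rewrite -/m1 -/q1 in q1d; rewrite -/m2 -/q2 in q2d.
have d1A := dpen_le delta A0 rho0 m1; have d2A := dpen_le delta A0 rho0 m2.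
have := speed Yw Xq1 Xq2 wL (le_trans (ltW q1d) d1A) (le_trans (ltW q2d) d2A).
have v1 : vel * ipnorm ip1 q1 < vel * dpen delta A rho m1 by rewrite ltr_pM2l.
have v2 : vel * ipnorm ip2 q2 < vel * dpen delta A rho m2 by rewrite ltr_pM2l.
have TE : (y2.1 - y1.1) / T = - ((y1.1 - y2.1) / T) by rewrite -mulNr opprB.
by rewrite TE in hv; lra.
Qed.

End fixed_parameters.

Lemma doubling z1 z2 : cylinder D1 z1 -> cylinder D2 z2 ->
  u z1 - v z2 <= bound z1 z2.
Proof.
have A0 : 0 < A by exact: le_lt_trans KA.
have [? ? ?] := And3 L0 M0 delta0; move=> Cz1 Cz2.
(* With rho = 1/(2e) the regularisation costs at most [e * c]: [L * e] and [M * e] from the smoothed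
   distances, [A * e] times the squared weights from the penalties. The 1 keeps [c] positive. *)
pose c := 1 + L + M + A * (weight ip1 vel z1 ^+ 2 + weight ip2 vel z2 ^+ 2).
have c0 : 0 < c.
  by rewrite /c; have := mulr_ge0 (ltW A0) (addr_ge0 (sqr_ge0 (weight ip1 vel z1)) (sqr_ge0 (weight ip2 vel z2))); lra.
apply/ler_addgt0Pr => r r0.
pose e := r / c; have e0 : 0 < e by rewrite divr_gt0.
have ie0 : 0 < (2 * e)^-1 by rewrite invr_gt0; lra.
have := doubling_le0 e0 ie0 Cz1 Cz2.
have := pen_le delta A0 ie0 (weight ip1 vel z1).
have := pen_le delta A0 ie0 (weight ip2 vel z2).
have -> : 2 * (2 * e)^-1 = e^-1 by field; rewrite gt_eqF.
rewrite invrK.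
have := ler_wpM2l L0 (snorm_le (ipnorm ipw (a1 z1.2 - a2 z2.2)) (ltW e0)).
rewrite (ger0_norm (ipnorm_ge0 _ _)).
have := ler_wpM2l M0 (snorm_le (z1.1 - z2.1) (ltW e0)).
have : c * e = r by rewrite mulrC divfK // gt_eqF.
by rewrite /c /kernel /bound; lra.
Qed.

End doubling.

(** * Symmetric matrices and step functions *)

Section symmetric_matrices.
Context {R : realType} {D : nat}.
Implicit Types a b : 'M[R]_D.

Lemma mxipE a b : symm b -> mxip a b = \sum_i \sum_k a i k * b i k.
Proof.
move=> sb; rewrite /mxip /mxtrace; apply: eq_bigr => i _; rewrite mxE.
by apply: eq_bigr => k _; rewrite -[in RHS]sb mxE.
Qed.

Lemma mxipC a b : mxip a b = mxip b a. Proof. exact: mxtrace_mulC. Qed.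

Lemma mxipDl a b c : mxip (a + b) c = mxip a c + mxip b c.
Proof. by rewrite /mxip mulmxDl mxtraceD. Qed.

Lemma mxipZl t a b : mxip (t *: a) b = t * mxip a b.
Proof. by rewrite /mxip -scalemxAl mxtraceZ. Qed.

Lemma symmD a b : symm a -> symm b -> symm (a + b).
Proof. by rewrite /symm linearD /= => -> ->. Qed.

Lemma symmZ t a : symm a -> symm (t *: a).
Proof. by rewrite /symm linearZ /= => ->. Qed.

Lemma symm0 : symm (0 : 'M[R]_D). Proof. exact: trmx0. Qed.

Lemma sqr_entry_le_mxip a i k : symm a -> a i k ^+ 2 <= mxip a a.
Proof.
move=> sa; rewrite mxipE // (bigD1 i) //= (bigD1 k) //= -expr2 -addrA lerDl.
rewrite addr_ge0 //; first by apply: sumr_ge0 => m _; rewrite -expr2 sqr_ge0.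
by do 2 apply: sumr_ge0 => ? _; rewrite -expr2 sqr_ge0.
Qed.

Lemma euclid_mx : euclid (@symm R D) (@mxip R D).
Proof.
split=> //; [exact: symm0 | exact: symmD | exact: symmZ | exact: mxipC
  | exact: mxipDl | exact: mxipZl | |].
- move=> a sa; rewrite mxipE //.
  by do 2 apply: sumr_ge0 => ? _; rewrite -expr2 sqr_ge0.
- move=> a sa a0; apply/matrixP => i k; rewrite mxE; apply/eqP.
  by rewrite -sqrf_eq0 eq_le sqr_ge0 andbT -a0 sqr_entry_le_mxip.
Qed.

Definition qform (v : 'cV[R]_D) a : R := (v^T *m a *m v) 0 0.

Lemma qformE v a : qform v a = \sum_i \sum_k v i 0 * v k 0 * a i k.
Proof.
rewrite /qform mxE exchange_big /=; apply: eq_bigr => k _.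
by rewrite mxE mulr_suml; apply: eq_bigr => i _; rewrite !mxE; ring.
Qed.

Lemma qformD v a b : qform v (a + b) = qform v a + qform v b.
Proof. by rewrite /qform mulmxDr mulmxDl mxE. Qed.

Lemma qformZ v t a : qform v (t *: a) = t * qform v a.
Proof. by rewrite /qform -scalemxAr -scalemxAl mxE. Qed.

Lemma qformB v a b : qform v (a - b) = qform v a - qform v b.
Proof. by rewrite qformD -scaleN1r qformZ mulN1r. Qed.

Lemma psdD a b : psd a -> psd b -> psd (a + b).
Proof.
move=> [sa pa] [sb pb]; split; first exact: symmD.
by move=> v; have := qformD v a b; rewrite /qform => ->; rewrite addr_ge0.
Qed.

Lemma psdZ t a : 0 <= t -> psd a -> psd (t *: a).
Proof.
move=> t0 [sa pa]; split; first exact: symmZ.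
by move=> v; have := qformZ v t a; rewrite /qform => ->; rewrite mulr_ge0.
Qed.

Lemma psd0 : psd (0 : 'M[R]_D).
Proof. by split; [exact: symm0 | move=> v; rewrite mulmx0 mul0mx mxE]. Qed.

Lemma psd_rank1 (v : 'cV[R]_D) : psd (v *m v^T).
Proof.
split; first by rewrite /symm trmx_mul trmxK.
move=> w; rewrite mulmxA -mulmxA mxE big_ord1.
by rewrite -[X in X * _]/((w^T *m v) 0 0) -[w^T *m v]trmxK trmx_mul trmxK mxE -expr2 sqr_ge0.
Qed.

Lemma mxip_rank1 (v : 'cV[R]_D) a : mxip a (v *m v^T) = qform v a.
Proof. by rewrite /mxip mulmxA mxtrace_mulC mulmxA /mxtrace big_ord1. Qed.

Lemma qform_delta a i k : symm a ->
  qform (delta_mx i 0 + delta_mx k 0) a = a i i + a k k + 2 * a i k /\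
  qform (delta_mx i 0 - delta_mx k 0) a = a i i + a k k - 2 * a i k.
Proof.
move=> sa; pose B (v w : 'cV[R]_D) := (v^T *m a *m w) 0 0.
have e m n : B (delta_mx m 0) (delta_mx n 0) = a m n.
  by rewrite /B trmx_delta -rowE -colE !mxE.
have BD v w t : qform (v + t *: w) a = B v v + t * (B v w + B w v) + t ^+ 2 * B w w.
  rewrite /qform /B [(_ + _)^T]linearD /= [(_ *: _)^T]linearZ /= !mulmxDl !mulmxDr.
  by rewrite -!scalemxAl -!scalemxAr !mxE; ring.
have aki : a k i = a i k by rewrite -[in LHS]sa mxE.
split; first by rewrite -[delta_mx k 0]scale1r BD !e aki; ring.
by rewrite -scaleN1r BD !e aki; ring.
Qed.

Lemma qform_eq0 a : symm a -> (forall v, qform v a = 0) -> a = 0.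
Proof.
move=> sa q0; apply/matrixP => i k; rewrite mxE.
by have [] := qform_delta i k sa; rewrite !q0; lra.
Qed.

(** Nonnegativity of the form at e_i + e_k and e_i - e_k bounds 2|a_ik| by a_ii + a_kk. This is how
    a monotone matrix path is controlled by the scalar increasing function [\tr (mu s)]. *)
Lemma psd_entry_le_trace a i k : psd a -> `|a i k| <= \tr a.
Proof.
move=> [sa pa]; have [q1 q2] := qform_delta i k sa.
have d0 m : 0 <= a m m.
  by have [+ _] := qform_delta m m sa; have := pa (delta_mx m 0 + delta_mx m 0); rewrite /qform; lra.
have dt m : a m m <= \tr a.
  by rewrite /mxtrace (bigD1 m) //= lerDl sumr_ge0.
have := pa (delta_mx i 0 + delta_mx k 0); have := pa (delta_mx i 0 - delta_mx k 0).
rewrite -[X in 0 <= X -> _]/(qform _ _) -[X in _ -> 0 <= X -> _]/(qform _ _) q1 q2.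
by have := (dt i, dt k) => -[? ?] ? ?; rewrite ler_norml; apply/andP; split; lra.
Qed.

End symmetric_matrices.

Section subdivision_theory.
Context {R : realType}.
Implicit Type j : subdivision R.

Lemma size_subdivision_gt0 j : (0 < size j)%N.
Proof.
case: j => [[|x s] h l] //=; exfalso; move: l => /= /eqP.
by rewrite eq_sym oner_eq0.
Qed.

Lemma lptS j k : lpt j k.+1 = rpt j k. Proof. by []. Qed.

Lemma lpt0 j : lpt j 0 = 0. Proof. by []. Qed.

Lemma lpt_size j : lpt j (size j) = 1.
Proof. by rewrite /lpt -[size j]/(size (0 :: points j)).-1 nth_last /= points_last. Qed.

Lemma lt_lpt_rpt j k : (k < size j)%N -> lpt j k < rpt j k.
Proof. by move=> kj; have /(pathP 0) := points_sorted j; apply. Qed.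

Lemma width_gt0 j k : (k < size j)%N -> 0 < width j k.
Proof. by move=> kj; rewrite subr_gt0 lt_lpt_rpt. Qed.

Lemma le_lpt j k l : (k <= l)%N -> (l <= size j)%N -> lpt j k <= lpt j l.
Proof.
move=> /subnK <-; elim: (l - k)%N => [|m IH] h; first by rewrite add0n.
rewrite addSn lptS; apply: le_trans (IH _) _; first exact: ltnW.
exact/ltW/lt_lpt_rpt.
Qed.

Lemma lpt_ge0 j k : (k <= size j)%N -> 0 <= lpt j k.
Proof. by move=> kj; rewrite -(lpt0 j) le_lpt. Qed.

Lemma lpt_le1 j k : (k <= size j)%N -> lpt j k <= 1.
Proof. by move=> kj; rewrite -(lpt_size j) le_lpt. Qed.

Lemma cellE j k s : cell j k s = (lpt j k <= s < rpt j k) :> Prop.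
Proof. by rewrite /cell /= in_itv. Qed.

Lemma sub_cell01 j k : (k < size j)%N -> cell j k `<=` `[0, 1[.
Proof.
move=> kj s; rewrite cellE /= in_itv /= => /andP[h1 h2]; apply/andP; split.
  by apply: le_trans h1; apply: lpt_ge0; exact: ltnW.
by apply: lt_le_trans h2 _; rewrite -lptS lpt_le1.
Qed.

Lemma cell_cover j s : (`[0, 1[%classic : set R) s -> exists k : 'I_(size j), cell j k s.
Proof.
rewrite /= in_itv /= => /andP[s0 s1].
suff h n : (n <= size j)%N -> s < lpt j n -> exists2 k, (k < n)%N & cell j k s.
  have [k kn ck] := h (size j) (leqnn _) (eq_ind_r (fun x => s < x) s1 (lpt_size j)).
  by exists (Ordinal kn).
elim: n => [|n IH] nj; first by rewrite lpt0 ltNge s0.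
have [h _|h h'] := ltP s (lpt j n).
  by have [k kn ck] := IH (ltnW nj) h; exists k => //; exact: ltnW.
by exists n => //; rewrite cellE h.
Qed.

Lemma cell_uniq j k l s : (k < size j)%N -> (l < size j)%N ->
  cell j k s -> cell j l s -> k = l.
Proof.
have h m n : (m < size j)%N -> (n < size j)%N -> (m < n)%N ->
    cell j m s -> cell j n s -> False.
  move=> mj nj mn; rewrite !cellE => /andP[_ h1] /andP[h2 _].
  have := le_lpt mn (ltnW nj); rewrite lptS => h3.
  by have := lt_le_trans h1 (le_trans h3 h2); rewrite ltxx.
move=> kj lj ck cl; case: (ltngtP k l) => // kl; exfalso.
  exact: h kj lj kl ck cl.
exact: h lj kj kl cl ck.
Qed.

Lemma measurable_cell j k : measurable (cell j k : set (measurableTypeR R)).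
Proof. exact: measurable_itv. Qed.

Lemma lebesgue_cell j k : (k < size j)%N ->
  lebesgue_measure (cell j k) = (width j k)%:E.
Proof.
move=> kj; rewrite /cell lebesgue_measure_itv /= lte_fin lt_lpt_rpt //.
Qed.

Lemma sum_width j : \sum_(k < size j) width j k = 1.
Proof.
rewrite -(big_mkord xpredT (fun k => width j k)) /=.
under eq_bigr do rewrite /width -lptS.
by rewrite telescope_sumr // lpt_size lpt0 subr0.
Qed.

End subdivision_theory.

Section step_functions.
Context {R : realType} {D : nat}.
Implicit Type j : subdivision R.

Lemma HvecD j (x y : Hvec D j) k : (x + y) k = x k + y k.
Proof. exact: ffunE. Qed.

Lemma HvecZ j t (x : Hvec D j) k : (t *: x) k = t *: x k.
Proof. exact: ffunE. Qed.

Lemma Hvec0 j k : (0 : Hvec D j) k = 0.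
Proof. exact: ffunE. Qed.

Lemma HvecN j (x : Hvec D j) k : (- x) k = - x k.
Proof. exact: ffunE. Qed.

Lemma HvecB j (x y : Hvec D j) k : (x - y) k = x k - y k.
Proof. by rewrite HvecD HvecN. Qed.

Lemma euclid_Hj j : euclid (@Hj R D j) (@Hjip R D j).
Proof.
split.
- by move=> k; rewrite Hvec0; exact: symm0.
- by move=> x y hx hy k; rewrite HvecD; exact: symmD.
- by move=> t x hx k; rewrite HvecZ; exact: symmZ.
- by move=> x y; apply: eq_bigr => k _; rewrite mxipC.
- move=> x y z; rewrite -big_split; apply: eq_bigr => k _.
  by rewrite HvecD mxipDl mulrDr.
- move=> t x y; rewrite mulr_sumr; apply: eq_bigr => k _.
  by rewrite HvecZ mxipZl mulrCA.
- move=> x hx; apply: sumr_ge0 => k _.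
  by rewrite mulr_ge0 ?(ip_ge0 euclid_mx (hx k)) // ltW // width_gt0.
- move=> x hx /eqP; rewrite psumr_eq0; last first.
    move=> k _; rewrite mulr_ge0 ?(ip_ge0 euclid_mx (hx k)) // ltW //.
    exact: width_gt0.
  move=> /allP h; apply/ffunP => k; have := h k (mem_index_enum k).
  rewrite mulf_eq0 gt_eqF ?width_gt0 //= => /eqP.
  by move=> /(ip_eq0 euclid_mx (hx k)) ->; rewrite Hvec0.
Qed.

Lemma Cj_sub j : @Cj R D j `<=` @Hj R D j.
Proof. by move=> x [h _] k; case: (h k). Qed.

Lemma Cj0 j : @Cj R D j 0.
Proof.
by split=> [k|k l _]; rewrite !Hvec0 ?subr0; exact: psd0.
Qed.

Lemma Cj_cone j (x y : Hvec D j) (s : R) :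
  Cj x -> Cj y -> 0 <= s -> Cj (x + s *: y).
Proof.
move=> [px mx] [py my] s0; split=> [k|k l kl]; rewrite !HvecD !HvecZ.
  by apply: psdD => //; exact: psdZ.
rewrite opprD addrACA -scalerBr; apply: psdD; first exact: mx.
by apply: psdZ => //; exact: my.
Qed.

(** The arrays jumping from 0 to v v^T at positions k and k+1 both belong to the cone. Their
    difference isolates the k-th entry of [q], which is determined by its quadratic form. *)
Lemma Cj_span j (q : Hvec D j) : Hj q ->
  (forall v : Hvec D j, Cj v -> Hjip q v = 0) -> q = 0.
Proof.
move=> hq h; apply/ffunP => k; rewrite Hvec0; apply: qform_eq0 => // v.
pose f m : Hvec D j := [ffun l : 'I_(size j) => if (m <= l)%N then v *m v^T else 0].
have fE m (l : 'I_(size j)) : f m l = if (m <= l)%N then v *m v^T else 0.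
  exact: ffunE.
have Cf m : Cj (f m).
  split=> [l|l l' ll']; rewrite !fE.
    by case: ifP => _; [exact: psd_rank1 | exact: psd0].
  have [ml|ml] := leqP m l; first by rewrite (leq_trans ml) // subrr; exact: psd0.
  by rewrite subr0; case: ifP => _; [exact: psd_rank1 | exact: psd0].
have := h _ (Cf k); have := h _ (Cf k.+1); rewrite /Hjip => h1 h2.
have : \sum_(l < size j) width j l * mxip (q l) (f k l)
     - \sum_(l < size j) width j l * mxip (q l) (f k.+1 l) = 0.
  by rewrite h1 h2 subrr.
rewrite -sumrB (bigD1 k) //= big1 => [|l lk]; last first.
  by rewrite !fE ltn_neqAle eq_sym -val_eqE /= in lk *; rewrite lk subrr.
rewrite !fE leqnn ltnn (mxipC _ 0) -(scale0r 0) mxipZl mul0r mulr0 subr0 addr0.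
by move=> /eqP; rewrite mulf_eq0 gt_eqF ?width_gt0 //= mxip_rank1 => /eqP.
Qed.

End step_functions.

(** * Existence of maxima *)

Section closed_cone.
Context {R : realType} {D : nat} {T : topologicalType} (A : set T).

Lemma closure_ge0 (f : T -> R) : continuous f -> (forall u, A u -> 0 <= f u) ->
  forall u, closure A u -> 0 <= f u.
Proof.
move=> cf Af u Au.
have cl : closed (f @^-1` [set x | 0 <= x]).
  by apply: preimage_closed; [move=> x _; exact: cf | exact: closed_ge].
have := closureS (Af : A `<=` f @^-1` [set x | 0 <= x]).
by move/closure_id: cl => <-; apply.
Qed.

Lemma closure_psd (m : T -> 'M[R]_D) :
  (forall i k, continuous (fun u => m u i k)) -> (forall u, A u -> psd (m u)) ->
  forall u, closure A u -> psd (m u).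
Proof.
move=> cm Am u Au; split=> [|v].
  have h i k : 0 <= m u i k - m u k i.
    apply: (@closure_ge0 (fun u => m u i k - m u k i)) => //.
      by move=> x; apply: cvgB; exact: cm.
    by move=> x /Am [sx _]; rewrite -[in X in _ - X]sx mxE subrr.
  apply/matrixP => i k; rewrite mxE; have := h i k; have := h k i; lra.
rewrite -[X in _ <= X]/(qform v (m u)) qformE.
apply: (@closure_ge0 (fun u => \sum_i \sum_k v i 0 * v k 0 * m u i k)) => //.
  apply: continuous_big; first exact: add_continuous.
  move=> i _; apply: continuous_big; first exact: add_continuous.
  by move=> k _ x; apply: cvgMr; exact: cm.
by move=> x /Am [_ px]; rewrite -qformE; exact: px.
Qed.

End closed_cone.

Section decoding.
Context {R : realType} {D : nat}.
Implicit Type j : subdivision R.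

(** One coordinate for the time and one for each matrix entry of each cell, so that maxima can be
    sought among row vectors. *)
Definition code j := (unit + 'I_(size j) * ('I_D * 'I_D))%type.

Definition decode j (c : code j -> R) : R * Hvec D j :=
  (c (inl tt), [ffun k : 'I_(size j) => \matrix_(a, b) c (inr (k, (a, b)))]).

Definition encode j (z : R * Hvec D j) (i : code j) : R :=
  match i with inl _ => z.1 | inr (k, (a, b)) => z.2 k a b end.

Lemma decode2E j (c : code j -> R) k a b : (decode c).2 k a b = c (inr (k, (a, b))).
Proof. by rewrite /decode /= ffunE mxE. Qed.

Lemma encodeK j : cancel (@encode j) (@decode j).
Proof.
move=> [t x]; rewrite /decode /=; congr pair; apply/ffunP => k.
by rewrite ffunE; apply/matrixP => a b; rewrite mxE.
Qed.

Lemma ipnorm_Hj_le j (x : Hvec D j) (r : R) : 0 <= r ->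
  (forall k a b, `|x k a b| <= r) -> ipnorm (@Hjip R D j) x <= D%:R * r.
Proof.
move=> r0 h; have Dr : 0 <= D%:R * r by rewrite mulr_ge0 // ler0n.
rewrite -(ger0_norm Dr) -sqrtr_sqr ler_wsqrtr //.
rewrite /Hjip -[leRHS]mul1r -[X in _ <= X * _](sum_width j) mulr_suml; apply: ler_sum => k _.
rewrite ler_wpM2l ?(ltW (width_gt0 _)) //.
rewrite /mxip /mxtrace exprMn -natrX.
have hh : forall a b, x k a b * x k b a <= r ^+ 2.
  move=> a b; apply: le_trans (ler_norm _) _.
  by rewrite normrM expr2 ler_pM.
apply: (@le_trans _ _ (\sum_(i < D) \sum_(l < D) r ^+ 2)).
  by apply: ler_sum => a _; rewrite mxE; apply: ler_sum => b _.
by rewrite !sumr_const !card_ord -mulrnA mulr_natl mulnn.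
Qed.

Lemma tnorm_decode_le j (c c' : code j -> R) (r : R) : 0 <= r ->
  (forall i, `|c i - c' i| <= r) ->
  tnorm (@Hjip R D j) (decode c - decode c') <= (1 + D%:R) * r.
Proof.
move=> r0 h; rewrite /tnorm mulrDl mul1r lerD //; first exact: h.
apply: ipnorm_Hj_le => // k a b.
by rewrite HvecB !mxE !decode2E; exact: h.
Qed.

Lemma encode_bounded j (r : R) : exists B, forall z : R * Hvec D j,
  Hj z.2 -> tnorm (@Hjip R D j) z <= r -> forall i, `|encode z i| <= B.
Proof.
(* The norm weights each entry by the width of its cell, so a squared entry is at most r^2 / width.
   The summand 1 makes c at least 1, whence c <= c^2. *)
pose c := 1 + \sum_(k < size j) (width j k)^-1.
have c1 (k : 'I_(size j)) : (width j k)^-1 <= c.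
  rewrite /c (bigD1 k) //= addrCA lerDl addr_ge0 // sumr_ge0 // => l _.
  by rewrite invr_ge0 ltW // width_gt0.
have c0 : 1 <= c by rewrite lerDl sumr_ge0 // => l _; rewrite invr_ge0 ltW // width_gt0.
exists (r * c) => z hz zr.
have [n1 n2] := (normr_ge0 z.1, ipnorm_ge0 (@Hjip R D j) z.2).
have r0 : 0 <= r by apply: le_trans zr; exact: tnorm_ge0.
move: zr; rewrite /tnorm => zr.
case=> [t|[k [a b]]] /=; first by apply: (@le_trans _ _ r); [lra|rewrite ler_peMr].
apply: le_sqr_abs; first by rewrite mulr_ge0 //; lra.
have w0 := width_gt0 (ltn_ord k).
have h : width j k * (z.2 k a b) ^+ 2 <= r ^+ 2.
  apply: (@le_trans _ _ (ipnorm (@Hjip R D j) z.2 ^+ 2)); last first.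
    by rewrite ler_sqr ?nnegrE //; lra.
  rewrite (sqr_ipnorm (euclid_Hj _)) // /Hjip (bigD1 k) //=.
  rewrite -[leLHS]addr0 lerD //.
    by rewrite ler_pM2l // sqr_entry_le_mxip.
  apply: sumr_ge0 => l _; rewrite mulr_ge0 ?(ip_ge0 euclid_mx (hz l)) //.
  by rewrite ltW // width_gt0.
have {}h : z.2 k a b ^+ 2 <= (width j k)^-1 * r ^+ 2.
  by rewrite mulrC ler_pdivlMr // mulrC.
apply: (le_trans h); rewrite exprMn mulrC ler_wpM2l ?sqr_ge0 //.
by apply: le_trans (c1 k) _; rewrite expr2 ler_peMr //; lra.
Qed.

Lemma closure_cylinder j (T : topologicalType) (A : set T) (c : T -> code j -> R) :
  (forall i, continuous (fun u => c u i)) ->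
  (forall u, A u -> cylinder (@Cj R D j) (decode (c u))) ->
  forall u, closure A u -> cylinder (@Cj R D j) (decode (c u)).
Proof.
move=> cc hA u Au; split; [|split].
- by apply: (closure_ge0 (f := fun u => c u (inl tt)) _ _ Au) => [|v /hA[]//]; exact: cc.
- move=> k; apply: (closure_psd (m := fun u => (decode (c u)).2 k) _ _ Au).
    by move=> a b; under eq_fun do rewrite decode2E; exact: cc.
  by move=> v /hA [_ []].
- move=> k l kl.
  apply: (closure_psd (m := fun u => (decode (c u)).2 l - (decode (c u)).2 k) _ _ Au).
    move=> a b; under eq_fun do rewrite !mxE -/(decode _) !decode2E.
    by move=> x; apply: cvgB; exact: cc.
  by move=> v /hA [_ [_]]; exact.
Qed.

Lemma attains_max_Cj j j' :
  attains_max (@Hjip R D j) (@Cj R D j) (@Hjip R D j') (@Cj R D j').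
Proof.
move=> g r gc.
pose I := (code j + code j')%type; pose N := #|{: I}|.
pose c1 (u : 'rV[R]_N) (i : code j) := u 0 (enum_rank (inl i : I)).
pose c2 (u : 'rV[R]_N) (i : code j') := u 0 (enum_rank (inr i : I)).
have [B1 hB1] := encode_bounded j r; have [B2 hB2] := encode_bounded j' r.
(* A cube containing the coordinates of both balls; the third bound makes it contain 0, so that the
   compact set is nonempty. *)
pose B := Num.max (Num.max B1 B2) 0.
have B0 : 0 <= B by rewrite le_max lexx orbT.
pose A := [set u : 'rV[R]_N | [/\ cylinder (@Cj R D j) (decode (c1 u)),
  cylinder (@Cj R D j') (decode (c2 u)) & forall i, `|u 0 i| <= B]].
have A0 : A 0.
  have d1 : decode (c1 0) = 0.
    congr pair; first by rewrite /c1 mxE.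
    by apply/ffunP => k; rewrite Hvec0; apply/matrixP => a b; rewrite decode2E /c1 !mxE.
  have d2 : decode (c2 0) = 0.
    congr pair; first by rewrite /c2 mxE.
    by apply/ffunP => k; rewrite Hvec0; apply/matrixP => a b; rewrite decode2E /c2 !mxE.
  split; first by rewrite d1; split => //; exact: Cj0.
    by rewrite d2; split => //; exact: Cj0.
  by move=> i; rewrite mxE normr0.
have cc i : continuous (fun u : 'rV[R]_N => u 0 i) by exact: coord_continuous.
have cA : compact A.
  apply: bounded_closed_compact.
    exists B; split; first exact: num_real.
    move=> x Bx u [_ _ hu]; rewrite /=. rewrite -[leLHS]/(mx_norm u) mx_normrE.
    apply/bigmax_leP; split; first by apply: le_trans B0 _; exact: ltW.
    by move=> [i k] _ /=; rewrite (ord1 i); apply: le_trans (hu k) _; exact: ltW.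
  move=> u Au; split.
  - apply: closure_cylinder Au => [i|v []//]; exact: coord_continuous.
  - apply: closure_cylinder Au => [i|v []//]; exact: coord_continuous.
  - move=> i; have h1 : 0 <= B - u 0 i.
      apply: (@closure_ge0 _ _ A (fun u : 'rV[R]_N => B - u 0 i)) => //.
        by move=> x; apply: cvgB (@cc i x); exact: cvg_cst.
      by move=> v [_ _ /(_ i)]; rewrite ler_norml subr_ge0 => /andP[].
    have h2 : 0 <= u 0 i + B.
      apply: (@closure_ge0 _ _ A (fun u : 'rV[R]_N => u 0 i + B)) => //.
        by move=> x; apply: cvgD (@cc i x) _; exact: cvg_cst.
      by move=> v [_ _ /(_ i)]; rewrite ler_norml => /andP[? ?]; lra.
    by rewrite ler_norml; apply/andP; split; lra.
pose f u := g (decode (c1 u)) (decode (c2 u)).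
have cf : {within A, continuous f}.
  apply/subspace_continuousP => u Au; have [C1 C2 _] := Au.
  apply/cvgrPdist_lt => e e0; have [del del0 hdel] := gc _ _ C1 C2 e e0.
  have D0 : 0 < 1 + D%:R :> R by rewrite ltr_pwDl // ler0n.
  have ee0 : 0 < del / (2 * (1 + D%:R)) by rewrite divr_gt0 // mulr_gt0.
  rewrite near_withinE; apply/nbhs_ballP; exists (del / (2 * (1 + D%:R))) => //=.
  move=> w [_ uw] [Cw1 Cw2 _].
  have lt_del : (1 + D%:R) * (del / (2 * (1 + D%:R))) < del.
    have -> : (1 + D%:R) * (del / (2 * (1 + D%:R))) = del / 2 by field; rewrite gt_eqF.
    by lra.
  have wu i : `|w 0 i - u 0 i| <= del / (2 * (1 + D%:R)).
    by rewrite distrC; apply/ltW; exact: uw.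
  rewrite distrC; apply: hdel => //.
    by apply: le_lt_trans lt_del; apply: tnorm_decode_le => [|i]; [exact: ltW|exact: wu].
  by apply: le_lt_trans lt_del; apply: tnorm_decode_le => [|i]; [exact: ltW|exact: wu].
have [u Au umax] := @EVT_max_rV _ _ f A (ex_intro _ _ A0) cA cf.
move: Au; rewrite inE => -[C1 C2 _].
exists (decode (c1 u)), (decode (c2 u)); split=> // w1 w2 Cw1 Cw2 w1r w2r.
pose w : 'rV[R]_N := \row_i match enum_val i with
  | inl i1 => encode w1 i1 | inr i2 => encode w2 i2 end.
have e1 : decode (c1 w) = w1.
  rewrite -[RHS]encodeK; congr (decode _); apply/funext => i.
  by rewrite /c1 mxE enum_rankK.
have e2 : decode (c2 w) = w2.
  rewrite -[RHS]encodeK; congr (decode _); apply/funext => i.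
  by rewrite /c2 mxE enum_rankK.
have Aw : A w.
  split; rewrite ?e1 ?e2 // => i; rewrite mxE !le_max.
  case: (enum_val i) => k; first by rewrite hB1 //; case: Cw1 => _ /Cj_sub.
  by rewrite hB2 ?orbT //; case: Cw2 => _ /Cj_sub.
by have := umax w; rewrite inE /f e1 e2; apply.
Qed.

End decoding.

(** * Square-integrable paths *)

Section unit_interval.
Context {R : realType}.
Local Notation I01 := (`[0, 1[%classic : set R).
Local Notation lambda := (@lebesgue_measure R).
Implicit Types f g : R -> R.

Definition integrable01 f : Prop := lambda.-integrable I01 (EFin \o f).

Lemma measurable01 : measurable (I01 : set (measurableTypeR R)). Proof. exact: measurable_itv. Qed.

Lemma lebesgue01 : lambda I01 = 1%E.
Proof. by rewrite lebesgue_measure_itv /= lte_fin ltr01 sube0. Qed.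

Lemma integrable01_measurable f : integrable01 f -> measurable_fun I01 f.
Proof. by move=> /integrableP[/measurable_EFinP]. Qed.

Lemma integrable01_dom f g : measurable_fun I01 f -> integrable01 g ->
  (forall s, I01 s -> `|f s| <= g s) -> integrable01 f.
Proof.
move=> mf ig fg; apply: (le_integrable measurable01) ig; first exact/measurable_EFinP.
by move=> s Is /=; rewrite lee_fin (le_trans (fg s Is)) // ler_norm.
Qed.

Lemma integrable01_eq f g : (forall s, I01 s -> f s = g s) ->
  integrable01 f -> integrable01 g.
Proof.
move=> fg; apply: (eq_integrable measurable01).
by move=> s; rewrite inE => Is /=; rewrite fg.
Qed.

Lemma integrable01_cst c : integrable01 (fun=> c).
Proof.
apply: (measurable_bounded_integrable measurable01) => //.
  by rewrite [ltLHS]lebesgue01 ltry.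
by exists `|c|; split=> [|x cx s _]; [exact: num_real | exact: ltW].
Qed.

Lemma integrable01D f g : integrable01 f -> integrable01 g ->
  integrable01 (fun s => f s + g s).
Proof. by move=> hf hg; exact: (integrableD measurable01 hf hg). Qed.

Lemma integrable01Zl c f : integrable01 f -> integrable01 (fun s => c * f s).
Proof. by move=> hf; exact: (integrableZl measurable01 c hf). Qed.

Lemma integrable01B f g : integrable01 f -> integrable01 g ->
  integrable01 (fun s => f s - g s).
Proof. by move=> hf hg; exact: (integrableB measurable01 hf hg). Qed.

Lemma integrable01_norm f : integrable01 f -> integrable01 (fun s => `|f s|).
Proof. exact: integrable_norm. Qed.

Lemma integrable01_sum (I : Type) (r : seq I) (F : I -> R -> R) :
  (forall i, integrable01 (F i)) -> integrable01 (fun s => \sum_(i <- r) F i s).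
Proof.
move=> hF; elim: r => [|i r IH].
  by under eq_fun do rewrite big_nil; exact: integrable01_cst.
by under eq_fun do rewrite big_cons; exact: integrable01D.
Qed.

Lemma Rintegral01_sum (I : Type) (r : seq I) (F : I -> R -> R) :
  (forall i, integrable01 (F i)) ->
  \int[lambda]_(s in I01) (\sum_(i <- r) F i s) =
  \sum_(i <- r) \int[lambda]_(s in I01) F i s.
Proof.
move=> hF; elim: r => [|i r IH].
  rewrite big_nil; under eq_Rintegral do rewrite big_nil.
  by rewrite Rintegral_cst ?mul0r //; exact measurable01.
rewrite big_cons -IH -RintegralD //; first by apply: eq_Rintegral => s _; rewrite big_cons.
- exact: hF.
- exact: integrable01_sum.
Qed.

Lemma Rintegral01_cst c : \int[lambda]_(s in I01) (c : R) = c.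
Proof.
by rewrite Rintegral_cst; [rewrite [X in fine X]lebesgue01 mulr1 | exact measurable01].
Qed.

Lemma Rintegral01_eq f g : (forall s, I01 s -> f s = g s) ->
  \int[lambda]_(s in I01) f s = \int[lambda]_(s in I01) g s.
Proof. by move=> fg; apply: eq_Rintegral => s; rewrite inE => /fg. Qed.

Lemma Rintegral01_le f g : integrable01 f -> integrable01 g ->
  (forall s, I01 s -> f s <= g s) ->
  \int[lambda]_(s in I01) f s <= \int[lambda]_(s in I01) g s.
Proof. by move=> hf hg; exact: (le_Rintegral measurable01 hf hg). Qed.

Section cells.
Variable j : subdivision R.

Lemma integrable_cell f (k : 'I_(size j)) :
  integrable01 f -> lambda.-integrable (cell j k) (EFin \o f).
Proof.
exact: (integrableS measurable01 (measurable_cell j k) (sub_cell01 (ltn_ord k))).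
Qed.

Lemma restrict_cell f k : f \_ (cell j k) = (fun s => \1_(cell j k) s * f s).
Proof.
apply/funext => s; rewrite /patch indicE; case: ifP => _; first by rewrite mul1r.
by rewrite mul0r.
Qed.

Lemma integrable01_cell f k : integrable01 f ->
  integrable01 (fun s => \1_(cell j k) s * f s).
Proof.
move=> hf; apply: (@integrable01_dom _ (fun s => `|f s|)).
- apply: measurable_funM; last exact: integrable01_measurable.
  by apply: measurable_indic; exact: (measurable_cell _ _).
- exact: integrable01_norm.
- move=> s _; rewrite normrM indicE; case: (_ \in _) => /=.
    by rewrite normr1 mul1r.
  by rewrite normr0 mul0r.
Qed.

Lemma Rintegral01_cell f (k : 'I_(size j)) :
  \int[lambda]_(s in I01) (\1_(cell j k) s * f s) =
  \int[lambda]_(s in cell j k) f s.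
Proof.
rewrite -[in RHS](setIidr (@sub_cell01 _ j k (ltn_ord k))) Rintegral_mkcondr.
by rewrite restrict_cell.
Qed.

Lemma cell_indic s (k l : 'I_(size j)) : cell j k s ->
  \1_(cell j l) s = (l == k)%:R :> R.
Proof.
move=> ck; rewrite indicE; congr ((nat_of_bool _)%:R); apply/idP/eqP => [|->].
  rewrite inE => cl; apply/val_inj; exact: (cell_uniq (ltn_ord l) (ltn_ord k) cl ck).
by rewrite inE.
Qed.

Lemma sum_cell_indic s (F : 'I_(size j) -> R) (k : 'I_(size j)) : cell j k s ->
  \sum_(l < size j) \1_(cell j l) s * F l = F k.
Proof.
move=> ck; rewrite (bigD1 k) //= (cell_indic _ ck) eqxx mul1r big1 ?addr0 //.
by move=> l /negPf lk; rewrite (cell_indic _ ck) lk mul0r.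
Qed.

Lemma Rintegral_cell_cst (k : 'I_(size j)) c :
  \int[lambda]_(s in cell j k) (c : R) = width j k * c.
Proof.
rewrite Rintegral_cst; last exact: (measurable_cell _ _).
by rewrite [X in fine X](lebesgue_cell (ltn_ord k)) mulrC.
Qed.

Lemma Rintegral_cell_le f g (k : 'I_(size j)) : integrable01 f -> integrable01 g ->
  (forall s, cell j k s -> f s <= g s) ->
  \int[lambda]_(s in cell j k) f s <= \int[lambda]_(s in cell j k) g s.
Proof.
move=> hf hg.
exact: (le_Rintegral (measurable_cell j k) (integrable_cell k hf) (integrable_cell k hg)).
Qed.

Lemma Rintegral01_cells f : integrable01 f ->
  \int[lambda]_(s in I01) f s =
  \sum_(k < size j) \int[lambda]_(s in cell j k) f s.
Proof.
move=> hf; under [RHS]eq_bigr do rewrite -Rintegral01_cell.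
rewrite -Rintegral01_sum; last by move=> k; exact: integrable01_cell.
apply: Rintegral01_eq => s /(cell_cover j) [k ck].
by rewrite (sum_cell_indic (fun=> f s) ck).
Qed.

End cells.
End unit_interval.

Section square_integrable_paths.
Context {R : realType} {D : nat}.
Local Notation I01 := (`[0, 1[%classic : set R).
Local Notation lambda := (@lebesgue_measure R).
Implicit Types (iota kappa : R -> 'M[R]_D) (j : subdivision R).

Lemma sqr_mxnorm2 (a : 'M[R]_D) : symm a -> mxnorm2 a ^+ 2 = mxip a a.
Proof. by move=> sa; rewrite (sqr_ipnorm euclid_mx). Qed.

Lemma mxipE_gen (a b : 'M[R]_D) : mxip a b = \sum_i \sum_k a i k * b k i.
Proof. by apply: eq_bigr => i _; rewrite mxE. Qed.

Lemma measurable_mxip iota kappa :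
  (forall a b, measurable_fun I01 (fun s => iota s a b)) ->
  (forall a b, measurable_fun I01 (fun s => kappa s a b)) ->
  measurable_fun I01 (fun s => mxip (iota s) (kappa s)).
Proof.
move=> mi mk; under [X in measurable_fun _ X]eq_fun do rewrite mxipE_gen.
apply: measurable_sum => a; apply: measurable_sum => b.
exact: measurable_funM.
Qed.

Lemma L2_integrable iota : L2 iota ->
  integrable01 (fun s => mxip (iota s) (iota s)).
Proof.
move=> [si mi fi]; apply/integrableP; split.
  by apply/measurable_EFinP; apply: measurable_mxip.
apply: le_lt_trans fi; rewrite le_eqVlt; apply/orP; left; apply/eqP.
apply: eq_integral => s; rewrite inE => Is; rewrite /= sqr_mxnorm2; last exact: si.
by rewrite ger0_norm // (ip_ge0 euclid_mx) //; exact: si.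
Qed.

Lemma integrable_L2 iota : (forall s, I01 s -> symm (iota s)) ->
  (forall a b, measurable_fun I01 (fun s => iota s a b)) ->
  integrable01 (fun s => mxip (iota s) (iota s)) -> L2 iota.
Proof.
move=> si mi /integrableP[_ fi]; split=> //.
apply: le_lt_trans fi; rewrite le_eqVlt; apply/orP; left; apply/eqP.
apply: eq_integral => s; rewrite inE => Is; rewrite /= sqr_mxnorm2; last exact: si.
by rewrite ger0_norm // (ip_ge0 euclid_mx) //; exact: si.
Qed.

Lemma L2_entry iota a b : L2 iota -> integrable01 (fun s => iota s a b).
Proof.
move=> hi; have [si mi _] := hi.
apply: (@integrable01_dom _ _ (fun s => 1 + mxip (iota s) (iota s))) => //.
  by apply: integrable01D; [exact: integrable01_cst | exact: L2_integrable].
move=> s Is; have := sqr_entry_le_mxip a b (si s Is).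
rewrite -(real_normK (num_real _)); have := normr_ge0 (iota s a b); nra.
Qed.

Lemma L2_mxip_integrable iota kappa : L2 iota -> L2 kappa ->
  integrable01 (fun s => mxip (iota s) (kappa s)).
Proof.
move=> hi hk; have [si mi _] := hi; have [sk mk _] := hk.
apply: (@integrable01_dom _ _ (fun s => mxip (iota s) (iota s) + mxip (kappa s) (kappa s))).
- exact: measurable_mxip.
- by apply: integrable01D; exact: L2_integrable.
- move=> s Is; have [s1 s2] := (si s Is, sk s Is).
  apply: le_trans (cauchy_schwarz_abs euclid_mx s1 s2) _.
  rewrite -!(sqr_ipnorm euclid_mx) //.
  by have := ipnorm_ge0 mxip (iota s); have := ipnorm_ge0 mxip (kappa s); nra.
Qed.

Lemma L2ipC iota kappa : L2ip iota kappa = L2ip kappa iota.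
Proof. by apply: eq_Rintegral => s _; rewrite mxipC. Qed.

Lemma L2_lincomb iota kappa (t : R) : L2 iota -> L2 kappa ->
  L2 (fun s => iota s + t *: kappa s).
Proof.
move=> hi hk; have [si mi _] := hi; have [sk mk _] := hk.
apply: integrable_L2.
- by move=> s Is; apply: symmD; [exact: si | apply: symmZ; exact: sk].
- move=> a b; under [X in measurable_fun _ X]eq_fun do rewrite !mxE.
  by apply: measurable_funD => //; exact: measurable_funM.
- apply: (@integrable01_eq _ (fun s => mxip (iota s) (iota s)
    + (2 * t) * mxip (iota s) (kappa s) + t ^+ 2 * mxip (kappa s) (kappa s))).
    move=> s _; rewrite mxipDl mxipZl !(mxipC _ (_ + _)) !mxipDl !mxipZl.
    by rewrite (mxipC (kappa s) (iota s)); ring.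
  apply: integrable01D; [apply: integrable01D|]; first exact: L2_integrable.
    by apply: integrable01Zl; exact: L2_mxip_integrable.
  by apply: integrable01Zl; exact: L2_integrable.
Qed.

Lemma L2B iota kappa : L2 iota -> L2 kappa -> L2 (iota - kappa).
Proof.
move=> hi hk; have := L2_lincomb (-1) hi hk.
by under eq_fun do rewrite scaleN1r.
Qed.

Lemma L2ipB iota kappa : L2 iota -> L2 kappa ->
  L2ip (iota - kappa) (iota - kappa) =
  L2ip iota iota - 2 * L2ip iota kappa + L2ip kappa kappa.
Proof.
move=> hi hk.
have [h1 h2 h3] := And3 (L2_integrable hi) (L2_integrable hk) (L2_mxip_integrable hi hk).
have h23 := integrable01Zl 2 h3.
rewrite /L2ip -(RintegralZl 2 measurable01 h3) -(RintegralB measurable01 h1 h23).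
rewrite -(RintegralD measurable01 (integrable01B h1 h23) h2).
apply: eq_Rintegral => s _; rewrite -[(iota - kappa) s]/(iota s - kappa s).
rewrite (ipDl euclid_mx) (ipNl euclid_mx) !(ipDr euclid_mx) !(ipNr euclid_mx).
by rewrite (mxipC (kappa s) (iota s)); ring.
Qed.

Lemma L2ip_ge0 iota : L2 iota -> 0 <= L2ip iota iota.
Proof.
by move=> [si _ _]; apply: Rintegral_ge0 => s Is; apply: (ip_ge0 euclid_mx); exact: si.
Qed.

Lemma sqr_L2norm iota : L2 iota -> L2norm iota ^+ 2 = L2ip iota iota.
Proof. by move=> /L2ip_ge0 hi; rewrite sqr_sqrtr. Qed.

Lemma ljE j (x : Hvec D j) s (k : 'I_(size j)) : cell j k s -> lj x s = x k.
Proof.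
move=> ck; rewrite /lj (bigD1 k) //= (cell_indic _ ck) eqxx scale1r big1 ?addr0 //.
by move=> l /negPf lk; rewrite (cell_indic _ ck) lk scale0r.
Qed.

Lemma lj_out j (x : Hvec D j) s : ~ I01 s -> lj x s = 0.
Proof.
move=> h; rewrite /lj big1 // => k _; rewrite indicE memNset ?scale0r //.
by move=> /sub_cell01 ck; apply: h; apply: ck.
Qed.

Lemma ljB j (x y : Hvec D j) : lj (x - y) = lj x - lj y.
Proof.
apply/funext => s; rewrite -[RHS]/(lj x s - lj y s) /lj -sumrB.
by apply: eq_bigr => k _; rewrite HvecB scalerBr.
Qed.

Lemma ljZ j t (x : Hvec D j) : lj (t *: x) = t *: lj x.
Proof.
apply/funext => s; rewrite -[RHS]/(t *: lj x s) /lj scaler_sumr.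
by apply: eq_bigr => k _; rewrite HvecZ !scalerA mulrC.
Qed.

Lemma lj_L2 j (x : Hvec D j) : Hj x -> L2 (lj x).
Proof.
move=> hx; have sx s : symm (lj x s).
  by apply: big_ind => [|u v|k _]; [exact: symm0|exact: symmD|exact/symmZ/hx].
have ex a b s : lj x s a b = \sum_(k < size j) \1_(cell j k) s * x k a b.
  by rewrite summxE; apply: eq_bigr => k _; rewrite mxE.
have mx a b : measurable_fun I01 (fun s => lj x s a b).
  under [X in measurable_fun _ X]eq_fun do rewrite ex; apply: measurable_sum => k.
  apply: measurable_funM => //; apply: measurable_indic; exact: (measurable_cell _ _).
apply: integrable_L2 => //.
apply: (@integrable01_dom _ _ (fun=> \sum_(k < size j) mxip (x k) (x k))).
- exact: measurable_mxip.
- exact: integrable01_cst.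
- move=> s /(cell_cover j) [k ck]; rewrite (ljE _ ck).
  rewrite ger0_norm; last exact: (ip_ge0 euclid_mx).
  rewrite (bigD1 k) //= lerDl sumr_ge0 // => l _; exact: (ip_ge0 euclid_mx).
Qed.

Lemma pjE j iota (k : 'I_(size j)) a b : pj j iota k a b =
  (width j k)^-1 * \int[lambda]_(s in cell j k) iota s a b.
Proof. by rewrite ffunE mxE. Qed.

(** Averaging and embedding are adjoint. With [pj_lj] this yields Pythagoras, the contraction
    property and the tower property below. *)
Lemma pj_adjoint j iota (x : Hvec D j) : L2 iota ->
  Hjip (pj j iota) x = L2ip iota (lj x).
Proof.
move=> hi; transitivity (\int[lambda]_(s in I01)
    \sum_(k < size j) \1_(cell j k) s * mxip (iota s) (x k)); last first.
  apply: Rintegral01_eq => s /(cell_cover j) [k ck]; rewrite (ljE _ ck).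
  by rewrite (sum_cell_indic (fun l => mxip (iota s) (x l)) ck).
have ik (k : 'I_(size j)) a b : integrable01 (fun s => iota s a b * x k b a).
  by under eq_fun do rewrite mulrC; apply: integrable01Zl; exact: L2_entry.
rewrite Rintegral01_sum; last first.
  move=> k; apply: integrable01_cell; under eq_fun do rewrite mxipE_gen.
  by do 2 apply: integrable01_sum => ?.
apply: eq_bigr => k _; rewrite Rintegral01_cell -Rintegral01_cell.
transitivity (\sum_a \sum_b \int[lambda]_(s in cell j k) (iota s a b * x k b a)).
  rewrite mxipE_gen mulr_sumr; apply: eq_bigr => a _.
  rewrite mulr_sumr; apply: eq_bigr => b _; rewrite pjE RintegralZr.
  - by rewrite mulrA mulrA divff ?mul1r // gt_eqF // width_gt0.
  - exact: (measurable_cell _ _).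
  - by apply: integrable_cell; exact: L2_entry.
under eq_bigr => a _ do under eq_bigr => b _ do rewrite -Rintegral01_cell.
under eq_bigr => a _ do (rewrite -Rintegral01_sum; last by move=> b; exact: integrable01_cell).
rewrite -Rintegral01_sum; last first.
  by move=> a; apply: integrable01_sum => b; exact: integrable01_cell.
apply: Rintegral01_eq => s _; rewrite mxipE_gen mulr_sumr; apply: eq_bigr => a _.
by rewrite mulr_sumr.
Qed.

Lemma pj_const j iota (k : 'I_(size j)) (c : 'M[R]_D) :
  (forall s, cell j k s -> iota s = c) -> pj j iota k = c.
Proof.
move=> ic; apply/matrixP => a b; rewrite pjE.
rewrite (_ : \int[_]_(s in _) _ = \int[lambda]_(s in cell j k) c a b); last first.
  by apply: eq_Rintegral => s; rewrite inE => /ic ->.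
by rewrite Rintegral_cell_cst mulKf // gt_eqF // width_gt0.
Qed.

Lemma pj_lj j (x : Hvec D j) : pj j (lj x) = x.
Proof. by apply/ffunP => k; apply: pj_const => s /ljE. Qed.

Lemma L2ip_lj j (x y : Hvec D j) : Hj x -> L2ip (lj x) (lj y) = Hjip x y.
Proof. by move=> hx; rewrite -pj_adjoint ?pj_lj //; exact: lj_L2. Qed.

Lemma L2norm_lj j (x : Hvec D j) : Hj x -> L2norm (lj x) = ipnorm (@Hjip R D j) x.
Proof. by move=> hx; rewrite /L2norm /ipnorm L2ip_lj. Qed.

Lemma pj_Hj j iota : L2 iota -> Hj (pj j iota).
Proof.
move=> [si _ _] k; apply/matrixP => a b; rewrite mxE !pjE; congr (_ * _).
apply: eq_Rintegral => s; rewrite inE => /(sub_cell01 (ltn_ord k)) /si sis.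
by rewrite -[in LHS]sis mxE.
Qed.

Lemma pjB j iota kappa : L2 iota -> L2 kappa ->
  pj j (iota - kappa) = pj j iota - pj j kappa.
Proof.
move=> hi hk; apply/ffunP => k; rewrite HvecB; apply/matrixP => a b.
rewrite !mxE !pjE -mulrBr -RintegralB.
- by congr (_ * _); apply: eq_Rintegral => s _; rewrite !mxE.
- exact: (measurable_cell _ _).
- by apply: integrable_cell; exact: L2_entry.
- by apply: integrable_cell; exact: L2_entry.
Qed.

(** Pythagoras: [lj (pj j iota)] is the orthogonal projection of [iota] on step functions. *)
Lemma L2ip_sub_projection j iota : L2 iota ->
  L2ip (iota - lj (pj j iota)) (iota - lj (pj j iota)) =
  L2ip iota iota - Hjip (pj j iota) (pj j iota).
Proof.
move=> hi; have hp : Hj (pj j iota) by exact: pj_Hj.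
by rewrite L2ipB //; [rewrite -pj_adjoint // L2ip_lj //; ring | exact: lj_L2].
Qed.

Lemma ipnorm_pj_le j iota : L2 iota -> ipnorm (@Hjip R D j) (pj j iota) <= L2norm iota.
Proof.
move=> hi; rewrite ler_wsqrtr // -subr_ge0 -L2ip_sub_projection //.
by apply: L2ip_ge0; apply: L2B => //; apply: lj_L2; exact: pj_Hj.
Qed.

End square_integrable_paths.

(** * Refinement of partitions *)

Section refinement.
Context {R : realType}.
Implicit Types i j : subdivision R.

Lemma refined_lpt i j m : refined_by i j -> (m <= size i)%N ->
  exists2 n, (n <= size j)%N & lpt i m = lpt j n.
Proof.
move=> ij; case: m => [|m] mi; first by exists 0%N.
have /ij /(nthP 0) [n nj h] : rpt i m \in points i by exact: mem_nth.
by exists n.+1.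
Qed.

Lemma refined_cell i j m k s s' : refined_by i j -> (m < size i)%N ->
  (k < size j)%N -> cell j k s -> cell j k s' -> cell i m s -> cell i m s'.
Proof.
move=> ij mi kj; rewrite !cellE => /andP[h1 h2] /andP[h3 h4] /andP[h5 h6].
have [n nj e] := refined_lpt ij (ltnW mi); rewrite e in h5 *.
have [n' nj' e'] := refined_lpt ij mi; rewrite lptS in e'; rewrite e' in h6 *.
apply/andP; split.
  apply: le_trans h3; have [nk|kn] := leqP n k; first by apply: le_lpt => //; exact: ltnW.
  by have := le_lpt kn nj; rewrite lptS; have := lt_le_trans (le_lt_trans h5 h2); move=> h /h; rewrite ltxx.
apply: (lt_le_trans h4); rewrite -lptS; have [kn|nk] := ltnP k n'; first exact: le_lpt.
by have := le_lt_trans (le_trans (le_lpt nk (ltnW kj)) h1) h6; rewrite ltxx.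
Qed.

Lemma refined_size i j : refined_by i j -> (size i <= size j)%N.
Proof.
move=> ij; apply: uniq_leq_size ij.
have : path <%R 0 (points i) by exact: points_sorted.
by move/path_sorted; exact: (sorted_uniq lt_trans ltxx).
Qed.

Lemma refined_refl i : refined_by i i. Proof. by []. Qed.

End refinement.

(** * Projections between partitions and monotone paths *)

Section discretised_paths.
Context {R : realType} {D : nat}.
Local Notation I01 := (`[0, 1[%classic : set R).
Local Notation lambda := (@lebesgue_measure R).
Implicit Types (mu iota : R -> 'M[R]_D) (i j : subdivision R).

(** A step function on the coarser partition is constant on finer cells. The equality is pointwise,
    both sides being 0 outside [0,1), so it can be used under [H], which is a function of
    representatives. *)
Lemma lj_pj_lj i j (w : Hvec D i) : refined_by i j -> lj (pj j (lj w)) = lj w.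
Proof.
move=> ij; apply/funext => s; have [Is|nIs] := pselect (I01 s); last by rewrite !lj_out.
have [k ck] := cell_cover j Is; have [m cm] := cell_cover i Is.
rewrite (ljE _ ck) (ljE _ cm); apply: pj_const => s' ck'; apply: ljE.
exact: refined_cell ij (ltn_ord m) (ltn_ord k) ck ck' cm.
Qed.

(** Tower property by duality: paired with any [x] in H^i both sides give the product of [iota] with
    [lj x], which projection on the finer partition leaves fixed. *)
Lemma pj_lj_pj i j iota : refined_by i j -> L2 iota ->
  pj i (lj (pj j iota)) = pj i iota.
Proof.
move=> ij hi; have hj : Hj (pj j iota) by exact: pj_Hj.
have hlj := lj_L2 hj; have h1 : Hj (pj i (lj (pj j iota))) by exact: pj_Hj.
have h2 : Hj (pj i iota) by exact: pj_Hj.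
have EH := @euclid_Hj R D i.
apply/subr0_eq/(ip_eq0 EH); first exact: (euclidB EH).
set x := _ - _; have hx : Hj x by exact: (euclidB EH).
rewrite {1}/x (ipDl EH) (ipNl EH) !pj_adjoint // L2ipC -pj_adjoint; last exact: lj_L2.
rewrite (ipC (@euclid_Hj R D j)) pj_adjoint // lj_pj_lj //.
by rewrite subrr.
Qed.

Lemma contraction_pj_lj i j : contraction (@Hj R D j) (@Hjip R D j)
  (@Hj R D i) (@Hjip R D i) (fun x => pj i (lj x)) (fun w => pj j (lj w)).
Proof.
split.
- by move=> x hx; apply: pj_Hj; exact: lj_L2.
- by move=> w hw; apply: pj_Hj; exact: lj_L2.
(* [contrB] is required for all arrays, symmetric or not, so linearity is read off the integrals and
   not taken from [pjB]. *)
- move=> x y; rewrite ljB; apply/ffunP => k; rewrite HvecB; apply/matrixP => a b.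
  have ex (z : Hvec D j) s : lj z s a b = \sum_(l < size j) \1_(cell j l) s * z l a b.
    by rewrite summxE; apply: eq_bigr => l _; rewrite mxE.
  have ix (z : Hvec D j) : integrable01 (fun s => lj z s a b).
    under eq_fun do rewrite ex; apply: integrable01_sum => l.
    by apply: integrable01_cell; exact: integrable01_cst.
  have := RintegralB (measurable_cell i k) (integrable_cell k (ix x)) (integrable_cell k (ix y)).
  rewrite !mxE !pjE -mulrBr => <-; congr (_ * _).
  by apply: eq_Rintegral => s _; rewrite !mxE.
- move=> t w; rewrite ljZ; apply/ffunP => k; rewrite HvecZ; apply/matrixP => a b.
  have ex s : lj w s a b = \sum_(l < size i) \1_(cell i l) s * w l a b.
    by rewrite summxE; apply: eq_bigr => l _; rewrite mxE.
  have ix : integrable01 (fun s => lj w s a b).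
    under eq_fun do rewrite ex; apply: integrable01_sum => l.
    by apply: integrable01_cell; exact: integrable01_cst.
  have := RintegralZl t (measurable_cell j k) (integrable_cell k ix).
  rewrite !mxE !pjE mulrCA => <-; congr (_ * _).
  by apply: eq_Rintegral => s _; rewrite !mxE.
- move=> x w hx hw; rewrite (ipC (@euclid_Hj R D i) w).
  by rewrite (pj_adjoint _ (lj_L2 hx)) (pj_adjoint _ (lj_L2 hw)) L2ipC.
- by move=> x hx; rewrite -(L2norm_lj hx); apply: ipnorm_pj_le; exact: lj_L2.
Qed.

(** Covering by intervals closed on the right, which locate the left limit of a step function at
    [t]. *)
Lemma cell_cover_left j t : 0 < t <= 1 ->
  exists2 k : 'I_(size j), lpt j k < t & t <= rpt j k.
Proof.
move=> /andP[t0 t1].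
suff h n : (n <= size j)%N -> t <= lpt j n -> exists k, [/\ (k < n)%N, lpt j k < t & t <= rpt j k].
  have [|k [kn h1 h2]] := h (size j) (leqnn _); first by rewrite lpt_size.
  by exists (Ordinal kn).
elim: n => [|n IH] nj; first by rewrite lpt0 leNgt t0.
have [h _|h h'] := leP t (lpt j n).
  by have [k [kn ? ?]] := IH (ltnW nj) h; exists k; split => //; exact: ltnW.
by exists n.
Qed.

Lemma lj_mono_paths j (x : Hvec D j) : Cj x -> mono_paths (lj x).
Proof.
move=> Cx; have hx := Cj_sub Cx; have [px mx] := Cx.
split; first exact: lj_L2.
- by move=> s /(cell_cover j) [k ck]; rewrite (ljE _ ck).
- split=> t.
    move=> t01; have [k ck] : exists k : 'I_(size j), cell j k t.
      by apply: cell_cover; rewrite /= in_itv.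
    have := ck; rewrite cellE => /andP[h1 h2].
    apply: cvg_near_cst; rewrite (ljE _ ck).
    near=> s; apply: ljE; rewrite cellE; apply/andP; split.
      by apply: (le_trans h1); near: s; exact: nbhs_right_ge.
    by near: s; exact: nbhs_right_lt.
  move=> /andP[t0 t1]; have [|k h1 h2] := @cell_cover_left j t.
    by rewrite t0 ltW.
  exists (x k); apply: cvg_near_cst.
  near=> s; apply: ljE; rewrite cellE; apply/andP; split.
    by apply: ltW; near: s; exact: nbhs_left_gt.
  by apply: lt_le_trans h2; near: s; exact: nbhs_left_lt.
- move=> s t /(cell_cover j) [k ck] /(cell_cover j) [l cl] st.
  rewrite (ljE _ ck) (ljE _ cl); apply: mx.
  rewrite leqNgt; apply/negP => lk.
  have := le_lpt lk (ltnW (ltn_ord k)); rewrite lptS => h.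
  move: ck cl; rewrite !cellE => /andP[h1 _] /andP[_ h2].
  by have := lt_le_trans h2 (le_trans h (le_trans h1 st)); rewrite ltxx.
Unshelve. all: by end_near.
Qed.

Lemma qform_pj j mu (k : 'I_(size j)) (v : 'cV[R]_D) : L2 mu ->
  qform v (pj j mu k) = (width j k)^-1 * \int[lambda]_(s in cell j k) qform v (mu s).
Proof.
move=> hm; have ie a b : integrable01 (fun s => v a 0 * v b 0 * mu s a b).
  by apply: integrable01Zl; exact: L2_entry.
rewrite -Rintegral01_cell.
transitivity ((width j k)^-1 * \int[lambda]_(s in I01)
   \sum_a \sum_b (\1_(cell j k) s * (v a 0 * v b 0 * mu s a b))); last first.
  congr (_ * _); apply: eq_Rintegral => s _; rewrite qformE mulr_sumr.
  by apply: eq_bigr => a _; rewrite mulr_sumr.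
rewrite Rintegral01_sum; last by move=> a; apply: integrable01_sum => b; exact: integrable01_cell.
rewrite qformE mulr_sumr; apply: eq_bigr => a _.
rewrite Rintegral01_sum; last by move=> b; exact: integrable01_cell.
rewrite mulr_sumr; apply: eq_bigr => b _; rewrite Rintegral01_cell pjE mulrCA.
congr (_ * _).
by rewrite (RintegralZl (v a 0 * v b 0) (measurable_cell j k) (integrable_cell k (L2_entry a b hm))).
Qed.

Lemma integrable01_qform mu v : L2 mu -> integrable01 (fun s => qform v (mu s)).
Proof.
move=> hm; under eq_fun do rewrite qformE.
apply: integrable01_sum => a; apply: integrable01_sum => b.
by apply: integrable01Zl; exact: L2_entry.
Qed.

Lemma pj_Cj j mu : mono_paths mu -> Cj (pj j mu).
Proof.
move=> [hm pm _ mm]; have hp : Hj (pj j mu) by exact: pj_Hj.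
have wi (k : 'I_(size j)) : 0 <= (width j k)^-1 by rewrite invr_ge0 ltW // width_gt0.
split=> [k|k l kl]; split => //.
- move=> v; rewrite -[leRHS]/(qform v _) qform_pj // mulr_ge0 // Rintegral_ge0 //.
  by move=> s /(sub_cell01 (ltn_ord k)) /pm [_]; exact.
- by apply: (euclidB euclid_mx); exact: hp.
move=> v; rewrite -[leRHS]/(qform v _) qformB subr_ge0.
have iq := integrable01_qform v hm.
move: kl; rewrite leq_eqVlt => /orP[/eqP/val_inj->//|kl].
have mq s t : I01 s -> I01 t -> s <= t -> qform v (mu s) <= qform v (mu t).
  by move=> Is It st; rewrite -subr_ge0 -qformB; case: (mm s t Is It st) => _; exact.
have cl : cell j l (lpt j l) by rewrite cellE lexx lt_lpt_rpt.
have Il := sub_cell01 (ltn_ord l) cl.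
(* The value at the left end of the later cell separates the two averages. *)
apply: (@le_trans _ _ (qform v (mu (lpt j l)))).
  rewrite qform_pj // mulrC ler_pdivrMr ?width_gt0 // [leRHS]mulrC -Rintegral_cell_cst.
  apply: Rintegral_cell_le => //; first exact: integrable01_cst.
  move=> s ck; apply: mq => //; first exact: (sub_cell01 (ltn_ord k)).
  move: ck; rewrite cellE => /andP[_ h]; apply: le_trans (ltW h) _.
  by rewrite -lptS; apply: le_lpt => //; exact: ltnW.
rewrite qform_pj // [leRHS]mulrC ler_pdivlMr ?width_gt0 // mulrC -Rintegral_cell_cst.
apply: Rintegral_cell_le => //; first exact: integrable01_cst.
move=> s cs; apply: mq => //; first exact: (sub_cell01 (ltn_ord l)).
by move: cs; rewrite cellE => /andP[].
Qed.

End discretised_paths.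

(** * Estimates in L^p *)

Section Lp_estimates.
Context {R : realType} {D : nat}.
Local Notation I01 := (`[0, 1[%classic : set R).
Local Notation lambda := (@lebesgue_measure R).
Implicit Types (mu iota : R -> 'M[R]_D) (j : subdivision R).

(** The two terms cross over at a0 = tau^(-1/(2-p)): below it a^p <= a0^(p-1) a, above it a^p = a^2
    a^(p-2) <= tau a^2. *)
Lemma powR_split (p tau : R) : 1 <= p -> p < 2 -> 0 < tau ->
  exists2 c, 0 <= c & forall a, 0 <= a -> a `^ p <= tau * a ^+ 2 + c * a.
Proof.
move=> p1 p2 tau0; pose a0 := (tau^-1) `^ (2 - p)^-1.
have a00 : 0 < a0 by rewrite powR_gt0 // invr_gt0.
have a0p : a0 `^ (2 - p) = tau^-1.
  by rewrite /a0 -powRrM mulVf ?powRr1 ?invr_ge0 ?(ltW tau0) //; apply/eqP; lra.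
exists (a0 `^ (p - 1)); first exact: powR_ge0.
move=> a; rewrite le_eqVlt => /predU1P[<-|a_gt0].
  by rewrite powR0 ?expr0n ?mulr0 ?addr0 //; apply/eqP; lra.
have [aa0|a0a] := leP a a0.
  apply: (@le_trans _ _ (a0 `^ (p - 1) * a)); last first.
    by rewrite lerDr mulr_ge0 ?sqr_ge0 // ltW.
  rewrite -mulr_powRB1 ?(ltW a_gt0) //; last by lra.
  rewrite mulrC ler_wpM2r ?(ltW a_gt0) // ge0_ler_powR ?nnegrE ?(ltW a_gt0) ?(ltW a00) //.
  by lra.
apply: (@le_trans _ _ (tau * a ^+ 2)); last first.
  by rewrite lerDl mulr_ge0 ?powR_ge0 // ltW.
have -> : a ^+ 2 = a `^ p * a `^ (2 - p).
  rewrite -powR_mulrn ?(ltW a_gt0) // -powRD; last by rewrite (gt_eqF a_gt0) implybT.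
  by rewrite addrC subrK.
rewrite mulrCA ler_peMr ?powR_ge0 // -ler_pdivrMl // mulr1 -a0p.
by apply: ge0_ler_powR; rewrite ?nnegrE ?(ltW a_gt0) ?(ltW a00) ?(ltW a0a) //; lra.
Qed.

Lemma measurable_mxnorm2 iota : L2 iota -> measurable_fun I01 (fun s => mxnorm2 (iota s)).
Proof.
move=> [si mi _]; apply: (eq_measurable_fun (fun s => mxip (iota s) (iota s) `^ 2^-1)).
  move=> s; rewrite inE => Is; rewrite powR12_sqrt //.
  by apply: (ip_ge0 euclid_mx); exact: si.
exact: (measurableT_comp (measurable_powR _) (measurable_mxip mi mi)).
Qed.

Lemma integrable01_mxnorm2 iota : L2 iota -> integrable01 (fun s => mxnorm2 (iota s)).
Proof.
move=> hi; have [si _ _] := hi.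
apply: (@integrable01_dom _ _ (fun s => 1 + mxip (iota s) (iota s))).
- exact: measurable_mxnorm2.
- by apply: integrable01D; [exact: integrable01_cst | exact: L2_integrable].
- move=> s Is; have n0 := ipnorm_ge0 mxip (iota s).
  by rewrite ger0_norm // -(sqr_ipnorm euclid_mx (si s Is)) -/(mxnorm2 _); rewrite /mxnorm2 in n0 *; nra.
Qed.

(** The splitting is applied to |iota|/N, so that the resulting bound is linear in [N]. *)
Lemma Lpnorm_le (p tau c N B : R) iota : 1 <= p -> 0 <= c -> 0 < N -> L2 iota ->
  (forall a, 0 <= a -> a `^ p <= tau * a ^+ 2 + c * a) ->
  tau * L2ip iota iota + c * N * (\int[lambda]_(s in I01) mxnorm2 (iota s))
    <= N ^+ 2 * B ->
  Lpnorm p iota <= N * B `^ p^-1.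
Proof.
move=> p1 c0 N0 hi split_p hB; have p0 : 0 < p by lra.
have [si _ _] := hi.
have i1 := integrable01_mxnorm2 hi; have i2 := L2_integrable hi.
pose F (s : R) := N `^ p * (tau / N ^+ 2 * mxip (iota s) (iota s) + c / N * mxnorm2 (iota s)).
have iF0 : integrable01 (fun s => tau / N ^+ 2 * mxip (iota s) (iota s) + c / N * mxnorm2 (iota s)).
  by apply: integrable01D; exact: integrable01Zl.
have iF : integrable01 F by exact: integrable01Zl.
have le_F s : I01 s -> mxnorm2 (iota s) `^ p <= F s.
  move=> Is; have n0 : 0 <= mxnorm2 (iota s) by exact: ipnorm_ge0.
  have {1}-> : mxnorm2 (iota s) = N * (mxnorm2 (iota s) / N).
    by rewrite mulrC divfK // gt_eqF.
  have nN : 0 <= mxnorm2 (iota s) / N by rewrite divr_ge0 // ltW.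
  rewrite powRM ?(ltW N0) // ler_wpM2l ?powR_ge0 //.
  apply: (le_trans (split_p _ nN)); rewrite -sqr_mxnorm2; last exact: si.
  rewrite le_eqVlt; apply/orP; left; apply/eqP; field; rewrite gt_eqF //.
have ip : integrable01 (fun s => mxnorm2 (iota s) `^ p).
  apply: integrable01_dom iF _; last by move=> s Is; rewrite ger0_norm ?powR_ge0 ?le_F.
  exact: (measurableT_comp (measurable_powR p) (measurable_mxnorm2 hi)).
have int_le : \int[lambda]_(s in I01) mxnorm2 (iota s) `^ p <= N `^ p * B.
  apply: le_trans (Rintegral01_le ip iF le_F) _; rewrite /F.
  rewrite (RintegralZl (N `^ p) measurable01 iF0) ler_wpM2l ?powR_ge0 //.
  rewrite (RintegralD measurable01 (integrable01Zl _ i2) (integrable01Zl _ i1)).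
  rewrite (RintegralZl _ measurable01 i2) (RintegralZl _ measurable01 i1) -/(L2ip iota iota).
  rewrite -(ler_pM2l (exprn_gt0 2 N0)); apply: le_trans hB.
  rewrite le_eqVlt; apply/orP; left; apply/eqP; set x := L2ip _ _; set y := Rintegral _ _ _.
  by field; rewrite gt_eqF.
have i0 : 0 <= \int[lambda]_(s in I01) mxnorm2 (iota s) `^ p.
  by apply: Rintegral_ge0 => s _; exact: powR_ge0.
rewrite /Lpnorm; apply: (@le_trans _ _ ((N `^ p * B) `^ p^-1)); last first.
  have B0 : 0 <= B.
    by have := le_trans i0 int_le; rewrite pmulr_rge0 // powR_gt0.
  by rewrite powRM ?powR_ge0 // -powRrM divff ?gt_eqF // powRr1 ?(ltW N0).
apply: ge0_ler_powR; rewrite ?nnegrE ?invr_ge0 ?(ltW p0) //; exact: le_trans int_le.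
Qed.

End Lp_estimates.

(** * Projection error of monotone paths *)

Section projection_estimates.
Context {R : realType} {D : nat}.
Local Notation I01 := (`[0, 1[%classic : set R).
Local Notation lambda := (@lebesgue_measure R).
Implicit Types (mu iota : R -> 'M[R]_D) (j : subdivision R).

Lemma psd_diag_ge0 (a : 'M[R]_D) i : psd a -> 0 <= a i i.
Proof.
move=> [sa pa]; have [+ _] := qform_delta i i sa.
by have := pa (delta_mx i 0 + delta_mx i 0); rewrite /qform; lra.
Qed.

Lemma psd_trace_ge0 (a : 'M[R]_D) : psd a -> 0 <= \tr a.
Proof. by move=> pa; apply: sumr_ge0 => i _; exact: psd_diag_ge0. Qed.

Lemma entry_le_mxnorm2 (a : 'M[R]_D) i k : symm a -> `|a i k| <= mxnorm2 a.
Proof.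
by move=> sa; apply: le_sqr_abs; [exact: ipnorm_ge0|rewrite sqr_mxnorm2 // sqr_entry_le_mxip].
Qed.

Lemma sqr_trace_le (a : 'M[R]_D) : symm a -> (\tr a) ^+ 2 <= D%:R ^+ 2 * mxip a a.
Proof.
move=> sa; rewrite -sqr_mxnorm2 // -exprMn -(real_normK (num_real (\tr a))).
rewrite ler_sqr ?nnegrE ?mulr_ge0 ?ler0n ?ipnorm_ge0 //.
apply: le_trans (ler_norm_sum _ _ _) _.
apply: (@le_trans _ _ (\sum_(i < D) mxnorm2 a)).
  by apply: ler_sum => i _; exact: entry_le_mxnorm2.
by rewrite sumr_const card_ord mulr_natl.
Qed.

Lemma mxnorm2_le_sum (a : 'M[R]_D) : symm a ->
  mxnorm2 a <= \sum_i \sum_k `|a i k|.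
Proof.
move=> sa; set S := \sum_i _.
have S0 : 0 <= S by do 2 apply: sumr_ge0 => ? _.
rewrite -ler_sqr ?nnegrE ?ipnorm_ge0 // sqr_mxnorm2 // mxipE // expr2.
rewrite {2}/S mulr_sumr; apply: ler_sum => i _; rewrite mulr_sumr; apply: ler_sum => k _.
rewrite -expr2 -(real_normK (num_real _)) expr2 ler_wpM2r //.
rewrite /S (bigD1 i) //= (bigD1 k) //= -addrA lerDl addr_ge0 ?sumr_ge0 //.
by move=> l _; rewrite sumr_ge0.
Qed.

Lemma uniform_lpt j k : uniform_subdivision j -> (k <= size j)%N ->
  lpt j k = k%:R / (size j)%:R.
Proof. by move=> ju; case: k => [|k] kj; [rewrite lpt0 mul0r|rewrite lptS ju]. Qed.

Lemma uniform_width j k : uniform_subdivision j -> (k < size j)%N ->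
  width j k = (size j)%:R^-1.
Proof.
move=> ju kj; rewrite /width -lptS !uniform_lpt // ?(ltnW kj) //.
by rewrite -mulrBl -natrB // subSnn mul1r.
Qed.

Section monotone.
Variables (mu : R -> 'M[R]_D) (j : subdivision R).
Hypothesis mu_mono : mono_paths mu.
Hypothesis j_unif : uniform_subdivision j.

Let mu_L2 : L2 mu. Proof. by case: mu_mono. Qed.

Lemma entry_variation_le_trace s t a b : I01 s -> I01 t -> s <= t ->
  `|mu t a b - mu s a b| <= \tr (mu t) - \tr (mu s).
Proof.
case: mu_mono => _ _ _ h Is It st.
by have := psd_entry_le_trace a b (h s t Is It st); rewrite linearB /= !mxE.
Qed.

Lemma trace_mono s t : I01 s -> I01 t -> s <= t -> \tr (mu s) <= \tr (mu t).
Proof.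
case: mu_mono => _ _ _ h Is It st.
by rewrite -subr_ge0 -linearB psd_trace_ge0 //; exact: h.
Qed.

Lemma integrable01_trace : integrable01 (fun s => \tr (mu s)).
Proof. by apply: integrable01_sum => a; exact: L2_entry. Qed.

Lemma cell_lpt k : (k < size j)%N -> cell j k (lpt j k).
Proof. by move=> kj; rewrite cellE lexx lt_lpt_rpt. Qed.

Lemma lpt01 k : (k < size j)%N -> I01 (lpt j k).
Proof. by move=> kj; exact: sub_cell01 kj _ (cell_lpt kj). Qed.

(** Within a cell the path oscillates by at most the increase of its trace over that cell. The last
    cell is excluded: its right end 1 is outside [0,1), and the path may be unbounded there. *)
Lemma entry_deviation (k : 'I_(size j)) s a b : (k.+1 < size j)%N -> cell j k s ->
  `|mu s a b - pj j mu k a b| <= \tr (mu (lpt j k.+1)) - \tr (mu (lpt j k)).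
Proof.
move=> kj ck; have w0 := width_gt0 (ltn_ord k).
set d := \tr (mu (lpt j k.+1)) - _; have h t : cell j k t -> `|mu s a b - mu t a b| <= d.
  have bound x y : cell j k x -> cell j k y -> x <= y -> `|mu y a b - mu x a b| <= d.
    move=> cx cy xy; have [Ix Iy] := (sub_cell01 (ltn_ord k) cx, sub_cell01 (ltn_ord k) cy).
    apply: le_trans (entry_variation_le_trace a b Ix Iy xy) _.
    move: cx cy; rewrite !cellE => /andP[h1 _] /andP[_ h2].
    apply: lerB.
      by apply: (trace_mono Iy); [exact: lpt01 | exact: ltW].
    by apply: (trace_mono _ Ix) => //; exact: lpt01.
  by move=> ct; have [st|ts] := leP s t; [rewrite distrC bound|rewrite bound // ltW].
have ie := L2_entry a b mu_L2.
have lo : mu s a b - d <= pj j mu k a b.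
  rewrite pjE ler_pdivlMl // -Rintegral_cell_cst; apply: Rintegral_cell_le => //.
    exact: integrable01_cst.
  by move=> t /h; rewrite ler_norml => /andP[? ?]; lra.
have hi : pj j mu k a b <= mu s a b + d.
  rewrite pjE ler_pdivrMl // -Rintegral_cell_cst; apply: Rintegral_cell_le => //.
    exact: integrable01_cst.
  by move=> t /h; rewrite ler_norml => /andP[? ?]; lra.
by rewrite ler_norml; apply/andP; split; lra.
Qed.

(** With equal widths, the trace increments of all cells before the last telescope to at most one
    width times the trace at the start of the last cell, hence to one copy of the last integral. On
    the last cell the path and its mean contribute one copy each, which makes 3. *)
Lemma L1_entry_projection a b :
  \int[lambda]_(s in I01) `|mu s a b - lj (pj j mu) s a b| <=
  3 * \int[lambda]_(s in cell j (size j).-1) \tr (mu s).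
Proof.
have [n sE] : exists n, size j = n.+1.
  by exists (size j).-1; rewrite prednK // size_subdivision_gt0.
have ltn : (n < size j)%N by rewrite sE.
have -> : (size j).-1 = n by rewrite sE.
have ie := L2_entry a b mu_L2; have it := integrable01_trace.
have hp : Hj (pj j mu) by exact: pj_Hj.
have ilp := L2_entry a b (lj_L2 hp).
have ih : integrable01 (fun s => `|mu s a b - lj (pj j mu) s a b|).
  by apply: integrable01_norm; exact: integrable01B.
set T := \int[lambda]_(s in cell j n) \tr (mu s).
have Tge : width j n * \tr (mu (lpt j n)) <= T.
  rewrite -(Rintegral_cell_cst (Ordinal ltn)).
  apply: (Rintegral_cell_le (k := Ordinal ltn)) => //; first exact: integrable01_cst.
  move=> s cs; apply: trace_mono; [exact: lpt01 | exact: sub_cell01 cs|].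
  by move: cs; rewrite cellE => /andP[].
pose B k := if (k < n)%N then
  width j n * (\tr (mu (lpt j k.+1)) - \tr (mu (lpt j k))) else 2 * T.
have hB (k : 'I_(size j)) : \int[lambda]_(s in cell j k) `|mu s a b - lj (pj j mu) s a b| <= B k.
  rewrite /B; case: ifP => kn.
    rewrite (uniform_width j_unif ltn) -(uniform_width j_unif (ltn_ord k)).
    rewrite -Rintegral_cell_cst; apply: Rintegral_cell_le => //.
      exact: integrable01_cst.
    by move=> s cs; rewrite (ljE _ cs); apply: entry_deviation => //; move: kn; clear -sE; rewrite -ltnS -sE.
  have kE : k = Ordinal ltn.
    apply/val_inj => /=; apply/eqP; rewrite eqn_leq [X in _ && X]leqNgt kn andbT.
    by rewrite -ltnS -sE.
  have w0 := width_gt0 ltn.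
  have ent s : I01 s -> `|mu s a b| <= \tr (mu s).
    by case: mu_mono => _ pm _ _ /pm; exact: psd_entry_le_trace.
  have mean : `|pj j mu k a b| <= (width j n)^-1 * T.
    rewrite pjE normrM ger0_norm ?invr_ge0 ?(ltW (width_gt0 _)) // kE /=.
    rewrite ler_wpM2l ?invr_ge0 ?(ltW w0) //.
    apply: le_trans (le_normr_Rintegral (measurable_cell j n) (integrable_cell (Ordinal ltn) ie)) _.
    apply: (Rintegral_cell_le (k := Ordinal ltn)) => //; first exact: integrable01_norm.
    by move=> s /(sub_cell01 ltn); exact: ent.
  apply: (@le_trans _ _ (\int[lambda]_(s in cell j k) (\tr (mu s) + (width j n)^-1 * T))).
    apply: Rintegral_cell_le => //; first by apply: integrable01D => //; exact: integrable01_cst.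
    move=> s cs; rewrite (ljE _ cs); apply: le_trans (ler_normB _ _) _.
    by apply: lerD => //; apply: ent; exact: sub_cell01 cs.
  rewrite (RintegralD (measurable_cell j k) (integrable_cell k it) (integrable_cell k (integrable01_cst _))).
  by rewrite Rintegral_cell_cst kE /= mulrA divff ?gt_eqF // mul1r -/T; lra.
rewrite (Rintegral01_cells j ih).
apply: (@le_trans _ _ (\sum_(k < size j) B k)); first by apply: ler_sum => k _.
rewrite -(big_mkord xpredT B) sE big_nat_recr //= {2}/B ltnn.
have -> : \sum_(0 <= k < n) B k =
    width j n * \sum_(0 <= k < n) (\tr (mu (lpt j k.+1)) - \tr (mu (lpt j k))).
  by rewrite mulr_sumr; apply: eq_big_nat => k /andP[_ kn]; rewrite /B kn.
rewrite telescope_sumr // mulrBr.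
have : 0 <= width j n * \tr (mu (lpt j 0)).
  rewrite mulr_ge0 ?(ltW (width_gt0 _)) // psd_trace_ge0 //.
  by case: mu_mono => _ pm _ _; apply: pm; apply: lpt01; rewrite sE.
lra.
Qed.

(** Young's inequality tr <= (e/N) tr^2 + N/e. The first term integrates to at most D^2 e N, the
    second, over a cell of width at most e^2, to at most e N. *)
Lemma trace_last_cell (N e : R) : 0 < N -> L2norm mu <= N -> 0 < e ->
  (size j)%:R^-1 <= e ^+ 2 ->
  \int[lambda]_(s in cell j (size j).-1) \tr (mu s) <= (D%:R ^+ 2 + 1) * e * N.
Proof.
move=> N0 muN e0 je; have ltn : ((size j).-1 < size j)%N.
  by rewrite prednK // size_subdivision_gt0.
set n := (size j).-1 in ltn *; pose k := Ordinal ltn.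
have i2 := L2_integrable mu_L2; have it := integrable01_trace.
pose c := e / N * D%:R ^+ 2.
have c0 : 0 <= c by rewrite mulr_ge0 ?sqr_ge0 // divr_ge0 // ltW.
have iG := integrable01Zl c i2.
apply: (@le_trans _ _ (\int[lambda]_(s in cell j k) (c * mxip (mu s) (mu s) + N / e))).
  apply: (Rintegral_cell_le (k := k)) => //.
    by apply: integrable01D => //; exact: integrable01_cst.
  move=> s /(sub_cell01 ltn) Is; have sm : symm (mu s) by case: mu_L2 => h _ _; exact: h.
  have h := sqr_trace_le sm; rewrite /c.
  apply: (@le_trans _ _ (e / N * \tr (mu s) ^+ 2 + N / e)); last first.
    by rewrite lerD2r -[leRHS]mulrA ler_wpM2l // divr_ge0 // ltW.
  have -> : e / N * \tr (mu s) ^+ 2 + N / e =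
     ((e * \tr (mu s)) ^+ 2 + N ^+ 2) / (N * e).
    by field; rewrite !gt_eqF.
  rewrite ler_pdivlMr ?mulr_gt0 //.
  have := sqr_ge0 (e * \tr (mu s) - N); have := sqr_ge0 (e * \tr (mu s)); have := sqr_ge0 N.
  have -> : \tr (mu s) * (N * e) = e * \tr (mu s) * N by ring.
  by rewrite sqrrB; move: (e * \tr (mu s)) => x; lra.
rewrite (RintegralD (measurable_cell j k) (integrable_cell k iG) (integrable_cell k (integrable01_cst _))).
rewrite Rintegral_cell_cst (RintegralZl c (measurable_cell j k) (integrable_cell k i2)).
have h1 : \int[lambda]_(s in cell j k) mxip (mu s) (mu s) <= N ^+ 2.
  rewrite -Rintegral01_cell; apply: (@le_trans _ _ (L2ip mu mu)); last first.
    by rewrite -sqr_L2norm // ler_sqr ?nnegrE ?(ltW N0) // ipnorm_ge0.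
  apply: Rintegral01_le => //; first exact: integrable01_cell.
  move=> s Is; have sm : symm (mu s) by case: mu_L2 => h _ _; exact: h.
  have m0 := ip_ge0 euclid_mx sm.
  by rewrite indicE; case: (_ \in _); rewrite ?mul1r ?mul0r.
rewrite (uniform_width j_unif (ltn_ord k)).
apply: (@le_trans _ _ (c * N ^+ 2 + e ^+ 2 * (N / e))).
  by apply: lerD; [exact: ler_wpM2l|apply: ler_wpM2r => //; rewrite divr_ge0 // ltW].
rewrite /c le_eqVlt; apply/orP; left; apply/eqP.
by field; rewrite !gt_eqF.
Qed.

Lemma L1_projection (N e : R) : 0 < N -> L2norm mu <= N -> 0 < e ->
  (size j)%:R^-1 <= e ^+ 2 ->
  \int[lambda]_(s in I01) mxnorm2 ((mu - lj (pj j mu)) s) <=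
  (D%:R ^+ 2 * (3 * (D%:R ^+ 2 + 1))) * e * N.
Proof.
move=> N0 muN e0 je; have hp : Hj (pj j mu) by exact: pj_Hj.
have hl := lj_L2 hp; have hd := L2B mu_L2 hl.
have ia a b : integrable01 (fun s => `|mu s a b - lj (pj j mu) s a b|).
  by apply: integrable01_norm; apply: integrable01B; exact: L2_entry.
apply: (@le_trans _ _ (\int[lambda]_(s in I01) \sum_a \sum_b `|mu s a b - lj (pj j mu) s a b|)).
  apply: Rintegral01_le; first exact: integrable01_mxnorm2.
    by apply: integrable01_sum => a; exact: integrable01_sum.
  move=> s Is; have [sd _ _] := hd.
  apply: le_trans (mxnorm2_le_sum (sd s Is)) _.
  by apply: ler_sum => a _; apply: ler_sum => b _; rewrite !mxE.
rewrite Rintegral01_sum; last by move=> a; exact: integrable01_sum.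
set T := 3 * ((D%:R ^+ 2 + 1) * e * N).
apply: (@le_trans _ _ (\sum_(a < D) \sum_(b < D) T)); last first.
  by rewrite !sumr_const !card_ord -mulr_natl -(mulr_natl T) /T; lra.
apply: ler_sum => a _; rewrite Rintegral01_sum //; apply: ler_sum => b _.
apply: le_trans (L1_entry_projection a b) _.
by rewrite ler_pM2l // trace_last_cell.
Qed.

End monotone.

(* Monotonicity gives a rate n^(-1/2) in L^1, with no rate in L^2 (mass may
   concentrate near 1); this is where p < 2 is used. *)
Lemma Lpnorm_projection (p eta : R) : 1 <= p -> p < 2 -> 0 < eta ->
  exists n, forall j, uniform_subdivision j -> (n < size j)%N ->
  forall mu N, mono_paths mu -> 0 < N -> L2norm mu <= N ->
    Lpnorm p (mu - lj (pj j mu)) <= eta * N.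
Proof.
move=> p1 p2 eta0; have p0 : 0 < p by lra.
pose B := eta `^ p; have B0 : 0 < B by exact: powR_gt0.
have B20 : 0 < B / 2 by lra.
have [c c0 hc] := powR_split p1 p2 B20.
pose K : R := D%:R ^+ 2 * (3 * (D%:R ^+ 2 + 1)).
have K0 : 0 <= K.
  have ? : 0 <= (D%:R : R) ^+ 2 by rewrite sqr_ge0.
  by rewrite /K; apply: mulr_ge0 => //; lra.
have cK : 0 <= c * K by exact: mulr_ge0.
(* The budget is B = eta^p. The coefficient B/2 of the L^2 part spends one half, and [e] makes the
   L^1 part, c K e, at most the other half. *)
pose e := B / (2 * (c * K + 1)).
have e0 : 0 < e by rewrite divr_gt0 //; lra.
have eB : c * K * e <= B / 2.
  rewrite /e mulrA ler_pdivrMr; last by lra.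
  by have := mulr_ge0 (ltW B0) cK; lra.
exists (Num.truncn (e ^- 2)) => j ju nj mu N hmu N0 muN.
have [hm _ _ _] := hmu; have hp : Hj (pj j mu) by exact: pj_Hj.
have hl := lj_L2 hp; have hd := L2B hm hl.
have n0 : 0 < (size j)%:R :> R by rewrite ltr0n size_subdivision_gt0.
have je : (size j)%:R^-1 <= e ^+ 2.
  rewrite -[leRHS]invrK lef_pV2 ?posrE ?invr_gt0 ?exprn_gt0 //.
  apply: le_trans (ltW (real_truncnS_gt (num_real _))) _.
  by rewrite ler_nat.
have L1 := L1_projection hmu ju N0 muN e0 je; rewrite -/K in L1.
have L2b : L2ip (mu - lj (pj j mu)) (mu - lj (pj j mu)) <= N ^+ 2.
  rewrite L2ip_sub_projection // lerBlDr; apply: (@le_trans _ _ (N ^+ 2)); last first.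
    by rewrite lerDl (ip_ge0 (euclid_Hj _)).
  by rewrite -sqr_L2norm // ler_sqr ?nnegrE ?(ltW N0) // ipnorm_ge0.
have -> : eta = B `^ p^-1.
  by rewrite /B -powRrM divff ?gt_eqF // powRr1 // ltW.
rewrite mulrC; apply: (Lpnorm_le p1 c0 N0 hd hc).
have := ler_wpM2l (ltW B20) L2b; have := ler_wpM2l (mulr_ge0 c0 (ltW N0)) L1.
have := ler_wpM2r (sqr_ge0 N) eB; lra.
Qed.

(** Serves to show that [psi] is Lipschitz for the L^2 norm; only the finiteness of [K] matters. *)
Lemma Lpnorm_le_L2norm (p : R) : 1 <= p -> p < 2 ->
  exists2 K, 0 <= K & forall iota, L2 iota -> Lpnorm p iota <= K * L2norm iota.
Proof.
move=> p1 p2; have [c c0 hc] := powR_split p1 p2 (@ltr01 R).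
exists ((1 + 2 * c) `^ p^-1) => [|iota hi]; first exact: powR_ge0.
have n0 := ipnorm_ge0 L2ip iota; have k0 := powR_ge0 (1 + 2 * c) p^-1.
apply/ler_addgt0Pr => e e0.
(* The scale in [Lpnorm_le] must be positive even if the norm is 0; the excess costs at most [e] in
   the end. *)
pose N := L2norm iota + e / ((1 + 2 * c) `^ p^-1 + 1).
have ee0 : 0 < e / ((1 + 2 * c) `^ p^-1 + 1) by rewrite divr_gt0 //; lra.
have N0 : 0 < N by rewrite /N /L2norm; lra.
have ipN : L2ip iota iota <= N ^+ 2.
  by rewrite -sqr_L2norm // ler_sqr ?nnegrE ?(ltW N0) // /N; lra.
have L1 : \int[lambda]_(s in I01) mxnorm2 (iota s) <= 2 * N.
  have i2 := L2_integrable hi; have [si _ _] := hi.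
  have iG := integrable01Zl N^-1 i2.
  apply: (@le_trans _ _ (\int[lambda]_(s in I01) (N + N^-1 * mxip (iota s) (iota s)))).
    apply: Rintegral01_le; first exact: integrable01_mxnorm2.
      by apply: integrable01D => //; exact: integrable01_cst.
    move=> s Is; rewrite -sqr_mxnorm2; last exact: si.
    have -> : N + N^-1 * mxnorm2 (iota s) ^+ 2 = (N ^+ 2 + mxnorm2 (iota s) ^+ 2) / N.
      by field; rewrite gt_eqF.
    rewrite ler_pdivlMr //; have := sqr_ge0 (N - mxnorm2 (iota s)).
    by have := sqr_ge0 N; have := sqr_ge0 (mxnorm2 (iota s)); nra.
  rewrite (RintegralD measurable01 (integrable01_cst N) iG) Rintegral01_cst.
  rewrite (RintegralZl _ measurable01 i2) -/(L2ip iota iota).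
  have : N^-1 * L2ip iota iota <= N by rewrite ler_pdivrMl // -expr2.
  lra.
apply: (@le_trans _ _ (N * (1 + 2 * c) `^ p^-1)).
  apply: (Lpnorm_le p1 c0 N0 hi hc).
  by have := ler_wpM2l (mulr_ge0 c0 (ltW N0)) L1; lra.
rewrite /N mulrDl mulrC lerD2l mulrAC ler_pdivrMr; last by lra.
by nra.
Qed.

End projection_estimates.

(** * The discretised equations *)

Section lipnorm.
Context {R : realType} {V : zmodType}.
Variables (A : set V) (N : V -> R) (g : V -> R).

Lemma lipnorm_le (L : R) : 0 <= L ->
  (forall x y, A x -> A y -> `|g x - g y| <= L * N (x - y)) ->
  (lipnorm A N g <= L%:E)%E.
Proof. by move=> L0 h; apply: ereal_inf_lbound; exists L. Qed.

Lemma lipnorm_ge0 : (0 <= lipnorm A N g)%E.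
Proof. by apply: le_ereal_inf_tmp => _ [L [L0 _] <-]; rewrite lee_fin. Qed.

(** The infimum is itself an admissible constant: one within e / (N (x - y) + 1) of it changes the
    bound by less than [e]. *)
Lemma lipnorm_leP (L : R) : (forall x, 0 <= N x) -> (lipnorm A N g <= L%:E)%E ->
  forall x y, A x -> A y -> `|g x - g y| <= L * N (x - y).
Proof.
move=> N0 hL x y Ax Ay; apply/ler_addgt0Pr => e e0.
have n1 : 0 < N (x - y) + 1 by have := N0 (x - y); lra.
have e'0 : 0 < e / (N (x - y) + 1) by rewrite divr_gt0.
have lfin : lipnorm A N g \is a fin_num.
  by rewrite ge0_fin_numE ?lipnorm_ge0 // (le_lt_trans hL) // ltry.
have [_ [L' [L'0 hL'] <-]] := lb_ereal_inf_adherent e'0 lfin.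
move=> hlt; have {hlt} : (L'%:E < (L + e / (N (x - y) + 1))%:E)%E.
  by apply: (lt_le_trans hlt); rewrite EFinD; apply: leeD2r.
rewrite lte_fin => hlt; apply: (le_trans (hL' x y Ax Ay)).
apply: (@le_trans _ _ ((L + e / (N (x - y) + 1)) * N (x - y))).
  by rewrite ler_wpM2r // ltW.
rewrite mulrDl lerD2l mulrAC ler_pdivrMr //.
by rewrite ler_wpM2l ?(ltW e0) //; lra.
Qed.

Lemma lipnorm_finite : (forall x, 0 <= N x) -> (lipnorm A N g < +oo)%E ->
  exists L : R, [/\ 0 <= L, lipnorm A N g = L%:E
    & forall x y, A x -> A y -> `|g x - g y| <= L * N (x - y)].
Proof.
move=> N0 h; have lfin : lipnorm A N g \is a fin_num.
  by rewrite ge0_fin_numE ?lipnorm_ge0.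
exists (fine (lipnorm A N g)); split; first by rewrite fine_ge0 ?lipnorm_ge0.
  by rewrite fineK.
by apply: lipnorm_leP => //; rewrite fineK.
Qed.

End lipnorm.

Section comparison.
Context {R : realType} {D : nat}.
Implicit Types (i j : subdivision R) (mu iota : R -> 'M[R]_D).
Local Notation nrm j := (ipnorm (@Hjip R D j)).

(** [K] may depend on the partition; it only feeds [approximation_initial], whose bound does not. *)
Lemma class_S_bound j (f : R * Hvec D j -> R) : class_S f ->
  exists K, [/\ 0 <= K,
    forall t x y, 0 <= t -> Cj x -> Cj y -> `|f (t, x) - f (t, y)| <= K * nrm j (x - y)
    & forall t x, 0 <= t -> Cj x -> `|f (t, x) - f (0, x)| <= K * t].
Proof.
move=> [h1 h2 _].
have N0 (x : Hvec D j) : 0 <= nrm j x by exact: ipnorm_ge0.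
have [K1 K10 hK1] : exists2 K, 0 <= K & forall t x y, 0 <= t -> Cj x -> Cj y ->
    `|f (t, x) - f (t, y)| <= K * nrm j (x - y).
  move: h1; set S := [set _ | t in _] => h1.
  have S0 : (0 <= ereal_sup S)%E.
    by apply: (le_trans (lipnorm_ge0 (@Cj R D j) (nrm j) (fun x => f (0, x)))); apply: ereal_sup_ubound; exists 0 => //=.
  exists (fine (ereal_sup S)); first by rewrite fine_ge0.
  move=> t x y t0; apply: (@lipnorm_leP _ _ _ _ (fun x => f (t, x))) => //.
  rewrite fineK ?ge0_fin_numE //.
  by apply: ereal_sup_ubound; exists t.
have [K2 K20 hK2] : exists2 K, 0 <= K & forall t x, 0 <= t -> Cj x ->
    `|f (t, x) - f (0, x)| <= K * t.
  move: h2; set S := [set _ | t in _ & x in _] => h2.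
  have hS t x : 0 < t -> Cj x -> ((`|f (t, x) - f (0, x)| / t)%:E <= ereal_sup S)%E.
    by move=> t0 Cx; apply: ereal_sup_ubound; exists t => //; exists x.
  have S0 : (0 <= ereal_sup S)%E.
    by apply: le_trans (hS 1 0 ltr01 (@Cj0 R D j)); rewrite lee_fin divr_ge0.
  exists (fine (ereal_sup S)); first by rewrite fine_ge0.
  move=> t x; rewrite le_eqVlt => /predU1P[<- _|t0 Cx].
    by rewrite subrr normr0 mulr0.
  have := hS t x t0 Cx; rewrite -[X in (_ <= X)%E -> _]fineK ?ge0_fin_numE //.
  by rewrite lee_fin ler_pdivrMr.
exists (K1 + K2); split; first exact: addr_ge0.
  move=> t x y t0 Cx Cy; apply: le_trans (hK1 t x y t0 Cx Cy) _.
  by rewrite ler_wpM2r // lerDl.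
move=> t x t0 Cx; apply: le_trans (hK2 t x t0 Cx) _.
by rewrite ler_wpM2r // lerDr.
Qed.

Variables (H : (R -> 'M[R]_D) -> R).
Hypothesis H_loclip : locally_lipschitz L2 L2ip H.

Lemma L2_zero : L2 (0 : R -> 'M[R]_D).
Proof.
apply: integrable_L2 => [s _|a b|]; first exact: symm0.
  by under [X in measurable_fun _ X]eq_fun do rewrite mxE; apply: measurable_cst.
apply: (@integrable01_eq _ (fun=> 0)); last exact: integrable01_cst.
by move=> s _; rewrite /mxip mul0mx mxtrace0.
Qed.

Lemma hamiltonian_lipschitz (r : R) : exists2 v, 1 <= v & forall iota kappa,
  L2 iota -> L2 kappa -> L2norm iota <= r -> L2norm kappa <= r ->
  `|H iota - H kappa| <= v * L2norm (iota - kappa).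
Proof.
have N0 (x : R -> 'M[R]_D) : 0 <= ipnorm L2ip x by exact: ipnorm_ge0.
have [v [v0 _ hv]] := lipnorm_finite N0 (H_loclip r L2_zero).
(* The summand 1 makes the speed at least 1, so that [weight] dominates [tnorm]. *)
exists (v + 1) => [|iota kappa hi hk ir kr]; first by lra.
apply: le_trans (hv iota kappa _ _) _; rewrite /= ?subr0 //.
by rewrite ler_wpM2r //; lra.
Qed.

(** Since [lj (pj j (lj w)) = lj w], every partition finer than [i] sees the same value of [H] at
    [w], and only the penalty gradient [q] contributes. *)
Lemma hamiltonian_perturbation i j (L B v : R) : refined_by i j -> 0 <= B ->
  (forall iota kappa, L2 iota -> L2 kappa -> L2norm iota <= L + B ->
    L2norm kappa <= L + B -> `|H iota - H kappa| <= v * L2norm (iota - kappa)) ->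
  forall w q, @Hj R D i w -> @Hj R D j q -> nrm i w <= L -> nrm j q <= B ->
    `|H (lj (pj j (lj w) + q)) - H (lj w)| <= v * nrm j q.
Proof.
move=> ij B0 hv w q hw hq wL qB.
have EH := @euclid_Hj R D j.
have hpw : Hj (pj j (lj w)) by apply: pj_Hj; exact: lj_L2.
have npw : nrm j (pj j (lj w)) = nrm i w by rewrite -L2norm_lj // lj_pj_lj // L2norm_lj.
have hs : Hj (pj j (lj w) + q) by exact: (euclidD EH).
have -> : nrm j q = L2norm (lj (pj j (lj w) + q) - lj w).
  by rewrite -[X in L2norm (_ - X)](lj_pj_lj w ij) -ljB (addrC _ q) addrK L2norm_lj.
apply: hv; [exact: lj_L2 | exact: lj_L2 | |].
  rewrite L2norm_lj //; apply: le_trans (ler_ipnormD EH hpw hq) _.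
  by rewrite npw lerD.
by rewrite L2norm_lj //; lra.
Qed.

(** Only displacements backward in time are tested, so no regularity of [g] is involved. Applied to
    psi - M t and to the opposite of psi + M t, it makes them barriers for constant Hamiltonians. *)
Lemma superjet_affine_time j (g : Hvec D j -> R) (m : R) (u : R * Hvec D j -> R) z d :
  (forall w, u w = g w.2 + m * w.1) ->
  superjet (@Hj R D j) (@Hjip R D j) (@Cj R D j) u z d -> d.1 <= m.
Proof.
move=> uE [[z0 Dz] _ [C [del [del0 h]]]].
apply/ler_addgt0Pr => e e0; have EH := @euclid_Hj R D j.
have C0 : 0 < `|C| + 1 by have := normr_ge0 C; lra.
pose s := Num.min (Num.min (z.1 / 2) (del / 2)) (e / (`|C| + 1)).
have e'0 : 0 < e / (`|C| + 1) by rewrite divr_gt0.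
have s0 : 0 < s by rewrite !lt_min e'0 !divr_gt0.
have [s1 s2 s3] : [/\ s <= z.1 / 2, s <= del / 2 & s * (`|C| + 1) <= e].
  rewrite -ler_pdivlMr //; have : s <= s by [].
  by rewrite {2}/s !le_min => /andP[/andP[? ?] ?]; split.
have := h (z.1 - s, z.2).
rewrite /tnorm /quad /= subrr (ipnorm0 EH) (ipC EH) (ip0l EH) !uE /= addr0 expr0n /= !addr0.
rewrite [z.1 - s - z.1]addrAC subrr add0r normrN (gtr0_norm s0) => /(_ _ _) hh.
have {hh} := hh (conj _ Dz) _; rewrite /= => /(_ _ _) hh.
have : g z.2 + m * (z.1 - s) <= g z.2 + m * z.1 + d.1 * - s + C * (- s) ^+ 2.
  by apply: hh => //=; lra.
rewrite sqrrN => hq; have hC := ler_norm C.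
have : s * d.1 <= s * (m + C * s) by lra.
rewrite ler_pM2l // => h'; apply: (le_trans h'); rewrite lerD2l.
have := ler_wpM2r (ltW s0) hC; lra.
Qed.

End comparison.

(** * Initial bounds and comparison between partitions *)

Section approximations.
Context {R : realType} {D : nat}.
Implicit Types (i j : subdivision R) (mu iota : R -> 'M[R]_D).
Local Notation nrm j := (ipnorm (@Hjip R D j)).
Local Notation tnrm j := (tnorm (@Hjip R D j)).
Local Notation wgt j := (weight (@Hjip R D j)).

Lemma lipschitz_continuous_on_cylinder j (f : R * Hvec D j -> R) (K : R) : 0 <= K ->
  (forall z w, cylinder (@Cj R D j) z -> cylinder (@Cj R D j) w ->
     `|f w - f z| <= K * tnrm j (w - z)) ->
  continuous_on_cylinder (@Hjip R D j) (@Cj R D j) f.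
Proof.
move=> K0 h z Cz e e0; have K1 : 0 < K + 1 by lra.
exists (e / (K + 1)); first by rewrite divr_gt0.
move=> w Cw; rewrite ltr_pdivlMr // => hw; apply: (le_lt_trans (h z w Cz Cw)).
by have := tnorm_ge0 (@Hjip R D j) (w - z); lra.
Qed.

Lemma lj0 j : lj (0 : Hvec D j) = 0.
Proof. by rewrite -(subrr (0 : Hvec D j)) ljB subrr. Qed.

Variables (H psi : (R -> 'M[R]_D) -> R) (L M : R).
Hypothesis H_loclip : locally_lipschitz L2 L2ip H.
Hypotheses (L0 : 0 <= L) (M0 : 0 <= M).
Hypothesis psi_lip : forall mu nu, mono_paths mu -> mono_paths nu ->
  `|psi mu - psi nu| <= L * L2norm (mu - nu).
Hypothesis H_bound : forall iota, L2 iota -> L2norm iota <= L -> `|H iota| <= M.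

Lemma psi_lip_lj j (x y : Hvec D j) : Cj x -> Cj y ->
  `|psi (lj x) - psi (lj y)| <= L * nrm j (x - y).
Proof.
move=> Cx Cy; apply: le_trans (psi_lip (lj_mono_paths Cx) (lj_mono_paths Cy)) _.
by rewrite -ljB L2norm_lj //; apply: (euclidB (@euclid_Hj R D j)); exact: Cj_sub.
Qed.

Lemma psi_growth j (x : Hvec D j) : Cj x -> `|psi (lj x) - psi 0| <= L * nrm j x.
Proof.
by move=> Cx; have := psi_lip_lj Cx (@Cj0 R D j); rewrite subr0 lj0.
Qed.

Definition approximation j (f : R * Hvec D j -> R) : Prop :=
  [/\ continuous_on_cylinder (@Hjip R D j) (@Cj R D j) f,
      jet_sub (@Hj R D j) (@Hjip R D j) (@Cj R D j) (H \o @lj R D j) f,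
      jet_super (@Hj R D j) (@Hjip R D j) (@Cj R D j) (H \o @lj R D j) f
    & forall x, Cj x -> f (0, x) = psi (lj x)].

Lemma approximation_solution j (f : R * Hvec D j -> R) :
  solves_HJ (@Hj R D j) (@Hjip R D j) (@Cj R D j) (H \o @lj R D j) (psi \o @lj R D j) f ->
  approximation f.
Proof.
have EH := @euclid_Hj R D j; have sp := @Cj_span R D j.
move=> [[sub sup] f0]; split=> //.
- by have [] := sub.
- exact: (viscosity_jet_sub EH (@Cj_sub R D j) (@Cj_cone R D j) sp sub).
- exact: (viscosity_jet_super EH (@Cj_sub R D j) (@Cj_cone R D j) sp sup).
Qed.

Lemma tnorm_bounds j (z : R * Hvec D j) : 0 <= z.1 ->
  z.1 <= tnrm j z /\ nrm j z.2 <= tnrm j z.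
Proof.
move=> z0; split; first by rewrite /tnorm ger0_norm // lerDl ipnorm_ge0.
by rewrite /tnorm lerDr.
Qed.

Lemma barrier_continuous j (m : R) :
  continuous_on_cylinder (@Hjip R D j) (@Cj R D j)
    (fun z : R * Hvec D j => psi (lj z.2) + m * z.1).
Proof.
apply: (@lipschitz_continuous_on_cylinder _ _ (L + `|m|)); first by rewrite addr_ge0.
move=> z w [_ Cz] [_ Cw]; have := psi_lip_lj Cw Cz.
have -> : psi (lj w.2) + m * w.1 - (psi (lj z.2) + m * z.1) =
  (psi (lj w.2) - psi (lj z.2)) + m * (w.1 - z.1) by ring.
move=> h; apply: (le_trans (ler_normD _ _)); rewrite normrM /tnorm /=.
have := mulr_ge0 L0 (normr_ge0 (w.1 - z.1)).
have := mulr_ge0 (normr_ge0 m) (ipnorm_ge0 (@Hjip R D j) (w.2 - z.2)).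
by lra.
Qed.

(** [f] is compared with psi + M t, a supersolution for the constant Hamiltonian [M]; kernel
    gradients have norm at most [L], where [H] is at most [M]. The time kernel has slope [K], which
    handles the boundary, and it vanishes on the diagonal, where with delta = 0 nothing else
    remains. *)
Lemma approximation_initial_upper j (f : R * Hvec D j -> R) (K : R) : 0 <= K ->
  approximation f ->
  (forall t x, 0 <= t -> Cj x -> `|f (t, x) - f (0, x)| <= K * t) ->
  forall t x, 0 <= t -> Cj x -> f (t, x) <= psi (lj x) + M * t.
Proof.
move=> K0 [cf sf _ f0] hK t x t0 Cx; have ? := M0; have ? := L0.
have EH := @euclid_Hj R D j; have ac := @contraction_pj_lj R D j j.
have [vel vel1 hvel] := hamiltonian_lipschitz H_loclip (L + (L + K + 1)).
pose v (z : R * Hvec D j) := psi (lj z.2) + M * z.1.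
have fK s y : 0 <= s -> Cj y -> f (s, y) <= psi (lj y) + K * s.
  by move=> s0 Cy; have := hK s y s0 Cy; rewrite f0 // ler_norml => /andP[_ ?]; lra.
have sv : jet_super (@Hj R D j) (@Hjip R D j) (@Cj R D j) (fun=> M) v.
  move=> z d /(superjet_affine_time (g := fun y => - psi (lj y)) (m := - M)) /=.
  by rewrite lerN2; apply => w; rewrite /v; ring.
have growth z1 z2 : cylinder (@Cj R D j) z1 -> cylinder (@Cj R D j) z2 ->
    f z1 - v z2 <= 0 + (L + K) * (tnrm j z1 + tnrm j z2).
  case: z1 z2 => [s1 x1] [s2 x2] [/= s10 Cx1] [/= s20 Cx2].
  have [a1 b1] := @tnorm_bounds j (s1, x1) s10; have [a2 b2] := @tnorm_bounds j (s2, x2) s20.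
  have := psi_growth Cx1; have := psi_growth Cx2; have := fK s1 x1 s10 Cx1.
  rewrite !ler_norml /v /= in b1 b2 a1 a2 *; move=> h1 /andP[h2 _] /andP[_ h3].
  have := ler_wpM2l L0 b1; have := ler_wpM2l L0 b2; have := ler_wpM2l K0 a1.
  have := mulr_ge0 M0 s20; have := mulr_ge0 K0 (le_trans s20 a2).
  have := mulr_ge0 L0 (le_trans s20 a2); have := mulr_ge0 K0 (le_trans s10 a1).
  lra.
have speed w q1 q2 : Hj w -> Hj q1 -> Hj q2 -> nrm j w <= L ->
    nrm j q1 <= 0 + (L + K + 1) -> nrm j q2 <= 0 + (L + K + 1) ->
    (H \o @lj R D j) (pj j (lj w) + q1) - M <= vel * (nrm j q1 + nrm j q2).
  move=> hw hq1 _ wL; rewrite add0r => q1B _.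
  have A0 : 0 <= L + K + 1 by lra.
  have := hamiltonian_perturbation (@refined_refl _ j) A0 hvel hw hq1 wL q1B.
  have : `|H (lj w)| <= M by apply: H_bound; [exact: lj_L2 | rewrite L2norm_lj].
  have : 0 <= vel * nrm j q2 by rewrite mulr_ge0 ?ipnorm_ge0 //; lra.
  by rewrite !ler_norml /= => ? /andP[_ ?] /andP[_ ?]; lra.
have boundary z1 z2 : cylinder (@Cj R D j) z1 -> cylinder (@Cj R D j) z2 ->
    z1.1 = 0 \/ z2.1 = 0 -> f z1 - v z2 <= L * nrm j (pj j (lj z1.2) - pj j (lj z2.2))
     + K * `|z1.1 - z2.1| + 0 * (wgt j vel z1 + wgt j vel z2).
  case: z1 z2 => [s1 x1] [s2 x2] [/= s10 Cx1] [/= s20 Cx2] hs.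
  rewrite !pj_lj mul0r addr0 /v /=.
  have := psi_lip_lj Cx1 Cx2; have := fK s1 x1 s10 Cx1; rewrite ler_norml => h1 /andP[_ h2].
  have h3 := mulr_ge0 M0 s20.
  have : K * s1 <= K * `|s1 - s2|.
    apply: ler_wpM2l => //; case: hs => ->; first by rewrite normr_ge0.
    by rewrite subr0 ler_norm.
  lra.
have KA : L + K < L + K + 1 by lra.
have := doubling EH EH EH (@Cj_sub R D j) (@Cj_sub R D j) (@Cj0 R D j) (@Cj0 R D j)
  ac ac (@attains_max_Cj R D j j) cf (barrier_continuous M) sf sv L0 K0 (lexx 0)
  (addr_ge0 L0 K0) KA vel1 growth speed boundary (z1 := (t, x)) (z2 := (t, x)) (conj t0 Cx) (conj t0 Cx).
by rewrite /= !subrr (ipnorm0 EH) normr0 !mulr0 mul0r !addr0 subr_le0.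
Qed.

Lemma approximation_initial_lower j (f : R * Hvec D j -> R) (K : R) : 0 <= K ->
  approximation f ->
  (forall t x, 0 <= t -> Cj x -> `|f (t, x) - f (0, x)| <= K * t) ->
  forall t x, 0 <= t -> Cj x -> psi (lj x) - M * t <= f (t, x).
Proof.
move=> K0 [cf _ sf f0] hK t x t0 Cx; have ? := M0; have ? := L0.
have EH := @euclid_Hj R D j; have ac := @contraction_pj_lj R D j j.
have [vel vel1 hvel] := hamiltonian_lipschitz H_loclip (L + (L + K + 1)).
pose u (z : R * Hvec D j) := psi (lj z.2) + - M * z.1.
have fK s y : 0 <= s -> Cj y -> psi (lj y) - K * s <= f (s, y).
  by move=> s0 Cy; have := hK s y s0 Cy; rewrite f0 // ler_norml => /andP[? _]; lra.
have su : jet_sub (@Hj R D j) (@Hjip R D j) (@Cj R D j) (fun=> - M) u.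
  by move=> z d; exact: (superjet_affine_time (g := fun y => psi (lj y)) (m := - M)).
have growth z1 z2 : cylinder (@Cj R D j) z1 -> cylinder (@Cj R D j) z2 ->
    u z1 - f z2 <= 0 + (L + K) * (tnrm j z1 + tnrm j z2).
  case: z1 z2 => [s1 x1] [s2 x2] [/= s10 Cx1] [/= s20 Cx2].
  have [a1 b1] := @tnorm_bounds j (s1, x1) s10; have [a2 b2] := @tnorm_bounds j (s2, x2) s20.
  have := psi_growth Cx1; have := psi_growth Cx2; have := fK s2 x2 s20 Cx2.
  rewrite !ler_norml /u /= in b1 b2 a1 a2 *; move=> h1 /andP[h2 _] /andP[_ h3].
  have := ler_wpM2l L0 b1; have := ler_wpM2l L0 b2; have := ler_wpM2l K0 a2.
  have := mulr_ge0 M0 s10; have := mulr_ge0 K0 (le_trans s20 a2).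
  have := mulr_ge0 L0 (le_trans s20 a2); have := mulr_ge0 K0 (le_trans s10 a1).
  lra.
have speed w q1 q2 : Hj w -> Hj q1 -> Hj q2 -> nrm j w <= L ->
    nrm j q1 <= 0 + (L + K + 1) -> nrm j q2 <= 0 + (L + K + 1) ->
    - M - (H \o @lj R D j) (pj j (lj w) - q2) <= vel * (nrm j q1 + nrm j q2).
  move=> hw _ hq2 wL _; rewrite add0r => q2B.
  have A0 : 0 <= L + K + 1 by lra.
  have hq2' : Hj (- q2) by exact: (euclidN EH).
  rewrite -(ipnormN EH) in q2B.
  have := hamiltonian_perturbation (@refined_refl _ j) A0 hvel hw hq2' wL q2B.
  have : `|H (lj w)| <= M by apply: H_bound; [exact: lj_L2 | rewrite L2norm_lj].
  have : 0 <= vel * nrm j q1 by rewrite mulr_ge0 ?ipnorm_ge0 //; lra.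
  by rewrite !ler_norml (ipnormN EH) /= => ? /andP[? _] /andP[? _]; lra.
have boundary z1 z2 : cylinder (@Cj R D j) z1 -> cylinder (@Cj R D j) z2 ->
    z1.1 = 0 \/ z2.1 = 0 -> u z1 - f z2 <= L * nrm j (pj j (lj z1.2) - pj j (lj z2.2))
     + K * `|z1.1 - z2.1| + 0 * (wgt j vel z1 + wgt j vel z2).
  case: z1 z2 => [s1 x1] [s2 x2] [/= s10 Cx1] [/= s20 Cx2] hs.
  rewrite !pj_lj mul0r addr0 /u /=.
  have := psi_lip_lj Cx1 Cx2; have := fK s2 x2 s20 Cx2; rewrite ler_norml => h1 /andP[_ h2].
  have h3 := mulr_ge0 M0 s10.
  have : K * s2 <= K * `|s1 - s2|.
    apply: ler_wpM2l => //; case: hs => ->; last by rewrite normr_ge0.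
    by rewrite sub0r normrN ler_norm.
  lra.
have KA : L + K < L + K + 1 by lra.
have := doubling EH EH EH (@Cj_sub R D j) (@Cj_sub R D j) (@Cj0 R D j) (@Cj0 R D j)
  ac ac (@attains_max_Cj R D j j) (barrier_continuous (- M)) cf su sf L0 K0 (lexx 0)
  (addr_ge0 L0 K0) KA vel1 growth speed boundary (z1 := (t, x)) (z2 := (t, x)) (conj t0 Cx) (conj t0 Cx).
rewrite /= !subrr (ipnorm0 EH) normr0 !mulr0 mul0r !addr0 subr_le0.
by rewrite mulNr.
Qed.

Lemma approximation_initial j (f : R * Hvec D j -> R) : approximation f -> class_S f ->
  forall t x, 0 <= t -> Cj x -> `|f (t, x) - psi (lj x)| <= M * t.
Proof.
move=> af /class_S_bound [K [K0 _ hK]] t x t0 Cx.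
have h1 := approximation_initial_upper K0 af hK t0 Cx.
have h2 := approximation_initial_lower K0 af hK t0 Cx.
by rewrite ler_norml; apply/andP; split; lra.
Qed.

(** When one time is 0, the initial errors M s1 + M s2 equal M |s1 - s2|; this fixes the slope [M]
    of the time kernel. Penalty gradients are at most delta + A with A = L + M + 1, so radius L + (L
    + M + 2) suffices and [vel] can be chosen before the partitions and [delta]. *)
Lemma approximation_comparison (delta vel : R) i j1 j2
    (f1 : R * Hvec D j1 -> R) (f2 : R * Hvec D j2 -> R) :
  refined_by i j1 -> refined_by i j2 -> 0 <= delta -> delta <= 1 -> 1 <= vel ->
  (forall iota kappa, L2 iota -> L2 kappa -> L2norm iota <= L + (L + M + 2) ->
    L2norm kappa <= L + (L + M + 2) -> `|H iota - H kappa| <= vel * L2norm (iota - kappa)) ->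
  approximation f1 -> class_S f1 -> approximation f2 -> class_S f2 ->
  (forall x y, Cj x -> Cj y -> psi (lj x) - psi (lj y) <=
     L * nrm i (pj i (lj x) - pj i (lj y)) +
     delta * (snorm 1 (nrm j1 x) + snorm 1 (nrm j2 y))) ->
  forall z1 z2, cylinder (@Cj R D j1) z1 -> cylinder (@Cj R D j2) z2 ->
  f1 z1 - f2 z2 <= L * nrm i (pj i (lj z1.2) - pj i (lj z2.2))
    + M * `|z1.1 - z2.1| + delta * (wgt j1 vel z1 + wgt j2 vel z2).
Proof.
move=> ij1 ij2 delta0 delta1 vel1 hvel a1 S1 a2 S2 hpsi.
have [cf1 sf1 _ _] := a1; have [cf2 _ sf2 _] := a2.
have ? := M0; have ? := L0.
have [E1 E2 Ei] := And3 (@euclid_Hj R D j1) (@euclid_Hj R D j2) (@euclid_Hj R D i).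
have growth z1 z2 : cylinder (@Cj R D j1) z1 -> cylinder (@Cj R D j2) z2 ->
    f1 z1 - f2 z2 <= 0 + (L + M) * (tnrm j1 z1 + tnrm j2 z2).
  case: z1 z2 => [s1 x1] [s2 x2] [/= s10 Cx1] [/= s20 Cx2].
  have [b1 c1] := @tnorm_bounds j1 (s1, x1) s10; have [b2 c2] := @tnorm_bounds j2 (s2, x2) s20.
  have := psi_growth Cx1; have := psi_growth Cx2.
  have := approximation_initial a1 S1 s10 Cx1; have := approximation_initial a2 S2 s20 Cx2.
  rewrite !ler_norml /= in b1 b2 c1 c2 *.
  move=> /andP[h1 _] /andP[_ h2] /andP[h3 _] /andP[_ h4].
  have := ler_wpM2l L0 c1; have := ler_wpM2l L0 c2.
  have := ler_wpM2l M0 b1; have := ler_wpM2l M0 b2.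
  lra.
have speed w q1 q2 : Hj w -> Hj q1 -> Hj q2 -> nrm i w <= L ->
    nrm j1 q1 <= delta + (L + M + 1) -> nrm j2 q2 <= delta + (L + M + 1) ->
    (H \o @lj R D j1) (pj j1 (lj w) + q1) - (H \o @lj R D j2) (pj j2 (lj w) - q2)
      <= vel * (nrm j1 q1 + nrm j2 q2).
  move=> hw hq1 hq2 wL q1B q2B.
  have A0 : 0 <= L + M + 2 by lra.
  have hq2' : Hj (- q2) by exact: (euclidN E2).
  have {}q1B : nrm j1 q1 <= L + M + 2 by lra.
  have {}q2B : nrm j2 (- q2) <= L + M + 2 by rewrite (ipnormN E2); lra.
  have := hamiltonian_perturbation ij1 A0 hvel hw hq1 wL q1B.
  have := hamiltonian_perturbation ij2 A0 hvel hw hq2' wL q2B.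
  by rewrite !ler_norml (ipnormN E2) /= => /andP[? _] /andP[_ ?]; lra.
have boundary z1 z2 : cylinder (@Cj R D j1) z1 -> cylinder (@Cj R D j2) z2 ->
    z1.1 = 0 \/ z2.1 = 0 -> f1 z1 - f2 z2 <= L * nrm i (pj i (lj z1.2) - pj i (lj z2.2))
     + M * `|z1.1 - z2.1| + delta * (wgt j1 vel z1 + wgt j2 vel z2).
  case: z1 z2 => [s1 x1] [s2 x2] [/= s10 Cx1] [/= s20 Cx2] hs.
  have := hpsi _ _ Cx1 Cx2; rewrite /weight /=.
  have := approximation_initial a1 S1 s10 Cx1; have := approximation_initial a2 S2 s20 Cx2.
  rewrite !ler_norml => /andP[h1 _] /andP[_ h2].
  have v0 : 0 <= vel by lra.
  have := mulr_ge0 delta0 (mulr_ge0 v0 s10); have := mulr_ge0 delta0 (mulr_ge0 v0 s20).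
  have : M * (s1 + s2) <= M * `|s1 - s2|.
    apply: ler_wpM2l => //; case: hs => ->; first by rewrite add0r sub0r normrN ler_norm.
    by rewrite addr0 subr0 ler_norm.
  lra.
have KA : L + M < L + M + 1 by lra.
move=> z1 z2 Cz1 Cz2.
exact: (doubling E1 E2 Ei (@Cj_sub R D j1) (@Cj_sub R D j2) (@Cj0 R D j1) (@Cj0 R D j2)
  (@contraction_pj_lj R D i j1) (@contraction_pj_lj R D i j2)
  (@attains_max_Cj R D j1 j2) cf1 cf2 sf1 sf2 L0 M0 delta0
  (addr_ge0 L0 M0) KA vel1 growth speed boundary Cz1 Cz2).
Qed.

Lemma approximation_lipschitz j (f : R * Hvec D j -> R) : approximation f -> class_S f ->
  forall z1 z2, cylinder (@Cj R D j) z1 -> cylinder (@Cj R D j) z2 ->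
  `|f z1 - f z2| <= L * nrm j (z1.2 - z2.2) + M * `|z1.1 - z2.1|.
Proof.
move=> af Sf.
have [vel vel1 hvel] := hamiltonian_lipschitz H_loclip (L + (L + M + 2)).
have h z1 z2 : cylinder (@Cj R D j) z1 -> cylinder (@Cj R D j) z2 ->
    f z1 - f z2 <= L * nrm j (z1.2 - z2.2) + M * `|z1.1 - z2.1|.
  move=> Cz1 Cz2.
  have := approximation_comparison (@refined_refl _ j) (@refined_refl _ j) (lexx 0)
    ler01 vel1 hvel af Sf af Sf _ Cz1 Cz2.
  rewrite !pj_lj mul0r addr0; apply=> x y Cx Cy; rewrite !pj_lj mul0r addr0.
  by have := psi_lip_lj Cx Cy; rewrite ler_norml => /andP[].
move=> z1 z2 Cz1 Cz2; rewrite ler_norml; have := h _ _ Cz1 Cz2; have := h _ _ Cz2 Cz1.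
rewrite (ipnorm_distC (@euclid_Hj R D j) z2.2) (distrC z2.1).
by move=> *; apply/andP; split; lra.
Qed.

End approximations.

(** * Convergence *)

Section nets.
Context {R : realType}.
Implicit Types (J : set (subdivision R)) (j : subdivision R).

(* If all sizes were bounded, no member would separate 0 from a point close
   to it, so that no generated set would. *)
Lemma good_size_unbounded J n : good J -> exists2 j, J j & (n < size j)%N.
Proof.
move=> [[_ genJ] unifJ]; apply: contrapT => hJ.
have sizeJ j : J j -> (size j <= n)%N.
  by move=> Jj; rewrite leqNgt; apply/negP => nj; apply: hJ; exists j.
(* A point of the first cell of every member, if all sizes are at most [n]; n + 2 keeps it below 1
   also for n = 0. Sets in [P] do not separate it from 0, whereas the Borel set {0} does. *)
pose c : R := n.+2%:R^-1.
have c0 : 0 < c by rewrite invr_gt0 ltr0n.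
have c1 : c < 1 by rewrite invf_lt1 ?ltr0n // ltr1n.
pose P := [set A : set R | A 0 <-> A c].
have [I0 Ic] : (`[0, 1[%classic : set R) 0 /\ (`[0, 1[%classic : set R) c.
  by rewrite /= !in_itv /= lexx ltr01 (ltW c0) c1.
have sP : sigma_algebra (`[0, 1[%classic : set R) P.
  split=> //.
  - by move=> A [h1 h2]; split=> -[? nA]; split=> // Ax; apply: nA; [exact: h2|exact: h1].
  - by move=> A hA; split=> -[k _ Ak]; exists k => //; apply/hA.
have sub : <<s (`[0, 1[%classic : set R), \bigcup_(j in J)
    <<s (`[0, 1[%classic : set R), [set cell j k | k in [set k | (k < size j)%N]] >> >> `<=` P.
  apply: smallest_sub => // A [j Jj]; move: A; apply: smallest_sub => // _ [k /= kj <-].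
  have uj := unifJ j Jj; have n0 : 0 < (size j)%:R :> R by rewrite ltr0n size_subdivision_gt0.
  have cj : c < (size j)%:R^-1.
    rewrite /c ltf_pV2 ?posrE ?ltr0n ?size_subdivision_gt0 // ltr_nat ltnS.
    exact: leq_trans (sizeJ j Jj) _.
  rewrite /P /= !cellE; case: k kj => [|k] kj.
    rewrite lpt0 lexx (ltW c0) /= uj // mul1r cj invr_gt0 n0 //.
  have : (size j)%:R^-1 <= lpt j k.+1.
    by rewrite lptS uj 1?ltnW // ler_peMl ?invr_ge0 ?(ltW n0) // ler1n.
  move=> hk; split=> /andP[h _].
    by have := lt_le_trans (lt_trans c0 cj) (le_trans hk h); rewrite ltxx.
  by have := lt_le_trans cj (le_trans hk h); rewrite ltxx.
have P0 : P [set 0].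
  apply: sub; rewrite genJ; split; first exact: measurable_set1.
  by move=> _ ->; exact: I0.
have [/(_ erefl) /= h _] := P0.
by move: c0; rewrite h ltxx.
Qed.

Lemma tails_proper_filter J : directed J -> J !=set0 -> ProperFilter (tails J).
Proof.
move=> dJ [j0 Jj0]; apply: Build_ProperFilter.
  by case=> j Jj h; exact: (h j Jj).
split.
- by exists j0.
- move=> P Q [j1 J1 h1] [j2 J2 h2]; have [j3 J3 [r1 r2]] := dJ _ _ J1 J2.
  exists j3 => // j Jj r3; split; [apply: h1 | apply: h2] => // x hx; apply: r3.
    exact: r1.
  exact: r2.
- by move=> P Q PQ [j1 J1 h1]; exists j1 => // j Jj r; exact/PQ/h1.
Qed.

End nets.

Section convergence.
Context {R : realType} {D : nat}.
Local Notation nrm j := (ipnorm (@Hjip R D j)).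
Local Notation wgt j := (weight (@Hjip R D j)).
Variables (H psi : (R -> 'M[R]_D) -> R) (L M C p : R).
Hypothesis H_loclip : locally_lipschitz L2 L2ip H.
Hypotheses (L0 : 0 <= L) (M0 : 0 <= M).
Hypotheses (C_gt0 : 0 < C) (p_ge1 : 1 <= p) (p_lt2 : p < 2).
Hypothesis psi_Lp : forall mu nu, mono_paths mu -> mono_paths nu ->
     `|psi mu - psi nu| <= C * Lpnorm p (mu - nu).
Hypothesis psi_lip : forall mu nu, mono_paths mu -> mono_paths nu ->
  `|psi mu - psi nu| <= L * L2norm (mu - nu).
Hypothesis H_bound : forall iota, L2 iota -> L2norm iota <= L -> `|H iota| <= M.
Variables (J : set (subdivision R)) (fj : forall j : subdivision R, R * Hvec D j -> R).
Arguments fj : clear implicits.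
Hypothesis J_good : good J.
Hypothesis fj_S : forall j, J j -> class_S (fj j).
Hypothesis fj_sol : forall j, J j ->
     solves_HJ (@Hj R D j) (@Hjip R D j) (@Cj R D j)
       (H \o @lj R D j) (psi \o @lj R D j) (fj j).

Let F j (z : R * (R -> 'M[R]_D)) : R := lift_up (fj j) z.

Let dirJ : directed J. Proof. by case: J_good => -[]. Qed.

Let approx j : J j -> approximation H psi (fj j).
Proof. by move=> /fj_sol; exact: approximation_solution. Qed.

Lemma cylinder_pj j z : cylinder (@mono_paths R D) z -> cylinder (@Cj R D j) (z.1, pj j z.2).
Proof. by move=> [z0 mz]; split=> //; exact: pj_Cj. Qed.

Lemma lift_up_lipschitz j z w : J j -> cylinder mono_paths z -> cylinder mono_paths w ->
  `|F j z - F j w| <= L * L2norm (z.2 - w.2) + M * `|z.1 - w.1|.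
Proof.
move=> Jj Cz Cw.
have := approximation_lipschitz H_loclip L0 M0 psi_lip H_bound (approx Jj) (fj_S Jj)
  (cylinder_pj j Cz) (cylinder_pj j Cw) => /le_trans; apply.
rewrite lerD2r ler_wpM2l //; have [[_ [hz _ _ _]] [_ [hw _ _ _]]] := (Cz, Cw).
by rewrite -pjB // ipnorm_pj_le //; exact: L2B.
Qed.

(** The error is proportional to the norm bound [N], with [n] independent of it: the initial
    comparison is needed for every element of the cone. *)
Lemma psi_projection (delta : R) : 0 < delta ->
  exists n, forall j, J j -> (n < size j)%N ->
  forall mu N, mono_paths mu -> 0 < N -> L2norm mu <= N ->
    `|psi mu - psi (lj (pj j mu))| <= delta * N.
Proof.
move=> d0; have dC : 0 < delta / C by rewrite divr_gt0.
have [n hn] := @Lpnorm_projection R D p _ p_ge1 p_lt2 dC.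
exists n => j Jj nj mu N hmu N0 muN.
have uj : uniform_subdivision j by case: J_good => _; exact.
apply: le_trans (psi_Lp hmu (lj_mono_paths (pj_Cj j hmu))) _.
rewrite mulrC -ler_pdivlMr // mulrAC; exact: hn.
Qed.

(** At projections of the same [z] the distances in space (by the tower property) and time vanish,
    leaving [delta] times the two weights. The radius bounds the projections of [z] and not its L^2
    norm, because the triangle inequality is at hand in H^j. *)
Lemma lift_up_cauchy (b e : R) : 0 <= b -> 0 < e ->
  exists2 i, J i & forall j, J j -> refined_by i j -> forall z, cylinder mono_paths z ->
    z.1 <= b -> (forall k, nrm k (pj k z.2) <= b) -> `|F j z - F i z| <= e.
Proof.
move=> b0 e0; have [vel vel1 hvel] := hamiltonian_lipschitz H_loclip (L + (L + M + 2)).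
(* Bounds the weight of every projection of [z]; it is fixed before [delta] and the partition,
   neither of which affects [vel]. *)
pose W := 1 + b + vel * b.
have W0 : 0 < W by have := mulr_ge0 (le_trans ler01 vel1) b0; rewrite /W; lra.
pose delta := Num.min 1 (e / (2 * W)).
have eW : 0 < e / (2 * W) by rewrite divr_gt0 // mulr_gt0.
have d0 : 0 < delta by rewrite lt_min ltr01 eW.
have d1 : delta <= 1 by rewrite ge_min lexx.
have dW : delta * (W + W) <= e.
  apply: (@le_trans _ _ (e / (2 * W) * (W + W))).
    by apply: ler_wpM2r; [lra | rewrite ge_min lexx orbT].
  by rewrite le_eqVlt; apply/orP; left; apply/eqP; field; rewrite gt_eqF.
have [n hn] := psi_projection d0.
have [i Ji ni] := good_size_unbounded n J_good.
exists i => // j Jj ij z Cz zb nb.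
have [z0 mz] := Cz; have [hz _ _ _] := mz.
have wb k : wgt k vel (z.1, pj k z.2) <= W.
  rewrite /weight /W /=; have := snorm_le (nrm k (pj k z.2)) (@ler01 R).
  rewrite ger0_norm ?ipnorm_ge0 //; have := nb k.
  have := ler_wpM2l (le_trans ler01 vel1) zb; lra.
have close (y : Hvec D j) : Cj y ->
    `|psi (lj y) - psi (lj (pj i (lj y)))| <= delta * snorm 1 (nrm j y).
  move=> Cy; apply: hn => //; first exact: lj_mono_paths.
    by rewrite snorm_gt0.
  rewrite L2norm_lj; last exact: Cj_sub.
  exact: le_trans (ler_norm _) (snorm_ge _ _).
have s0 k (x : Hvec D k) : 0 <= delta * snorm 1 (nrm k x).
  by rewrite mulr_ge0 ?sqrtr_ge0 // ltW.
have h1 : F i z - F j z <= delta * (W + W).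
  have := approximation_comparison H_loclip L0 M0 psi_lip H_bound (@refined_refl _ i) ij
    (ltW d0) d1 vel1 hvel (approx Ji) (fj_S Ji) (approx Jj) (fj_S Jj) _
    (cylinder_pj i Cz) (cylinder_pj j Cz).
  rewrite /= pj_lj (pj_lj_pj ij hz) !subrr (ipnorm0 (@euclid_Hj R D i)) normr0 !mulr0 !add0r.
  move=> h; apply: (le_trans (h _)); last by rewrite ler_wpM2l ?(ltW d0) // lerD.
  move=> x y Cx Cy; rewrite pj_lj mulrDr; have := s0 i x; have := close y Cy.
  have := psi_lip_lj psi_lip Cx (pj_Cj i (lj_mono_paths Cy)).
  by rewrite !ler_norml => /andP[_ ?] /andP[? _]; lra.
have h2 : F j z - F i z <= delta * (W + W).
  have := approximation_comparison H_loclip L0 M0 psi_lip H_bound ij (@refined_refl _ i)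
    (ltW d0) d1 vel1 hvel (approx Jj) (fj_S Jj) (approx Ji) (fj_S Ji) _
    (cylinder_pj j Cz) (cylinder_pj i Cz).
  rewrite /= pj_lj (pj_lj_pj ij hz) !subrr (ipnorm0 (@euclid_Hj R D i)) normr0 !mulr0 !add0r.
  move=> h; apply: (le_trans (h _)); last by rewrite ler_wpM2l ?(ltW d0) // lerD.
  move=> y x Cy Cx; rewrite pj_lj mulrDr; have := s0 i x; have := close y Cy.
  have := psi_lip_lj psi_lip (pj_Cj i (lj_mono_paths Cy)) Cx.
  by rewrite !ler_norml => /andP[_ ?] /andP[_ ?]; lra.
by rewrite ler_norml; apply/andP; split; lra.
Qed.

Definition lift_up_limit z : R := lim (F j z @[j --> tails J]).

Let tails_filter : ProperFilter (tails J).
Proof.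
by apply: tails_proper_filter => //; have [j Jj _] := good_size_unbounded 0 J_good; exists j.
Qed.

Lemma lift_up_cvg z : cylinder mono_paths z ->
  F j z @[j --> tails J] --> lift_up_limit z.
Proof.
move=> Cz; have [z0 [hz _ _ _]] := Cz.
have b0 : 0 <= z.1 + L2norm z.2 by rewrite addr_ge0 // ipnorm_ge0.
have PF := tails_filter; apply/cauchy_cvgP/cauchy_exP => e e0.
have e20 : 0 < e / 2 by rewrite divr_gt0.
have [i Ji hi] := lift_up_cauchy b0 e20; exists (F i z); exists i => // j Jj ij.
rewrite /= /ball /= distrC; apply: le_lt_trans (hi j Jj ij z Cz _ _) _.
- by rewrite lerDl ipnorm_ge0.
- by move=> k; apply: (le_trans (ipnorm_pj_le k hz)); rewrite lerDr.
- lra.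
Qed.

Lemma lift_up_uniform_cvg (b e : R) : 0 <= b -> 0 < e ->
  exists2 i, J i & forall j, J j -> refined_by i j -> forall z, cylinder mono_paths z ->
    z.1 <= b -> (forall k, nrm k (pj k z.2) <= b) -> `|lift_up_limit z - F j z| <= e.
Proof.
move=> b0 e0; have e20 : 0 < e / 2 by lra.
have [i Ji hi] := lift_up_cauchy b0 e20; exists i => // j Jj ij z Cz zb nb.
apply/ler_addgt0Pr => r r0; have PF := tails_filter.
have /cvgrPdist_lt/(_ r r0) [k Jk hk] := lift_up_cvg Cz.
(* The limit is reached through an index [m] finer than [i], to which the Cauchy estimate applies,
   and than [k], where [F] is within [r] of its limit. *)
have [m Jm [im km]] := dirJ Ji Jk.
have h1 := hi _ Jj ij z Cz zb nb; have h2 := hi _ Jm im z Cz zb nb; have h3 := hk m Jm km.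
move: h1 h2 h3; rewrite !ler_norml /= ltr_norml.
by move=> /andP[? ?] /andP[? ?] /andP[? ?]; apply/andP; split; lra.
Qed.

Lemma lift_up_limit_lipschitz z w : cylinder mono_paths z -> cylinder mono_paths w ->
  `|lift_up_limit z - lift_up_limit w| <= L * L2norm (z.2 - w.2) + M * `|z.1 - w.1|.
Proof.
move=> Cz Cw; have [[z0 [hz _ _ _]] [w0 [hw _ _ _]]] := (Cz, Cw).
have [nz nw] := (ipnorm_ge0 L2ip z.2, ipnorm_ge0 L2ip w.2).
pose b := (z.1 + L2norm z.2) + (w.1 + L2norm w.2).
have b0 : 0 <= b by rewrite !addr_ge0.
apply/ler_addgt0Pr => e e0; have e20 : 0 < e / 2 by lra.
have [i Ji hi] := lift_up_uniform_cvg b0 e20.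
have h1 : `|lift_up_limit z - F i z| <= e / 2.
  apply: hi => // [|k]; first by rewrite /b /L2norm; lra.
  by apply: (le_trans (ipnorm_pj_le k hz)); rewrite /b /L2norm; lra.
have h2 : `|lift_up_limit w - F i w| <= e / 2.
  apply: hi => // [|k]; first by rewrite /b /L2norm; lra.
  by apply: (le_trans (ipnorm_pj_le k hw)); rewrite /b /L2norm; lra.
have := lift_up_lipschitz Ji Cz Cw; move: h1 h2; rewrite !ler_norml.
by move=> /andP[? ?] /andP[? ?] /andP[? ?]; apply/andP; split; lra.
Qed.

Lemma lift_up_limit0 mu : mono_paths mu -> lift_up_limit (0, mu) = psi mu.
Proof.
move=> mmu; have [hmu _ _ _] := mmu.
have Cmu : cylinder mono_paths (0 : R, mu) by split.
have n0 : 0 <= L2norm mu := ipnorm_ge0 _ _.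
have N0 : 0 < L2norm mu + 1 by lra.
apply/eqP; rewrite -subr_eq0 -normr_le0; apply/ler_addgt0Pr => e e0; rewrite add0r.
have e20 : 0 < e / 2 by lra.
have d0 : 0 < e / 2 / (L2norm mu + 1) by rewrite divr_gt0.
have [n hn] := psi_projection d0.
have [i Ji hi] := lift_up_uniform_cvg n0 e20.
have [k Jk nk] := good_size_unbounded n J_good.
(* Finer than [i] for the uniform convergence, and finer than [k] so that its size still exceeds
   [n]. *)
have [j Jj [ij kj]] := dirJ Ji Jk.
have h1 := hi j Jj ij _ Cmu n0 (fun k => ipnorm_pj_le k hmu).
have muN : L2norm mu <= L2norm mu + 1 by lra.
have := hn j Jj (leq_trans nk (refined_size kj)) mu _ mmu N0 muN.
rewrite divfK ?gt_eqF // => h2.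
have Fj0 : F j (0, mu) = psi (lj (pj j mu)).
  by rewrite /F /lift_up /=; have [_ _ _ ->] := approx Jj; last exact: pj_Cj.
rewrite Fj0 in h1; move: h1 h2; rewrite !ler_norml.
by move=> /andP[? ?] /andP[? ?]; apply/andP; split; lra.
Qed.

Lemma lift_up_family_cvg :
  {family closed_balls L2ip (cylinder mono_paths), F @ tails J --> lift_up_limit}.
Proof.
have PF := tails_filter; apply/fam_cvgP => B [c [r [[c0 mc] ->]]] P /uniform_nbhs [E [entE EP]].
have [hc _ _ _] := mc.
have [e e0 he] : exists2 e : R, 0 < e & forall x y : R, `|x - y| < e -> E (x, y).
  move: entE; rewrite -entourage_ballE => -[e /= e0 he].
  by exists e => // x y xy; exact: he.
have nc : 0 <= L2norm c.2 := ipnorm_ge0 _ _.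
(* The radius [r] of a ball may have any sign, hence its absolute value. *)
pose b := c.1 + L2norm c.2 + `|r|.
have b0 : 0 <= b by rewrite !addr_ge0.
have e20 : 0 < e / 2 by lra.
have [i Ji hi] := lift_up_uniform_cvg b0 e20.
apply: (filterS EP); exists i => // j Jj ij z [Cz zr].
apply: he; apply: (@le_lt_trans _ _ (e / 2)); last by lra.
have [z0 [hz _ _ _]] := Cz.
have nzc : 0 <= L2norm (z.2 - c.2) := ipnorm_ge0 _ _.
have [zr1 zr2] : `|z.1 - c.1| <= `|r| /\ L2norm (z.2 - c.2) <= `|r|.
  have := ler_norm r; have := normr_ge0 (z.1 - c.1).
  by move: zr; rewrite /tnorm /= -/(L2norm _); split; lra.
apply: hi => // [|k].
  by move: zr1; rewrite ler_norml /b => /andP[_ ?]; lra.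
(* The triangle inequality is applied after projection, in H^k. *)
have -> : pj k z.2 = pj k (z.2 - c.2) + pj k c.2 by rewrite pjB // subrK.
apply: le_trans (ler_ipnormD (@euclid_Hj R D k) _ _) _.
- by apply: pj_Hj; exact: L2B.
- exact: pj_Hj.
- have := ipnorm_pj_le k (L2B hz hc); have := ipnorm_pj_le k hc; rewrite /b; lra.
Qed.

End convergence.

Theorem proposition3p10 (R : realType) (D : nat) (D_ge1 : (1 <= D)%N)
  (H : (R -> 'M[R]_D) -> R)
  (H_loclip : locally_lipschitz L2 L2ip H)
  (H_incr : cone_increasing L2 L2dual H)
  (psi : (R -> 'M[R]_D) -> R)
  (psi_incr : cone_increasing mono_paths L2dual psi)
  (C p : R) (C_gt0 : 0 < C) (p_ge1 : 1 <= p) (p_lt2 : p < 2)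
  (psi_Lp : forall mu nu, mono_paths mu -> mono_paths nu ->
     `|psi mu - psi nu| <= C * Lpnorm p (mu - nu))
  (J : set (subdivision R)) (J_good : good J)
  (fj : forall j : subdivision R, R * Hvec D j -> R)
  (fj_S : forall j, J j -> class_S (fj j))
  (fj_sol : forall j, J j ->
     solves_HJ (@Hj R D j) (@Hjip R D j) (@Cj R D j)
       (H \o @lj R D j) (psi \o @lj R D j) (fj j)) :
  exists f : R * (R -> 'M[R]_D) -> R,
  [/\ {family closed_balls L2ip (cylinder mono_paths),
         (fun j => lift_up (fj j)) @ tails J --> f},
      (lipnorm (cylinder mono_paths) (tnorm L2ip) f < +oo)%E,
      forall mu, mono_paths mu -> f (0, mu) = psi mu,
      (ereal_sup [set lipnorm mono_paths L2norm (fun mu => f (t, mu))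
         | t in [set t | (0 <= t)%R]] <= lipnorm mono_paths L2norm psi)%E
    & (ereal_sup [set lipnorm [set t : R | (0 <= t)%R] Num.norm
                        (fun t => f (t, mu)) | mu in mono_paths]
       <= ereal_sup [set `|H iota|%:E | iota in
            [set iota | L2 iota /\
               ((L2norm iota)%:E <= lipnorm mono_paths L2norm psi)%E]])%E].
Proof.
have N0 (x : R -> 'M[R]_D) : 0 <= L2norm x by exact: ipnorm_ge0.
have [K K0 hK] := @Lpnorm_le_L2norm R D p p_ge1 p_lt2.
(* [L] is the Lipschitz norm of [psi] itself and not the crude bound C K, so that both final
   estimates carry the stated constants. *)
have [L [L0 LE psi_lip]] : exists L : R, [/\ 0 <= L,
    lipnorm mono_paths L2norm psi = L%:E & forall mu nu, mono_paths mu -> mono_paths nu ->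
      `|psi mu - psi nu| <= L * L2norm (mu - nu)].
  apply: lipnorm_finite => //; apply: le_lt_trans (ltry (C * K)).
  apply: lipnorm_le; first by rewrite mulr_ge0 // ltW.
  move=> mu nu mmu mnu; have [[hmu _ _ _] [hnu _ _ _]] := (mmu, mnu).
  apply: le_trans (psi_Lp _ _ mmu mnu) _.
  by rewrite -mulrA ler_pM2l // hK //; exact: L2B.
rewrite LE; set S := [set `|H iota|%:E | iota in _].
have S_H iota : L2 iota -> L2norm iota <= L -> (`|H iota|%:E <= ereal_sup S)%E.
  by move=> hi iL; apply: ereal_sup_ubound; exists iota => //=; rewrite lee_fin.
have L2z := @L2_zero R D.
have n0 : L2norm (0 : R -> 'M[R]_D) <= L.
  by rewrite /L2norm /ipnorm (_ : L2ip _ _ = 0) ?sqrtr0 // -(subrr 0) L2ipB //; ring.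
have S0 : (0 <= ereal_sup S)%E by apply: le_trans (S_H 0 L2z n0).
(* The supremum is a real number: it is nonnegative because 0 lies in the ball, and finite because
   [H] is Lipschitz on the ball of radius [L] about 0. *)
have S_fin : ereal_sup S \is a fin_num.
  rewrite ge0_fin_numE //.
  have [v v1 hv] := hamiltonian_lipschitz H_loclip L.
  apply: le_lt_trans (ltry (`|H 0| + v * L)); apply: ge_ereal_sup => _ [iota [hi iL] <-].
  rewrite lee_fin in iL; rewrite lee_fin; have := hv iota 0 hi L2z iL n0; rewrite subr0 => h.
  have v0 : 0 <= v by lra.
  have := ler_wpM2l v0 iL; have := ler_normD (H iota - H 0) (H 0).
  by rewrite subrK; lra.
pose M := fine (ereal_sup S); have M0 : 0 <= M by exact: fine_ge0.
have SM : ereal_sup S = M%:E by rewrite /M fineK.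
have H_bound iota : L2 iota -> L2norm iota <= L -> `|H iota| <= M.
  by move=> hi iL; rewrite -lee_fin -SM S_H.
have f_lip := lift_up_limit_lipschitz H_loclip L0 M0 C_gt0 p_ge1 p_lt2 psi_Lp psi_lip
  H_bound J_good fj_S fj_sol.
exists (lift_up_limit J fj); split.
- exact: (lift_up_family_cvg H_loclip L0 M0 C_gt0 p_ge1 p_lt2 psi_Lp psi_lip
    H_bound J_good fj_S fj_sol).
- apply: le_lt_trans (ltry (L + M)); apply: lipnorm_le; first exact: addr_ge0.
  move=> z w Cz Cw; apply: le_trans (f_lip _ _ Cz Cw) _.
  rewrite /tnorm /= -/(L2norm _).
  have := mulr_ge0 L0 (normr_ge0 (z.1 - w.1)); have := mulr_ge0 M0 (N0 (z.2 - w.2)); lra.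
- exact: (lift_up_limit0 H_loclip L0 M0 C_gt0 p_ge1 p_lt2 psi_Lp psi_lip
    H_bound J_good fj_S fj_sol).
- apply: ge_ereal_sup => _ [t /= t0 <-]; apply: lipnorm_le => // mu nu mmu mnu.
  apply: le_trans (f_lip (t, mu) (t, nu) (conj t0 mmu) (conj t0 mnu)) _.
  by rewrite /= subrr normr0 mulr0 addr0.
- rewrite SM; apply: ge_ereal_sup => _ [mu mmu <-]; apply: lipnorm_le => // s t /= s0 t0.
  apply: le_trans (f_lip (s, mu) (t, mu) (conj s0 mmu) (conj t0 mmu)) _.
  rewrite /= subrr (_ : L2norm 0 = 0) ?mulr0 ?add0r //.
  by rewrite /L2norm /ipnorm (_ : L2ip _ _ = 0) ?sqrtr0 // -(subrr 0) L2ipB //; ring.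
Qed.
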